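(* The robust two-stage counterparts with two-stage continuous budgeted uncertainty of the following nominal problems are solvable in polynomial time: the representative selection problem, the selection problem, and the shortest path problem in series-parallel graphs.
   Context: Notation: $[n]=\{1,\dots,n\}$ and $\min\emptyset=\infty$. A nominal combinatorial optimization problem is given by a feasible set $\mathcal{X}_{\rm nom}\subseteq\{0,1\}^n$. Selection: $\mathcal{X}_{\rm nom}=\{x\in\{0,1\}^n:\sum_{i\in[n]}x_i=p\}$ for a constant $p$. Representative selection: $\mathcal{X}_{\rm nom}=\{x\in\{0,1\}^n:\sum_{i\in T_j}x_i=1,\ j\in[\ell]\}$ for a partition $T_1\cup\dots\cup T_\ell=[n]$. Shortest path: the items are the edges of a graph with terminals $s,t$ and $\mathcal{X}_{\rm nom}$ consists of the incidence vectors of $s$-$t$ paths. Put $\mathcal{X}=\{0,1\}^n$ and $\mathcal{X}(x)=\{y\in\{0,1\}^n: x+y\le\mathbf{1},\ x+y\in\mathcal{X}_{\rm nom}\}$. Two-stage continuous budgeted uncertainty: given $0\le\underline{c}_i\le\overline{c}_i$, $0\le\underline{d}_i\le\overline{d}_i$ ($i\in[n]$) and $\Gamma\ge0$, $$\mathcal{U}=\{c\in\mathbb{R}^n_+: c_i=\underline{c}_i+(\overline{c}_i-\underline{c}_i)\delta_i,\ \delta_i\in[0,1]\ \forall i\in[n],\ \textstyle\sum_{i}\delta_i\le\Gamma\},$$ $$\mathcal{U}(c)=\{d\in\mathbb{R}^n_+: d_i=\underline{d}_i+(\overline{d}_i-\underline{d}_i)\delta_i,\ \delta_i\in[0,1]\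 \forall i\in[n],\ \textstyle\sum_i\delta_i\le\Gamma-\sum_{i}\frac{c_i-\underline{c}_i}{\overline{c}_i-\underline{c}_i}\},$$ where a fraction with $\overline{c}_i=\underline{c}_i$ is read as $0$. The robust two-stage counterpart with this uncertainty is the problem $$\textsc{Rob}=\min_{x\in\mathcal{X}}\max_{c\in\mathcal{U}}\min_{y\in\mathcal{X}(x)}\max_{d\in\mathcal{U}(c)} c^tx+d^ty .$$ *)

(* Defs.v *)
From mathcomp Require Import all_boot all_order all_algebra.
From mathcomp Require Import all_classical all_reals ereal.

Set Implicit Arguments.
Unset Strict Implicit.
Unset Printing Implicit Defensive.

Import Order.TTheory GRing.Theory Num.Theory.

Local Open Scope ring_scope.

(** The machine model is a random access machine over the integers with
    logarithmic cost.  A program uses finitely many registers [reg 0], [reg 1],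
    ... and finitely many arrays [arr 0], [arr 1], ... of unbounded extent,
    which are accessed by indirect addressing.  Evaluating an expression is
    charged the bit length of every value that occurs in it (operands, array
    indices and results), so that running times are polynomially related to
    those of Turing machines. *)

(* Sign bit and binary digits. *)
Definition bitlen (z : int) : nat := (trunc_log 2 `|z|%N).+2.

Inductive expr :=
| Const of int
| Reg of nat
| Get of nat & expr
| Add of expr & expr
| Sub of expr & expr
| Mul of expr & expr.

Inductive prog :=
| Skip
| Assign of nat & expr
| Put of nat & expr & expr (* [Put a i e] is [arr a i := e] *)
| Seq of prog & prog
| If of expr & prog & prog   (* tests whether the expression is positive *)
| While of expr & prog.      (* same test *)

Record state := State { reg : nat -> int; arr : nat -> int -> int }.

Definition set_reg (st : state) (r : nat) (v : int) : state :=
  State (fun r' => if r' == r then v else reg st r') (arr st).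

Definition set_arr (st : state) (a : nat) (i v : int) : state :=
  State (reg st)
    (fun a' i' => if (a' == a) && (i' == i) then v else arr st a' i').

Fixpoint eval (st : state) (e : expr) : int :=
  match e with
  | Const z => z
  | Reg r => reg st r
  | Get a e1 => arr st a (eval st e1)
  | Add e1 e2 => eval st e1 + eval st e2
  | Sub e1 e2 => eval st e1 - eval st e2
  | Mul e1 e2 => eval st e1 * eval st e2
  end.

Fixpoint eval_cost (st : state) (e : expr) : nat :=
  (bitlen (eval st e) +
   match e with
   | Const _ | Reg _ => 0
   | Get _ e1 => eval_cost st e1
   | Add e1 e2 | Sub e1 e2 | Mul e1 e2 => eval_cost st e1 + eval_cost st e2
   end)%N.

(* [exec p st k st']: started in [st], the program [p] halts in [st'] after
   time [k]. *)
Inductive exec : prog -> state -> nat -> state -> Prop :=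
| exec_skip st : exec Skip st 1 st
| exec_assign r e st :
    exec (Assign r e) st (eval_cost st e).+1 (set_reg st r (eval st e))
| exec_put a i e st :
    exec (Put a i e) st (eval_cost st i + eval_cost st e).+1
      (set_arr st a (eval st i) (eval st e))
| exec_seq p q st k st' l st'' :
    exec p st k st' -> exec q st' l st'' -> exec (Seq p q) st (k + l).+1 st''
| exec_if_true e p q st k st' :
    0 < eval st e -> exec p st k st' ->
    exec (If e p q) st (eval_cost st e + k).+1 st'
| exec_if_false e p q st k st' :
    eval st e <= 0 -> exec q st k st' ->
    exec (If e p q) st (eval_cost st e + k).+1 st'
| exec_while_true e p st k st' l st'' :
    0 < eval st e -> exec p st k st' -> exec (While e p) st' l st'' ->
    exec (While e p) st (eval_cost st e + k + l).+1 st''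
| exec_while_false e p st :
    eval st e <= 0 -> exec (While e p) st (eval_cost st e).+1 st.

(* The input is stored in array 0 and its length in register 0; the output is
   read off array 1, its length being held in register 1. *)
Definition init (w : seq int) : state :=
  State (fun r => if r == 0%N then (size w)%:Z else 0)
        (fun a i => if (a == 0%N) && (0 <= i) then nth 0 w `|i|%N else 0).

Definition output (st : state) : seq int :=
  [seq arr st 1%N i%:Z | i <- iota 0 `|reg st 1%N|%N].

Definition input_size (w : seq int) : nat := \sum_(z <- w) bitlen z.

(* [promise] selects the legitimate instances, [enc] is their encoding, and
   [sol i w] says that [w] is a correct output for the instance [i]. *)
Definition poly_time_solvable (I : Type) (promise : I -> Prop)
    (enc : I -> seq int) (sol : I -> seq int -> Prop) : Prop :=
  exists (p : prog) (C k : nat), forall i : I, promise i ->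
    exists (t : nat) (st : state),
      [/\ exec p (init (enc i)) t st,
          (t <= C * (input_size (enc i)).+1 ^ k)%N
        & sol i (output st)].

(* Vectors of {0,1}^n; items are numbered from 0. *)
Notation bvec n := {ffun 'I_n -> bool}.

Record budget_data (K : Type) (n : nat) := BudgetData {
  c_lo : 'rV[K]_n;
  c_hi : 'rV[K]_n;
  d_lo : 'rV[K]_n;
  d_hi : 'rV[K]_n;
  Gam : K }.

Definition map_budget (K L : Type) (f : K -> L) (n : nat)
    (D : budget_data K n) : budget_data L n :=
  BudgetData (map_mx f (c_lo D)) (map_mx f (c_hi D))
             (map_mx f (d_lo D)) (map_mx f (d_hi D)) (f (Gam D)).

Definition budget_wf (K : numDomainType) (n : nat) (D : budget_data K n) :
    Prop :=
  [/\ forall i, 0 <= c_lo D 0 i <= c_hi D 0 i,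
      forall i, 0 <= d_lo D 0 i <= d_hi D 0 i
    & 0 <= Gam D].

Section Robust.
Local Open Scope classical_set_scope.
Variables (R : realType) (n : nat).

Definition budgeted_set (lo hi : 'rV[R]_n) (g : R) : set 'rV[R]_n :=
  [set c : 'rV[R]_n | (forall i, 0 <= c 0 i) /\
     exists delta : 'rV[R]_n,
       [/\ forall i, 0 <= delta 0 i <= 1,
           forall i, c 0 i = lo 0 i + (hi 0 i - lo 0 i) * delta 0 i
         & \sum_i delta 0 i <= g]].

Variable D : budget_data R n.

Definition U1 : set 'rV[R]_n := budgeted_set (c_lo D) (c_hi D) (Gam D).

(* A fraction with zero denominator is 0, since [0^-1 = 0]. *)
Definition U2 (c : 'rV[R]_n) : set 'rV[R]_n :=
  budgeted_set (d_lo D) (d_hi D)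
    (Gam D - \sum_i (c 0 i - c_lo D 0 i) / (c_hi D 0 i - c_lo D 0 i)).

Variable Xnom : set (bvec n).

Definition X2 (x : bvec n) : set (bvec n) :=
  [set y : bvec n | (forall i, (x i + y i <= 1)%N) /\
     exists2 z : bvec n, Xnom z & forall i, (z i : nat) = (x i + y i)%N].

Definition cost (c : 'rV[R]_n) (x : bvec n) : R := \sum_i c 0 i * (x i)%:R.

(* The worst-case cost of the first-stage solution [x].  The minimum over the
   empty set is [ereal_inf set0 = +oo]. *)
Definition rob_value (x : bvec n) : \bar R :=
  ereal_sup [set
    ereal_inf [set
      ereal_sup [set (cost c x + cost d y)%:E | d in U2 c]
    | y in X2 x]
  | c in U1].

Definition Rob : \bar R := ereal_inf [set rob_value x | x in [set: bvec n]].

End Robust.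

(* [nom_inst n] is the type of the combinatorial part of the instances with
   [n] items. *)
Record nominal := Nominal {
  nom_inst : nat -> Type;
  nom_wf : forall n, nom_inst n -> Prop;
  nom_feas : forall n, nom_inst n -> set (bvec n);
  nom_enc : forall n, nom_inst n -> seq int }.

Definition enc_rat (q : rat) : seq int := [:: numq q; denq q].

Definition enc_budget (n : nat) (D : budget_data rat n) : seq int :=
  enc_rat (Gam D) ++
  flatten [seq enc_rat (c_lo D 0 i) ++ enc_rat (c_hi D 0 i) ++
               enc_rat (d_lo D 0 i) ++ enc_rat (d_hi D 0 i)
          | i <- enum 'I_n].

(* Inputs are rational, whereas the uncertainty sets are sets of real
   vectors. *)
Record rob_inst (P : nominal) := RobInst {
  rob_n : nat;
  rob_nom : nom_inst P rob_n;
  rob_data : budget_data rat rob_n }.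

Definition rob_enc (P : nominal) (I : rob_inst P) : seq int :=
  (rob_n I)%:Z :: enc_budget (rob_data I) ++ nom_enc (rob_nom I).

Definition rob_wf (P : nominal) (I : rob_inst P) : Prop :=
  nom_wf (rob_nom I) /\ budget_wf (rob_data I).

(* To solve an instance is to report that it is infeasible (0), or to output 1,
   the optimal value as a fraction and an optimal first-stage solution. *)
Definition rob_sol (R : realType) (P : nominal) (I : rob_inst P)
    (w : seq int) : Prop :=
  let D := map_budget (ratr : rat -> R) (rob_data I) in
  let X := nom_feas (rob_nom I) in
  (Rob D X = +oo%E /\ w = [:: 0]) \/
  exists (a b : int) (x : bvec (rob_n I)),
    [/\ 0 < b,
        Rob D X = (a%:~R / b%:~R)%:E,
        rob_value D X x = Rob D X
      & w = [:: 1, a, b & [seq (x i : nat)%:Z | i <- enum 'I_(rob_n I)]]].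

Definition rob_poly_time (R : realType) (P : nominal) : Prop :=
  poly_time_solvable (@rob_wf P) (@rob_enc P) (@rob_sol R P).

Definition selection : nominal :=
  @Nominal (fun=> nat)
    (fun n p => True)
    (fun n p => [set x : bvec n | (\sum_i x i)%N = p]%classic)
    (fun n p => [:: p%:Z]).

(* The partition into [ell] parts is given by mapping each item to the index of
   its part. *)
Record rep_inst (n : nat) := RepInst {
  ell : nat;
  part_of : 'I_n -> 'I_ell }.

Definition part n (I : rep_inst n) (j : 'I_(ell I)) : {set 'I_n} :=
  [set i | part_of I i == j].
Arguments part [n] I j.

Definition rep_selection : nominal :=
  @Nominal rep_inst
    (fun n I => forall j, part I j <> finset.set0)
    (fun n I => [set x : bvec n |
                  forall j : 'I_(ell I), (\sum_(i in part I j) x i)%N = 1%N]%classic)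
    (fun n I => (ell I)%:Z :: [seq (part_of I i : nat)%:Z | i <- enum 'I_n]).

(* An undirected multigraph with vertex set ['I_nv] and terminals [src], [snk],
   whose edges are the items. *)
Record graph_inst (n : nat) := GraphInst {
  nv : nat;
  ends : 'I_n -> 'I_nv * 'I_nv;
  src : 'I_nv;
  snk : 'I_nv }.

Section Graph.
Variables (n : nat) (G : graph_inst n).

Definition joins (e : 'I_n) (u v : 'I_(nv G)) : bool :=
  (ends G e == (u, v)) || (ends G e == (v, u)).

(* [walk u es vs]: from [u], the edges [es] lead successively to the vertices
   [vs]. *)
Fixpoint walk (u : 'I_(nv G)) (es : seq 'I_n) (vs : seq 'I_(nv G)) : bool :=
  match es, vs with
  | [::], [::] => true
  | e :: es', v :: vs' => joins e u v && walk v es' vs'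
  | _, _ => false
  end.

Definition st_paths : set (bvec n) :=
  [set x | exists es vs,
     [/\ walk (src G) es vs, uniq (src G :: vs), last (src G) vs = snk G
       & x = [ffun e => e \in es]]]%classic.

Definition verts (A : {set 'I_n}) : {set 'I_(nv G)} :=
  [set v | [exists e in A, (v == (ends G e).1) || (v == (ends G e).2)]].

(* The subgraph with edge set [A] is series-parallel with terminals [s], [t]. *)
Inductive sp : {set 'I_n} -> 'I_(nv G) -> 'I_(nv G) -> Prop :=
| sp_edge e s t : s <> t -> joins e s t -> sp [set e] s t
| sp_series A B s m t :
    sp A s m -> sp B m t ->
    [disjoint A & B] -> verts A :&: verts B = [set m] ->
    sp (A :|: B) s t
| sp_parallel A B s t :
    sp A s t -> sp B s t ->
    [disjoint A & B] -> verts A :&: verts B = [set s; t] ->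
    sp (A :|: B) s t.

Definition series_parallel : Prop :=
  sp [set: 'I_n] (src G) (snk G) /\ verts [set: 'I_n] = [set: 'I_(nv G)].

End Graph.

Definition sp_shortest_path : nominal :=
  @Nominal graph_inst series_parallel st_paths
    (fun n G =>
       [:: (nv G)%:Z; (src G : nat)%:Z; (snk G : nat)%:Z] ++
       flatten [seq [:: ((ends G e).1 : nat)%:Z; ((ends G e).2 : nat)%:Z]
               | e <- enum 'I_n]).

(* Main.v *)
Require Import Defs.
From mathcomp Require Import all_boot all_order all_algebra.
From mathcomp Require Import zify ring lra.
Require Import Defs.

(** Fix a first-stage solution [x], an answer [y] to it and the amount [g] of
    the budget that the adversary spends in the first stage.  In both stages the
    adversary solves a fractional knapsack problem.  By duality ([capped_ub],
    [capped_tight]) the worst-case cost is the minimum, over a price [q] of the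
    budget in the first stage and a price [p] in the second, of an expression
    that is affine in [g]; moreover [q] may be restricted to 0 and the
    differences between the upper and lower bounds of [c], and [p] likewise for
    [d].  The robust value of [x] is therefore the maximum over an interval of
    the lower envelope of finitely many affine functions of [g], one for each
    triple of [q], [p] and [y].  Two of these functions suffice to determine
    this maximum ([line_minimax]), so it is the minimum, over two such triples,
    of an explicit value [pair_val] ([rob_value_le], [rob_value_ge]).

    There are only (n + 1)^4 choices of the four prices.  Once they are fixed,
    [pair_val] is a constant plus a linear function of [x] and of the two answers
    [y1] and [y2], and minimizing it amounts to choosing two solutions of the
    nominal problem at once, two plans, where each item has a price for being
    used by the first plan only, by the second only, or by both
    ([is_opt_triple]).  This two-plan problem is easy in all three cases.

    - In a series-parallel graph, three numbers per piece suffice: the cheapest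
      path for either plan alone and the cheapest pair of paths.  A series or
      parallel reduction anywhere in the graph preserves the numbers of the whole
      ([spl_reduce_series], [spl_reduce_parallel]), and a graph that admits
      none is a single edge ([spl_progress]).
    - A representative selection is a path along a chain of bunches of parallel
      edges, one for each part ([rep_label]).
    - For selection, a table is indexed by the number of items considered and
      the numbers of items chosen by the two plans ([table]).

    Only optimal values are computed in this way.  A solution [x] is recovered by
    scaling the prices by 2^n and adding distinct powers of two to those of the
    first stage, so that the optimal value spells out an optimal [x] in binary
    ([perturbed_opt]).

    For the running time, programs are written with counting loops only, and
    their correctness is proved by a weakest-precondition calculus [wp] with two
    extra obligations for a parameter [B]: loops make at most [B] rounds, and
    each product has a factor of at most [B] bits.  This bounds the running time
    by a polynomial in [B] ([wp_poly_time]), and a [B] quadratic in the length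
    of the input suffices. *)

Set Implicit Arguments.
Unset Strict Implicit.
Unset Printing Implicit Defensive.

Import Order.TTheory GRing.Theory Num.Theory.

Local Open Scope ring_scope.

(** * Counting-loop programs and their running time *)

(** A loop here makes a number of rounds that is fixed when it is entered.  The
    time of a program is then polynomial in the lengths of the loops and of the
    numbers, and proofs about it need neither termination arguments nor explicit
    costs. *)
Inductive cmd :=
| CSkip
| CAsgn of nat & expr
| CPut of nat & expr & expr
| CSeq of cmd & cmd
| CIf of expr & cmd & cmd
| CFor of nat & nat & expr & cmd.

(** [CFor r l e c] runs [c] with [r] counting up from 0 to the initial value
    of [e], which is kept in [l]. *)
Fixpoint compile (c : cmd) : prog :=
  match c with
  | CSkip => Skip
  | CAsgn r e => Assign r e
  | CPut a i e => Put a i e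
  | CSeq c1 c2 => Seq (compile c1) (compile c2)
  | CIf e c1 c2 => If e (compile c1) (compile c2)
  | CFor r l e c =>
      Seq (Assign l e) (Seq (Assign r (Const 0))
        (While (Sub (Reg l) (Reg r))
           (Seq (compile c) (Assign r (Add (Reg r) (Const 1))))))
  end.

Fixpoint mregs (c : cmd) : seq nat :=
  match c with
  | CSkip | CPut _ _ _ => [::]
  | CAsgn r _ => [:: r]
  | CSeq c1 c2 | CIf _ c1 c2 => mregs c1 ++ mregs c2
  | CFor r l _ c => [:: r, l & mregs c]
  end.

Fixpoint marrs (c : cmd) : seq nat :=
  match c with
  | CSkip | CAsgn _ _ => [::]
  | CPut a _ _ => [:: a]
  | CSeq c1 c2 | CIf _ c1 c2 => marrs c1 ++ marrs c2
  | CFor _ _ _ c => marrs c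
  end.

(** The counter of a loop and the register holding its bound must be out of
    reach of the body, or else the number of rounds would not be fixed. *)
Fixpoint wfc (c : cmd) : bool :=
  match c with
  | CSkip | CAsgn _ _ | CPut _ _ _ => true
  | CSeq c1 c2 | CIf _ c1 c2 => wfc c1 && wfc c2
  | CFor r l _ c => [&& r != l, r \notin mregs c, l \notin mregs c & wfc c]
  end.

(** Additions lengthen the binary representation of a number by one bit, but a
    loop of unrestricted multiplications doubles it in each round.  Requiring
    one factor of each product to have at most [B] bits keeps the growth
    linear in the number of operations. *)
Fixpoint okE (B : nat) (st : state) (e : expr) : bool :=
  match e with
  | Const _ | Reg _ => true
  | Get _ e1 => okE B st e1
  | Add e1 e2 | Sub e1 e2 => okE B st e1 && okE B st e2
  | Mul e1 e2 =>
      [&& okE B st e1, okE B st e2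
        & (`|eval st e1| <= 2 ^ B)%N || (`|eval st e2| <= 2 ^ B)%N]
  end.

Fixpoint wp_loop (f : (state -> Prop) -> state -> Prop) (r m i : nat)
    (Q : state -> Prop) (st : state) : Prop :=
  match m with
  | 0%N => Q st
  | m'.+1 => f (fun s => wp_loop f r m' i.+1 Q (set_reg s r i.+1%:Z)) st
  end.

(** Besides the postcondition, the weakest precondition guarantees the two
    resource bounds that make the running time polynomial in [B]. *)
Fixpoint wp (B : nat) (c : cmd) (Q : state -> Prop) (st : state) : Prop :=
  match c with
  | CSkip => Q st
  | CAsgn r e => okE B st e /\ Q (set_reg st r (eval st e))
  | CPut a i e =>
      [/\ okE B st i, okE B st e & Q (set_arr st a (eval st i) (eval st e))]
  | CSeq c1 c2 => wp B c1 (wp B c2 Q) st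
  | CIf e c1 c2 =>
      okE B st e /\ (if 0 < eval st e then wp B c1 Q st else wp B c2 Q st)
  | CFor r l e c =>
      [/\ okE B st e, 0 <= eval st e <= B%:Z
        & wp_loop (wp B c) r `|eval st e|%N 0 Q
            (set_reg (set_reg st l (eval st e)) r 0)]
  end.

Definition same (rs bs : seq nat) (st st' : state) : Prop :=
  (forall r, r \notin rs -> reg st' r = reg st r) /\
  (forall a, a \notin bs -> forall i, arr st' a i = arr st a i).

Lemma same_refl rs bs st : same rs bs st st.
Proof. by []. Qed.

Lemma same_trans rs bs rs' bs' rs'' bs'' s1 s2 s3 :
  {subset rs <= rs''} -> {subset rs' <= rs''} ->
  {subset bs <= bs''} -> {subset bs' <= bs''} ->
  same rs bs s1 s2 -> same rs' bs' s2 s3 -> same rs'' bs'' s1 s3.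
Proof.
move=> h1 h2 h3 h4 [r1 a1] [r2 a2]; split=> [r hr|a ha i].
  by rewrite r2 ?r1 //; apply: contra hr; [apply: h1|apply: h2].
by rewrite a2 ?a1 //; apply: contra ha; [apply: h3|apply: h4].
Qed.

Lemma wp_loop_mono f r m i (Q Q' : state -> Prop) st :
  (forall (P P' : state -> Prop) s, (forall s', P s' -> P' s') ->
     f P s -> f P' s) ->
  (forall s, Q s -> Q' s) -> wp_loop f r m i Q st -> wp_loop f r m i Q' st.
Proof.
move=> hf hQ; elim: m i st => [|m IH] i st /=; first exact: hQ.
by apply: hf => s; apply: IH.
Qed.

Lemma wp_mono B c (Q Q' : state -> Prop) st :
  (forall s, Q s -> Q' s) -> wp B c Q st -> wp B c Q' st.
Proof.
elim: c Q Q' st => [|r e|a i e|c1 IH1 c2 IH2|e c1 IH1 c2 IH2|r l e c IH] Q Q' st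
    hQ /=.
- exact: hQ.
- by case=> ? /hQ.
- by case=> ? ? /hQ.
- by apply: IH1 => s; apply: IH2.
- by case=> ? h; split=> //; move: h; case: ifP => _; [apply: IH1|apply: IH2].
- by case=> ? ? h; split=> //; apply: wp_loop_mono h => // P P' s hP; apply: IH.
Qed.

Lemma same_set_reg rs bs st r v : r \in rs -> same rs bs st (set_reg st r v).
Proof. by move=> hr; split=> //= r'; case: eqP => // ->; rewrite hr. Qed.

Lemma same_sub rs bs rs' bs' s s' :
  {subset rs <= rs'} -> {subset bs <= bs'} -> same rs bs s s' ->
  same rs' bs' s s'.
Proof.
move=> h1 h2 h; apply: (same_trans h1 h1 h2 h2 (same_refl _ _ _) h).
Qed.

(** The frame property.  It can be added to every postcondition, so that no
    invariant has to list what stays the same. *)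
Lemma wp_same B c (Q : state -> Prop) st :
  wp B c Q st -> wp B c (fun s => same (mregs c) (marrs c) st s /\ Q s) st.
Proof.
elim: c Q st => [|r e|a i e|c1 IH1 c2 IH2|e c1 IH1 c2 IH2|r l e c IH] Q st /=.
- by move=> h; split; first exact: same_refl.
- by case=> ? ?; do 2!split=> //; apply: same_set_reg; rewrite inE.
- case=> ? ? ?; split=> //; split=> //; split=> //= a'; rewrite inE.
  by move=> /negbTE->.
- move=> /IH1; apply: wp_mono => s [h1 /IH2]; apply: wp_mono => s' [h2 ?].
  split=> //.
  by apply: same_trans h1 h2 => x hx; rewrite mem_cat hx ?orbT.
- case=> ? h; split=> //; move: h; case: ifP => _.
    move=> /IH1; apply: wp_mono => s [h ?]; split=> //.
    by apply: same_sub h => x hx; rewrite mem_cat hx.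
  move=> /IH2; apply: wp_mono => s [h ?]; split=> //.
  by apply: same_sub h => x hx; rewrite mem_cat hx orbT.
- case=> ? ?; set rs := [:: r, l & _]; set st1 := set_reg _ r _ => h.
  split=> //.
  have : same rs (marrs c) st st1.
    apply: (same_trans (s2 := set_reg st l (eval st e))
             (rs := rs) (rs' := rs) (bs := marrs c) (bs' := marrs c)) => //.
      by apply: same_set_reg; rewrite !inE eqxx orbT.
    by apply: same_set_reg; rewrite inE eqxx.
  move: h; move: st1 (`|_|%N) 0%N => st1 m.
  elim: m st1 => [|m IHm] st1 i //= h hs.
  move/IH: h; apply: wp_mono => s [h /IHm]; apply.
  apply: (same_trans (s2 := s)
             (rs := rs) (rs' := rs) (bs := marrs c) (bs' := marrs c)) => //.
    apply: (same_trans (rs' := mregs c) (bs' := marrs c) _ _ _ _ hs h) => // x.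
    by rewrite /rs !inE => ->; rewrite !orbT.
  by apply: same_set_reg; rewrite inE eqxx.
Qed.

Definition bounded (b : nat) (st : state) : Prop :=
  (forall r, `|reg st r| <= 2 ^ b)%N /\ (forall a i, `|arr st a i| <= 2 ^ b)%N.

Lemma bounded_leq b b' st : (b <= b')%N -> bounded b st -> bounded b' st.
Proof.
move=> h [h1 h2]; have hb : (2 ^ b <= 2 ^ b')%N by rewrite leq_exp2l.
by split=> *; apply: leq_trans hb.
Qed.

Lemma bounded_set_reg b st r v :
  bounded b st -> (`|v| <= 2 ^ b)%N -> bounded b (set_reg st r v).
Proof. by move=> [h1 h2] hv; split=> //= r'; case: ifP. Qed.

Lemma bounded_set_arr b st a i v :
  bounded b st -> (`|v| <= 2 ^ b)%N -> bounded b (set_arr st a i v).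
Proof. by move=> [h1 h2] hv; split=> //= a' i'; case: ifP. Qed.

Lemma bitlen_le b z : (`|z| <= 2 ^ b)%N -> (bitlen z <= b.+2)%N.
Proof.
move=> h; rewrite /bitlen !ltnS; apply: leq_trans (leq_trunc_log 2 h) _.
by rewrite trunc_expnK.
Qed.

Fixpoint esize (e : expr) : nat :=
  match e with
  | Const z => `|z|.+1
  | Reg _ => 1
  | Get _ e1 => (esize e1).+1
  | Add e1 e2 | Sub e1 e2 | Mul e1 e2 => (esize e1 + esize e2).+1
  end.

Lemma leq_pow2 m n k : (k <= 2 ^ m)%N -> (m <= n)%N -> (k <= 2 ^ n)%N.
Proof. by move=> h hmn; apply: leq_trans h _; rewrite leq_exp2l. Qed.

Lemma eval_bound B b st e : bounded b st -> okE B st e ->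
  (`|eval st e| <= 2 ^ (b + esize e * B.+1))%N.
Proof.
move=> [hr ha]; elim: e => [z|r|a e1 IH|e1 IH1 e2 IH2|e1 IH1 e2 IH2
    |e1 IH1 e2 IH2] /=.
- move=> _; apply: (leq_pow2 (m := `|z|)); last by nia.
  exact: ltnW (ltn_expl _ _).
- by move=> _; apply: leq_pow2 (hr r) _; nia.
- by move=> _; apply: leq_pow2 (ha a _) _; nia.
- move=> /andP[/IH1 h1 /IH2 h2].
  apply: (leq_pow2 (m := (b + (esize e1 + esize e2) * B.+1).+1)); last by nia.
  have := leq_pow2 h1 (_ : _ <= b + (esize e1 + esize e2) * B.+1)%N.
  have := leq_pow2 h2 (_ : _ <= b + (esize e1 + esize e2) * B.+1)%N.
  rewrite expnS; lia.
- move=> /andP[/IH1 h1 /IH2 h2].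
  apply: (leq_pow2 (m := (b + (esize e1 + esize e2) * B.+1).+1)); last by nia.
  have := leq_pow2 h1 (_ : _ <= b + (esize e1 + esize e2) * B.+1)%N.
  have := leq_pow2 h2 (_ : _ <= b + (esize e1 + esize e2) * B.+1)%N.
  rewrite expnS; lia.
- move=> /and3P[/IH1 h1 /IH2 h2 /orP[h|h]]; rewrite abszM.
    apply: (leq_pow2 (m := B + (b + esize e2 * B.+1))); last by nia.
    by rewrite expnD leq_mul.
  apply: (leq_pow2 (m := (b + esize e1 * B.+1) + B)); last by nia.
  by rewrite expnD leq_mul.
Qed.

Lemma eval_cost_bound B b L st e : bounded b st -> okE B st e ->
  (b + esize e * B.+1 <= L)%N -> (eval_cost st e <= esize e * L.+2)%N.
Proof.
move=> hb; elim: e => [z|r|a e1 IH|e1 IH1 e2 IH2|e1 IH1 e2 IH2|e1 IH1 e2 IH2].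
all: move=> he hL; have := bitlen_le (leq_pow2 (eval_bound hb he) hL).
- by rewrite /= => h; nia.
- by rewrite /= => h; nia.
- move: he hL => /= he hL; have := IH he; rewrite mulSn; lia.
- move: he hL => /= /andP[h1 h2] hL; have := IH1 h1; have := IH2 h2.
  by rewrite mulSn mulnDl; lia.
- move: he hL => /= /andP[h1 h2] hL; have := IH1 h1; have := IH2 h2.
  by rewrite mulSn mulnDl; lia.
- move: he hL => /= /and3P[h1 h2 _] hL; have := IH1 h1; have := IH2 h2.
  by rewrite mulSn mulnDl; lia.
Qed.

(** A bound on the number of elementary operations when no loop makes more than
    [B] rounds.  It controls both resources: each operation lengthens the
    numbers by at most [B.+1] bits, and costs at most the length of the longest
    number.  The constants account for the control of the loops. *)
Fixpoint steps (B : nat) (c : cmd) : nat :=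
  match c with
  | CSkip => 1
  | CAsgn _ e => (esize e).+1
  | CPut _ i e => (esize i + esize e).+1
  | CSeq c1 c2 => (steps B c1 + steps B c2).+1
  | CIf e c1 c2 => (esize e + steps B c1 + steps B c2).+1
  | CFor _ _ e c => (esize e + B * (steps B c + 11) + 13)%N
  end.

(** [L] bounds the length of all numbers at the end of the run, hence at any
    time before.  Fixing it in advance keeps the time bound additive along the
    induction. *)
Lemma wp_sound B c (Q : state -> Prop) st b L :
  wfc c -> wp B c Q st -> bounded b st -> (b + steps B c * B.+1 <= L)%N ->
  exists (t : nat) (st' : state),
    [/\ exec (compile c) st t st', Q st',
        bounded (b + steps B c * B.+1) st' & (t <= steps B c * L.+3)%N].
Proof.
elim: c Q st b => [|r e|a i e|c1 IH1 c2 IH2|e c1 IH1 c2 IH2|r l e c IH] Q st b.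
- move=> _ /= hQ hb hL; exists 1%N, st; split=> //; first exact: exec_skip.
  by apply: bounded_leq hb; lia.
- move=> _ /= [he hQ] hb hL.
  have hE : (b + esize e * B.+1 <= L)%N by nia.
  exists (eval_cost st e).+1, (set_reg st r (eval st e)); split=> //.
  + exact: exec_assign.
  + apply: bounded_set_reg; first by apply: bounded_leq hb; lia.
    by apply: leq_pow2 (eval_bound hb he) _; nia.
  + by have := eval_cost_bound hb he hE; nia.
- move=> _ /= [hi he hQ] hb hL.
  have hE : (b + esize e * B.+1 <= L)%N by nia.
  have hI : (b + esize i * B.+1 <= L)%N by nia.
  exists (eval_cost st i + eval_cost st e).+1,
    (set_arr st a (eval st i) (eval st e)); split=> //.
  + exact: exec_put.
  + apply: bounded_set_arr; first by apply: bounded_leq hb; lia.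
    by apply: leq_pow2 (eval_bound hb he) _; nia.
  + by have := eval_cost_bound hb he hE; have := eval_cost_bound hb hi hI; nia.
- move=> /= /andP[w1 w2] h hb hL.
  have [t1 [s1 [x1 q1 b1 k1]]] := IH1 _ _ _ w1 h hb ltac:(nia).
  have [t2 [s2 [x2 q2 b2 k2]]] := IH2 _ _ _ w2 q1 b1 ltac:(nia).
  exists (t1 + t2).+1, s2; split=> //; first exact: exec_seq x1 x2.
    by apply: bounded_leq b2; nia.
  by nia.
- move=> /= /andP[w1 w2] [he h] hb hL.
  have hE : (b + esize e * B.+1 <= L)%N by nia.
  have kE := eval_cost_bound hb he hE.
  move: h; case: ltP => h0 h.
    have [t1 [s1 [x1 q1 b1 k1]]] := IH1 _ _ _ w1 h hb ltac:(nia).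
    exists (eval_cost st e + t1).+1, s1; split=> //; first exact: exec_if_true.
      by apply: bounded_leq b1; nia.
    by nia.
  have [t1 [s1 [x1 q1 b1 k1]]] := IH2 _ _ _ w2 h hb ltac:(nia).
  exists (eval_cost st e + t1).+1, s1; split=> //; first exact: exec_if_false.
    by apply: bounded_leq b1; nia.
  by nia.
- move=> /= /and4P[hrl hr hl hc] [he hk h] hb hL.
  set w := While _ _.
  have oT s : okE B s (Sub (Reg l) (Reg r)) by [].
  have loop m i s b' : wp_loop (wp B c) r m i Q s -> bounded b' s ->
      reg s r = i%:Z -> reg s l = (m + i)%:Z ->
      (b' + (m * (steps B c + 8) + 4) * B.+1 <= L)%N ->
      exists t s', [/\ exec w s t s', Q s',
        bounded (b' + (m * (steps B c + 8)) * B.+1) s'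
        & (t <= (m * (steps B c + 8) + 4) * L.+3)%N].
    elim: m i s b' => [|m IHm] i s b' hQ bs ri rl bL.
      have hT := eval_cost_bound bs (oT s) (L := L) ltac:(simpl; nia).
      exists (eval_cost s (Sub (Reg l) (Reg r))).+1, s; split=> //.
      + by apply: exec_while_false; rewrite /= ri rl; lia.
      + by apply: bounded_leq bs; nia.
      + by move: hT => /=; nia.
    have hT := eval_cost_bound bs (oT s) (L := L) ltac:(simpl; nia).
    have [t1 [s1 [x1 [[sm _] q1] b1 k1]]] :=
      IH _ _ _ hc (wp_same hQ) bs ltac:(nia).
    have r1 : reg s1 r = i%:Z by rewrite sm.
    have l1 : reg s1 l = (m.+1 + i)%:Z by rewrite sm.
    set s2 := set_reg s1 r i.+1.
    have e2 : eval s1 (Add (Reg r) (Const 1)) = i.+1%:Z by rewrite /= r1; lia.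
    have o2 : okE B s1 (Add (Reg r) (Const 1)) by [].
    have hT2 := eval_cost_bound (L := L) b1 o2 ltac:(simpl; nia).
    have v2 := eval_bound b1 o2.
    have b2 : bounded (b' + (steps B c + 8) * B.+1) s2.
      apply: bounded_set_reg; first by apply: bounded_leq b1; nia.
      by rewrite -e2; apply: leq_pow2 v2 _; simpl; nia.
    have r2 : reg s2 r = i.+1%:Z by rewrite /= eqxx.
    have l2 : reg s2 l = (m + i.+1)%:Z.
      by rewrite /= eq_sym (negbTE hrl) l1 addSnnS.
    have [t3 [s3 [x3 q3 b3 k3]]] := IHm i.+1 s2 _ q1 b2 r2 l2
       ltac:(move: bL; rewrite !mulSn !mulnDl; lia).
    exists (eval_cost s (Sub (Reg l) (Reg r))
      + (t1 + (eval_cost s1 (Add (Reg r) (Const 1))).+1).+1 + t3).+1, s3.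
    split=> //.
    + apply: exec_while_true x3; first by rewrite /= ri rl; lia.
      by apply: exec_seq x1 _; rewrite /s2 -e2; apply: exec_assign.
    + by apply: bounded_leq b3; rewrite !mulSn !mulnDl; lia.
    + have : (eval_cost s (Sub (Reg l) (Reg r)) <= 3 * L.+2)%N by exact: hT.
      have : (eval_cost s1 (Add (Reg r) (Const 1)) <= 4 * L.+2)%N by exact: hT2.
      move: k1 k3; rewrite mulSn !mulnDl.
      move: (eval_cost s _) (eval_cost s1 _) (_ * L.+3)%N (_ * L.+3)%N.
      move=> u v y z; lia.
  have hE : (b + esize e * B.+1 <= L)%N by nia.
  have kE := eval_cost_bound hb he hE.
  have b1 : bounded (b + esize e * B.+1) (set_reg (set_reg st l (eval st e)) r 0).
    apply: bounded_set_reg => //; apply: bounded_set_reg (eval_bound hb he).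
    by apply: bounded_leq hb; nia.
  have [m hm] : exists m : nat, eval st e = m%:Z by exists `|eval st e|%N; lia.
  have [t [s' [x q b' k]]] := loop _ _ _ _ h b1 ltac:(by rewrite /= eqxx)
       ltac:(rewrite /= eq_sym (negbTE hrl) eqxx; lia) ltac:(nia).
  exists ((eval_cost st e).+1
      + ((eval_cost (set_reg st l (eval st e)) (Const 0)).+1 + t).+1).+1, s'.
  split=> //.
  + apply: exec_seq; first exact: exec_assign.
    by apply: exec_seq x; apply: exec_assign.
  + by apply: bounded_leq b'; nia.
  + have -> : eval_cost (set_reg st l (eval st e)) (Const 0) = 2%N.
      by rewrite /= /bitlen absz0 trunc_log0.
    move: k kE; rewrite hm /= => k kE.
    have hmB : (m <= B)%N by lia.
    have : (m * (steps B c + 8) <= B * (steps B c + 11))%N by nia.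
    move: (B * _)%N (m * _)%N k => u v k huv; nia.
Qed.

(** A loop multiplies the bound for its body by the number of rounds, which
    raises the degree by one. *)
Lemma steps_poly c : exists C k, forall B, (steps B c <= C * B.+1 ^ k)%N.
Proof.
elim: c => [|r e|a i e|c1 [C1 [k1 h1]] c2 [C2 [k2 h2]]
    |e c1 [C1 [k1 h1]] c2 [C2 [k2 h2]]|r l e c [C [k h]]] /=.
- by exists 1%N, 0%N => B; rewrite expn0.
- by exists (esize e).+1, 0%N => B; rewrite expn0 muln1.
- by exists (esize i + esize e).+1, 0%N => B; rewrite expn0 muln1.
- exists (C1 + C2).+1, (k1 + k2)%N => B; move: (h1 B) (h2 B).
  rewrite expnD; have := expn_gt0 B.+1 k1; have := expn_gt0 B.+1 k2.
  move: (_ ^ k1)%N (_ ^ k2)%N => u v; rewrite /= => hu hv g1 g2.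
  have : (C1 * u <= C1 * (u * v))%N by nia.
  have : (C2 * v <= C2 * (u * v))%N by nia.
  have : (0 < u * v)%N by nia.
  by move: (u * v)%N => y; nia.
- exists (esize e + C1 + C2).+1, (k1 + k2)%N => B; move: (h1 B) (h2 B).
  rewrite expnD; have := expn_gt0 B.+1 k1; have := expn_gt0 B.+1 k2.
  move: (_ ^ k1)%N (_ ^ k2)%N => u v; rewrite /= => hu hv g1 g2.
  have : (C1 * u <= C1 * (u * v))%N by nia.
  have : (C2 * v <= C2 * (u * v))%N by nia.
  have : (0 < u * v)%N by nia.
  by move: (u * v)%N => y; nia.
- exists (esize e + C + 24)%N, k.+1 => B; move: (h B).
  rewrite expnS; have := expn_gt0 B.+1 k; move: (_ ^ k)%N => u /= hu g.
  by nia.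
Qed.

(** Everything that follows establishes running times through this lemma: it
    suffices to prove that a program is correct with a [B] that is polynomial in
    the length of the input. *)
Lemma wp_poly_time c : wfc c -> exists C k, forall B (Q : state -> Prop) st,
  wp B c Q st -> bounded B st ->
  exists t st', [/\ exec (compile c) st t st', Q st'
    & (t <= C * B.+1 ^ k)%N].
Proof.
move=> wc; have [C [k hs]] := steps_poly c.
exists (C * (C + 3))%N, (k + k + 1)%N => B Q st h hb.
have [t [st' [x q _ ht]]] := wp_sound wc h hb (leqnn _).
exists t, st'; split=> //; apply: leq_trans ht _.
move: (hs B); rewrite addn1 expnS expnD; have := expn_gt0 B.+1 k.
move: (_ ^ k)%N (steps _ _) => u s /= hu hsu.
apply: (@leq_trans (C * u * ((C * u + 3) * B.+1))); last first.
  have : (C * u + 3 <= (C + 3) * u)%N by nia.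
  by move=> /(leq_mul (leqnn (C * u * B.+1))); nia.
by apply: leq_mul => //; nia.
Qed.

Lemma wp_seq B c1 c2 Q st : wp B c1 (wp B c2 Q) st -> wp B (CSeq c1 c2) Q st.
Proof. by []. Qed.

Lemma wp_asgn B r e (Q : state -> Prop) st :
  okE B st e -> Q (set_reg st r (eval st e)) -> wp B (CAsgn r e) Q st.
Proof. by []. Qed.

Lemma wp_put B a i e (Q : state -> Prop) st :
  okE B st i -> okE B st e -> Q (set_arr st a (eval st i) (eval st e)) ->
  wp B (CPut a i e) Q st.
Proof. by []. Qed.

Lemma wp_skip B (Q : state -> Prop) st : Q st -> wp B CSkip Q st.
Proof. by []. Qed.

Lemma wp_if B e c1 c2 Q st :
  okE B st e -> (0 < eval st e -> wp B c1 Q st) ->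
  (eval st e <= 0 -> wp B c2 Q st) -> wp B (CIf e c1 c2) Q st.
Proof. by move=> he h1 h2; split=> //; case: ltP. Qed.

(** The loop rule supplies for free what the body cannot change, so that
    invariants only have to speak of the variables that the body assigns. *)
Lemma wp_for (Inv : nat -> state -> Prop) (k : nat) B r l e c Q st :
  okE B st e -> eval st e = k%:Z -> (k <= B)%N ->
  Inv 0%N (set_reg (set_reg st l k%:Z) r 0) ->
  (forall i s, (i < k)%N -> reg s r = i%:Z ->
     same [:: r, l & mregs c] (marrs c) st s -> Inv i s ->
     wp B c (fun s' => Inv i.+1 (set_reg s' r i.+1%:Z)) s) ->
  (forall s, same [:: r, l & mregs c] (marrs c) st s -> Inv k s -> Q s) ->
  wp B (CFor r l e c) Q st.
Proof.
move=> he ek kB h0 hS hQ; split=> //; first by rewrite ek; lia.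
rewrite ek absz_nat; set st0 := set_reg _ r 0.
have : same [:: r, l & mregs c] (marrs c) st st0.
  apply: (same_trans (s2 := set_reg st l k%:Z)
     (rs := [:: r, l & mregs c]) (rs' := [:: r, l & mregs c])
     (bs := marrs c) (bs' := marrs c)) => //.
    by apply: same_set_reg; rewrite !inE eqxx orbT.
  by apply: same_set_reg; rewrite inE eqxx.
have : reg st0 r = 0%:Z by rewrite /= eqxx.
move: h0; rewrite -/st0.
have : (0 + k = k)%N by [].
move: {1 2 3 4}0%N {1 3}k st0 => i m st0; elim: m i st0 => [|m IH] i st0 /= him hI hr hs.
  by apply: hQ => //; rewrite addn0 in him; rewrite -him.
have hik : (i < k)%N by lia.
apply: wp_mono (wp_same (hS i st0 hik hr hs hI)) => s [hss hIs].
apply: IH => //; first by lia.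
  by rewrite /= eqxx.
apply: (same_trans (s2 := s)
     (rs := [:: r, l & mregs c]) (rs' := [:: r, l & mregs c])
     (bs := marrs c) (bs' := marrs c)) => //.
  apply: (same_trans (rs' := mregs c) (bs' := marrs c) _ _ _ _ hs hss) => // x.
  by rewrite !inE => ->; rewrite !orbT.
by apply: same_set_reg; rewrite inE eqxx.
Qed.

Lemma wp_frame B c (P Q : state -> Prop) st : wp B c P st ->
  (forall st', same (mregs c) (marrs c) st st' -> P st' -> Q st') ->
  wp B c Q st.
Proof. by move=> /wp_same h hQ; apply: wp_mono h => s' []; apply: hQ. Qed.

Lemma sameR rs bs st st' r : same rs bs st st' -> r \notin rs ->
  reg st' r = reg st r.
Proof. by case=> h _; apply: h. Qed.

Lemma sameA rs bs st st' a i : same rs bs st st' -> a \notin bs ->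
  arr st' a i = arr st a i.
Proof. by case=> _ h ?; apply: h. Qed.

Arguments wp : simpl never.

(** * Labelled series-parallel graphs *)

(** The label of a series-parallel piece holds the minimum cost of a path for
    the first plan only, of a path for the second plan only, and of a pair of
    paths, one for each plan. *)
Record label := Label { lab1 : int; lab2 : int; lab12 : int }.

Definition lser (X Y : label) : label :=
  Label (lab1 X + lab1 Y) (lab2 X + lab2 Y) (lab12 X + lab12 Y).

(** In a parallel composition the two plans choose their sides independently;
    when they choose different sides, no edge is shared, which gives the mixed
    sums. *)
Definition lpar (X Y : label) : label :=
  Label (Num.min (lab1 X) (lab1 Y)) (Num.min (lab2 X) (lab2 Y))
    (Num.min (Num.min (lab12 X) (lab12 Y))
             (Num.min (lab1 X + lab2 Y) (lab2 X + lab1 Y))).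

Definition lzero : label := Label 0 0 0.

Lemma lser0 X : lser X lzero = X.
Proof. by case: X => *; rewrite /lser /= !addr0. Qed.

Lemma lserA X Y Z : lser X (lser Y Z) = lser (lser X Y) Z.
Proof. by rewrite /lser /= !addrA. Qed.

Lemma lserC X Y : lser X Y = lser Y X.
Proof. by rewrite /lser; congr Label; exact: addrC. Qed.

Lemma lparC X Y : lpar X Y = lpar Y X.
Proof. by rewrite /lpar; congr Label; lia. Qed.

Lemma lparA X Y Z : lpar X (lpar Y Z) = lpar (lpar X Y) Z.
Proof.
have ext (a b : int) : (forall w, (w <= a) = (w <= b)) -> a = b.
  by move=> h; apply/eqP; rewrite eq_le -h lexx h lexx.
rewrite /lpar /=; congr Label; apply: ext => w.
- by rewrite !le_min andbA.
- by rewrite !le_min andbA.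
- by rewrite !addr_minr !addr_minl !le_min -!andbA; do !bool_congr.
Qed.

Section LabelledSP.
Variables (I : finType) (T : eqType).
Implicit Types (E : I -> T * T) (F : I -> label) (A B : {set I}).

Definition ejoins E e (u v : T) : bool := (E e == (u, v)) || (E e == (v, u)).
Definition einc E e (v : T) : bool := ((E e).1 == v) || ((E e).2 == v).
Definition vert E A (v : T) : Prop := exists2 e, e \in A & einc E e v.

(** The ends [E] and the labels [F] of the edges are arbitrary functions, so
    that graphs whose edges stand for whole pieces of another graph are covered.
    The last argument is the label of the graph.  Reductions will be seen to
    leave it unchanged, so that it is independent of the decomposition. *)
Inductive spl E F : {set I} -> T -> T -> label -> Prop :=
| spl_edge e s t : s <> t -> ejoins E e s t -> spl E F [set e] s t (F e)
| spl_series A B s m t X Y :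
    spl E F A s m X -> spl E F B m t Y -> [disjoint A & B] ->
    (forall v, vert E A v -> vert E B v -> v = m) ->
    spl E F (A :|: B) s t (lser X Y)
| spl_parallel A B s t X Y :
    spl E F A s t X -> spl E F B s t Y -> [disjoint A & B] ->
    (forall v, vert E A v -> vert E B v -> v = s \/ v = t) ->
    spl E F (A :|: B) s t (lpar X Y).

Lemma disjointsU1 (a : I) A B :
  [disjoint a |: A & B] = (a \notin B) && [disjoint A & B].
Proof. by rewrite !disjoints_subset subUset sub1set inE. Qed.

Lemma ejoins_sym E e u v : ejoins E e u v = ejoins E e v u.
Proof. by rewrite /ejoins orbC. Qed.

Lemma ejoins_inc E e u v w : ejoins E e u v -> einc E e w = (w == u) || (w == v).
Proof.
by rewrite /ejoins /einc => /orP[] /eqP->; rewrite /= ?[u == w]eq_sym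
  ?[v == w]eq_sym // orbC.
Qed.

Lemma ejoins_incl E e u v : ejoins E e u v -> einc E e u.
Proof. by move=> /ejoins_inc->; rewrite eqxx. Qed.

Lemma ejoins_incr E e u v : ejoins E e u v -> einc E e v.
Proof. by move=> /ejoins_inc->; rewrite eqxx orbT. Qed.

Lemma ejoins_inj E e u v w : ejoins E e u w -> ejoins E e v w -> u = v.
Proof.
rewrite /ejoins => /orP[] /eqP-> /orP[] /eqP[] //.
  by move=> -> ->.
by move=> -> ->.
Qed.

Lemma vertU E A B v : vert E (A :|: B) v <-> vert E A v \/ vert E B v.
Proof.
split=> [[e]|[] [e he hv]]; last 2 first.
- by exists e; rewrite ?inE ?he.
- by exists e; rewrite ?inE ?he ?orbT.
by rewrite inE => /orP[] he hv; [left|right]; exists e.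
Qed.

Lemma vert1 E e v : vert E [set e] v <-> einc E e v.
Proof.
by split=> [[e']|h]; [rewrite inE => /eqP->|exists e; rewrite ?inE].
Qed.

Lemma spl_cast E F A A' s t X X' :
  spl E F A s t X -> A = A' -> X = X' -> spl E F A' s t X'.
Proof. by move=> h <- <-. Qed.

Lemma spl_facts E F A s t X : spl E F A s t X ->
  [/\ s <> t, vert E A s & vert E A t].
Proof.
elim=> {A s t X} [e s t hst he|A B s m t X Y _ [sm As Am] _ [mt Bm Bt] _ hAB
    |A B s t X Y _ [st As At] _ [_ Bs Bt] _ hAB].
- split=> //; exists e; rewrite ?inE //.
    exact: ejoins_incl he.
  exact: ejoins_incr he.
- split; [|by apply/vertU; left|by apply/vertU; right].
  by move=> est; apply: sm; apply: hAB; rewrite // est.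
- by split=> //; apply/vertU; left.
Qed.

Lemma spl_loopless E F A s t X e u v : spl E F A s t X -> e \in A ->
  ejoins E e u v -> u <> v.
Proof.
move=> h; elim: h => {A s t X} [e' s t hst he|A B s m t X Y _ IHA _ IHB _ _
    |A B s t X Y _ IHA _ IHB _ _].
- rewrite inE => /eqP-> hj uv; move: hj he; rewrite /ejoins uv orbb => /eqP->.
  by rewrite !xpair_eqE => /orP[]/andP[/eqP a /eqP b]; apply: hst; rewrite -a -b.
- by rewrite inE => /orP[/IHA|/IHB].
- by rewrite inE => /orP[/IHA|/IHB].
Qed.

Lemma spl_sym E F A s t X : spl E F A s t X -> spl E F A t s X.
Proof.
elim=> {A s t X} [e s t hst he|A B s m t X Y _ hA _ hB dAB hAB
    |A B s t X Y _ hA _ hB dAB hAB].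
- by apply: spl_edge; rewrite 1?ejoins_sym //; apply: nesym.
- rewrite setUC lserC; apply: spl_series hB hA _ _; first by rewrite disjoint_sym.
  by move=> v vB vA; apply: hAB.
- apply: spl_parallel => // v vA vB; case: (hAB v vA vB); tauto.
Qed.

Lemma eq_vert E E' A v : {in A, E =1 E'} -> vert E A v -> vert E' A v.
Proof. by move=> h [e eA hv]; exists e; rewrite // /einc -(h e). Qed.

Lemma eq_spl E F E' F' A s t X : {in A, E =1 E'} -> {in A, F =1 F'} ->
  spl E F A s t X -> spl E' F' A s t X.
Proof.
move=> hE hF h; elim: h hE hF => {A s t X} [e s t hst he hE hF
    |A B s m t X Y _ IHA _ IHB dAB hAB hE hF|A B s t X Y _ IHA _ IHB dAB hAB hE hF].
- have eE : e \in [set e] by rewrite inE.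
  by rewrite (hF e) //; apply: spl_edge => //; rewrite /ejoins -(hE e).
- have [sA sB] : {subset A <= A :|: B} /\ {subset B <= A :|: B}.
    by split=> x; rewrite inE => ->; rewrite ?orbT.
  apply: (spl_series (m := m)) => //.
  + by apply: IHA => x /sA; [apply: hE|apply: hF].
  + by apply: IHB => x /sB; [apply: hE|apply: hF].
  move=> v vA vB; apply: hAB; [apply: eq_vert vA|apply: eq_vert vB] => x hx.
    by rewrite hE ?sA.
  by rewrite hE ?sB.
- have [sA sB] : {subset A <= A :|: B} /\ {subset B <= A :|: B}.
    by split=> x; rewrite inE => ->; rewrite ?orbT.
  apply: spl_parallel => //.
  + by apply: IHA => x /sA; [apply: hE|apply: hF].
  + by apply: IHB => x /sB; [apply: hE|apply: hF].
  move=> v vA vB; apply: hAB; [apply: eq_vert vA|apply: eq_vert vB] => x hx.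
    by rewrite hE ?sA.
  by rewrite hE ?sB.
Qed.

(** * Series reductions *)

(** Allowing empty pieces saves the case distinctions on whether the reduced
    edges have neighbours on either side. *)
Definition spl0 E F A s t X : Prop :=
  [/\ A = set0, s = t & X = lzero] \/ spl E F A s t X.

Lemma spl0_series E F A B s m t X Y :
  spl E F A s m X -> spl0 E F B m t Y -> [disjoint A & B] ->
  (forall v, vert E A v -> vert E B v -> v = m) ->
  spl E F (A :|: B) s t (lser X Y).
Proof.
move=> hA [[-> <- ->]|hB] dAB hAB; first by rewrite setU0 lser0.
exact: spl_series hA hB dAB hAB.
Qed.

(** If [e] is the only edge at the terminal [t], it is the last factor of an
    iterated series composition. *)
Lemma spl_tail E F A s t X e :
  spl E F A s t X -> e \in A -> einc E e t ->
  (forall g, g \in A -> einc E g t -> g = e) ->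
  exists A0 u X0, [/\ spl0 E F A0 s u X0, ejoins E e u t, e \notin A0,
    A = e |: A0 & X = lser X0 (F e) /\ ~ vert E A0 t].
Proof.
move=> h; elim: h => {A s t X} [e' s t hst he
    |A B s m t X Y hA _ hB IHB dAB hAB|A B s t X Y hA _ hB _ dAB hAB].
- rewrite inE => /eqP-> _ _; exists set0, s, lzero; split=> //.
  + by left.
  + by rewrite inE.
  + by rewrite setU0.
  + by rewrite lserC lser0; split=> // -[? /[!inE]].
- move=> eAB et uet; have [mt Bm Bt] := spl_facts hB.
  have nAt : ~ vert E A t by move=> At; apply: mt; rewrite (hAB t).
  have eB : e \in B.
    have [g gB gt] := Bt; rewrite -(uet g) //.
    by rewrite inE gB orbT.
  have eA : e \notin A by rewrite (disjointFl dAB).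
  have [|A0 [u [X0 [h0 hj eA0 BE [YE nt]]]]] := IHB eB et.
    by move=> g gB; apply: uet; rewrite inE gB orbT.
  exists (A :|: A0), u, (lser X X0); split=> //.
  + right; apply: spl0_series hA h0 _ _.
      by apply: disjointWr dAB; rewrite BE subsetUr.
    by move=> v vA vB; apply: hAB => //; rewrite BE; apply/vertU; right.
  + by rewrite inE negb_or eA eA0.
  + by rewrite BE setUCA.
  + by rewrite YE lserA; split=> // /vertU[].
- move=> eAB et uet; have [_ _ [g gA gt]] := spl_facts hA.
  have [_ _ [g' gB gt']] := spl_facts hB.
  have gg : g' = g.
    by rewrite (uet g) ?inE ?gA // (uet g') // inE gB orbT.
  by rewrite gg (disjointFr dAB) in gB.
Qed.

(** The two parts of a series composition are taken apart as [A0], [e] and [f],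
    [B0] around the joining vertex [m].  The new edge [g], which reuses the name
    of [e] or of [f], then takes the place of [e] and [f] in the middle. *)
Lemma spl_merge E F E' F' A B s m t X Y e f g u v :
  spl E F A s m X -> spl E F B m t Y -> [disjoint A & B] ->
  (forall v, vert E A v -> vert E B v -> v = m) ->
  e \in A -> f \in B -> ejoins E e u m -> ejoins E f m v ->
  (forall h, h \in A :|: B -> einc E h m -> h = e \/ h = f) ->
  (forall h, h != e -> h != f -> E' h = E h /\ F' h = F h) ->
  g = e \/ g = f -> ejoins E' g u v -> F' g = lser (F e) (F f) ->
  spl E' F' (g |: ((A :|: B) :\ e :\ f)) s t (lser X Y).
Proof.
move=> hA hB dAB hAB eA fB hje hjf hm hEF hg hjg hFg.
have eB : e \notin B by rewrite (disjointFr dAB).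
have fA : f \notin A by rewrite (disjointFl dAB).
have [|A0 [u' [X0 [h0 hj0 eA0 AE [XE nA0]]]]] := spl_tail hA eA (ejoins_incr hje).
  move=> h hhA hhm; case: (hm h) => // [|hf]; first by rewrite inE hhA.
  by rewrite hf (negbTE fA) in hhA.
have [|B0 [v' [Y0 [h1 hj1 fB0 BE [YE nB0]]]]] :=
  spl_tail (spl_sym hB) fB (ejoins_incl hjf).
  move=> h hhB hhm; case: (hm h) => // [|he]; first by rewrite inE hhB orbT.
  by rewrite he (negbTE eB) in hhB.
have uu : u' = u by apply: ejoins_inj hj0 hje.
have vv : v' = v by apply: ejoins_inj hj1 _; rewrite ejoins_sym.
move: uu vv => ? ?; subst u' v'.
have eB0 : e \notin B0 by apply: contra eB; rewrite BE inE => ->; rewrite orbT.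
have fA0 : f \notin A0 by apply: contra fA; rewrite AE inE => ->; rewrite orbT.
have aA0 : {in A0, E =1 E'} /\ {in A0, F =1 F'}.
  by split=> h hh; case: (hEF h) => //; apply: contraTneq hh => ->.
have aB0 : {in B0, E =1 E'} /\ {in B0, F =1 F'}.
  by split=> h hh; case: (hEF h) => //; apply: contraTneq hh => ->.
have h0' : spl0 E' F' A0 s u X0.
  by case: h0 => h; [left|right; apply: eq_spl h; tauto].
have h1' : spl0 E' F' B0 v t Y0.
  case: h1 => [[? ? ?]|h]; [by left|right; apply: spl_sym; apply: eq_spl h; tauto].
have A0A w : vert E' A0 w -> vert E A w.
  move=> hw; rewrite AE; apply/vertU; right; apply: eq_vert hw.
  by move=> x hx; rewrite (proj1 aA0).
have A0m w : vert E' A0 w -> w <> m.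
  by move=> hw wm; apply: nA0; rewrite -wm; apply: eq_vert hw => x /(proj1 aA0).
have B0B w : vert E' B0 w -> vert E B w.
  move=> hw; rewrite BE; apply/vertU; right; apply: eq_vert hw.
  by move=> x hx; rewrite (proj1 aB0).
have B0m w : vert E' B0 w -> w <> m.
  by move=> hw wm; apply: nB0; rewrite -wm; apply: eq_vert hw => x /(proj1 aB0).
have Au : vert E A u by exists e => //; apply: ejoins_incl hje.
have Bv : vert E B v by exists f => //; apply: ejoins_incr hjf.
have um : u <> m by apply: spl_loopless hA eA hje.
have mv : m <> v by apply: spl_loopless hB fB hjf.
have uv : u <> v by move=> uv; apply: um; apply: hAB; rewrite // uv.
have gA0 : g \notin A0 by case: hg => ->.
have gB0 : g \notin B0 by case: hg => ->.
have hG : spl E' F' (g |: B0) u t (lser (F' g) Y0).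
  apply: spl0_series (spl_edge F' uv hjg) h1' _ _; first by rewrite disjoints1.
  move=> w /vert1; rewrite (ejoins_inc _ hjg) => /orP[]/eqP-> // hw.
  by case: um; apply: hAB => //; apply: B0B.
have vG w : vert E' (g |: B0) w -> w = u \/ vert E B w.
  move/vertU => [/vert1|/B0B]; last by right.
  by rewrite (ejoins_inc _ hjg) => /orP[]/eqP->; [left|right].
apply: (@spl_cast _ _ (A0 :|: (g |: B0)) _ _ _ (lser X0 (lser (F' g) Y0))).
- case: h0' => [[-> -> ->]|h0'].
    by rewrite set0U [lser lzero _]lserC lser0.
  apply: spl_series h0' hG _ _.
    rewrite disjoint_sym disjointsU1 gA0 /= disjoint_sym.
    apply: disjointWl (_ : A0 \subset A) _; first by rewrite AE subsetUr.
    by apply: disjointWr dAB; rewrite BE subsetUr.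
  move=> w hA0 /vG[] // hB'; case: (A0m w) => //.
  by apply: hAB => //; apply: A0A.
- apply/setP=> x; rewrite AE BE !inE.
  case: (eqVneq x e) => [->|xe].
    rewrite (negbTE eA0) (negbTE eB0) /=.
    by case: hg => ->; rewrite ?eqxx /= ?orbF ?andbF ?orbF //; case: eqVneq.
  case: (eqVneq x f) => [->|xf] /=.
    by rewrite (negbTE fA0) (negbTE fB0) /= orbF.
  by case: hg => ->; rewrite ?(negbTE xe) ?(negbTE xf).
- by rewrite XE YE hFg [lser Y0 _]lserC !lserA.
Qed.

Lemma vert_reduced E E' A e f g u m v w :
  e \in A -> f \in A -> ejoins E e u m -> ejoins E f m v ->
  (forall h, h != e -> h != f -> E' h = E h) ->
  ejoins E' g u v -> vert E' (g |: (A :\ e :\ f)) w -> vert E A w.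
Proof.
move=> eA fA hje hjf hE hjg /vertU[/vert1|[h]].
  rewrite (ejoins_inc _ hjg) => /orP[]/eqP->.
    by exists e => //; apply: ejoins_incl hje.
  by exists f => //; apply: ejoins_incr hjf.
rewrite !inE => /and3P[hf he hA] hw; exists h => //.
by rewrite /einc -hE.
Qed.

Lemma setU1D2l (A B : {set I}) e f g : e \notin B -> f \notin B ->
  (g |: (A :\ e :\ f)) :|: B = g |: ((A :|: B) :\ e :\ f).
Proof.
move=> eB fB; apply/setP=> x; rewrite !inE.
case: (eqVneq x e) => [->|]; rewrite ?(negbTE eB) ?andbF ?orbF //=.
by case: (eqVneq x f) => [->|]; rewrite ?(negbTE fB) ?andbF ?orbF //= orbA.
Qed.

Lemma setU1D2r (A B : {set I}) e f g : e \notin A -> f \notin A ->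
  A :|: (g |: (B :\ e :\ f)) = g |: ((A :|: B) :\ e :\ f).
Proof. by move=> eB fB; rewrite setUC setU1D2l // [B :|: A]setUC. Qed.

Lemma disjoint_reducedl (A B : {set I}) e f g : [disjoint A & B] ->
  e \in A -> f \in A -> g = e \/ g = f -> [disjoint g |: (A :\ e :\ f) & B].
Proof.
move=> dAB eA fA hg; rewrite disjointsU1; apply/andP; split.
  by case: hg => ->; rewrite (disjointFr dAB).
by apply: disjointWl dAB; apply: subset_trans (subsetDl _ _) (subsetDl _ _).
Qed.

Lemma eq_off E F E' F' B e f : e \notin B -> f \notin B ->
  (forall h, h != e -> h != f -> E' h = E h /\ F' h = F h) ->
  {in B, E =1 E'} /\ {in B, F =1 F'}.
Proof.
by move=> eB fB hEF; split=> h hh; case: (hEF h) => //;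
  apply: contraTneq hh => ->.
Qed.

(** Reducing two edges in series anywhere in the graph preserves the label.  If
    the two edges lie in different parts of a series composition, the vertex
    between them is the one at which the parts are joined, and both parts are
    cut open next to it. *)
Lemma spl_reduce_series E F E' F' A s t X e f g u m v :
  spl E F A s t X -> e \in A -> f \in A -> e != f ->
  ejoins E e u m -> ejoins E f m v -> m <> s -> m <> t ->
  (forall h, h \in A -> einc E h m -> h = e \/ h = f) ->
  (forall h, h != e -> h != f -> E' h = E h /\ F' h = F h) ->
  g = e \/ g = f -> ejoins E' g u v -> F' g = lser (F e) (F f) ->
  spl E' F' (g |: (A :\ e :\ f)) s t X.
Proof.
move=> h eA fA ef hje hjf ms mt hm hEF hg hjg hFg.
have hE h0 : h0 != e -> h0 != f -> E' h0 = E h0.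
  by move=> h1 h2; case: (hEF h0 h1 h2).
elim: h eA fA ms mt hm => {A s t X} [e' s t hst he
    |A B s k t X Y hA IHA hB IHB dAB hAB|A B s t X Y hA IHA hB IHB dAB hAB].
- by rewrite !inE => /eqP ee /eqP fe; rewrite ee fe eqxx in ef.
- move=> eAB fAB ms mt hm.
  have em : einc E e m by apply: ejoins_incr hje.
  have fm : einc E f m by apply: ejoins_incl hjf.
  move: (eAB) (fAB); rewrite !inE.
  have [eA|eA] := boolP (e \in A); have [fA|fA] := boolP (f \in A) => //=.
  + move=> _ _.
    have eB : e \notin B by rewrite (disjointFr dAB).
    have fB : f \notin B by rewrite (disjointFr dAB).
    have mk : m <> k.
      move=> mk; have [_ [h hh hk] _] := spl_facts hB; rewrite -mk in hk.
      have := hm h; rewrite inE hh orbT => /(_ isT hk) [] hE0;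
        by rewrite hE0 ?(negbTE eB) ?(negbTE fB) in hh.
    have [aE aF] := eq_off eB fB hEF.
    rewrite -setU1D2l //; apply: (spl_series (m := k)).
    * by apply: IHA => // h hh; apply: hm; rewrite inE hh.
    * exact: eq_spl hB.
    * exact: disjoint_reducedl.
    * move=> w hw1 hw2; apply: hAB.
        exact: vert_reduced hje hjf hE hjg hw1.
      by apply: eq_vert hw2 => x hx; rewrite aE.
  + move=> _ fB.
    have mk : m = k by apply: hAB; [exists e|exists f].
    move: mk => ?; subst k.
    exact: spl_merge hA hB dAB hAB eA fB hje hjf hm hEF hg hjg hFg.
  + move=> eB _; rewrite ejoins_sym in hje; rewrite ejoins_sym in hjf.
    have mk : m = k by apply: hAB; [exists f|exists e].
    move: mk => ?; subst k.
    have := spl_merge (E' := E') (F' := F') (g := g) hA hB dAB hAB fA eB hjf hje.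
    have -> : (A :|: B) :\ f :\ e = (A :|: B) :\ e :\ f.
      by apply/setP=> x; rewrite !inE andbCA.
    apply => //.
    * by move=> h hh /hm; case=> //; tauto.
    * by move=> h h1 h2; apply: hEF.
    * tauto.
    * by rewrite ejoins_sym.
    * by rewrite lserC.
  + move=> eB fB.
    have mk : m <> k.
      move=> mk; have [_ _ [h hh hk]] := spl_facts hA; rewrite -mk in hk.
      have := hm h; rewrite inE hh => /(_ isT hk) [] hE0;
        by rewrite hE0 ?(negbTE eA) ?(negbTE fA) in hh.
    have [aE aF] := eq_off eA fA hEF.
    rewrite -setU1D2r //; apply: (spl_series (m := k)).
    * exact: eq_spl hA.
    * by apply: IHB => // h hh; apply: hm; rewrite inE hh orbT.
    * by rewrite disjoint_sym; apply: disjoint_reducedl; rewrite // disjoint_sym.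
    * move=> w hw1 hw2; apply: hAB.
        by apply: eq_vert hw1 => x hx; rewrite aE.
      exact: vert_reduced hje hjf hE hjg hw2.
- move=> eAB fAB ms mt hm.
  have em : einc E e m by apply: ejoins_incr hje.
  have fm : einc E f m by apply: ejoins_incl hjf.
  move: (eAB) (fAB); rewrite !inE.
  have [eA|eA] := boolP (e \in A); have [fA|fA] := boolP (f \in A) => //=.
  + move=> _ _.
    have eB : e \notin B by rewrite (disjointFr dAB).
    have fB : f \notin B by rewrite (disjointFr dAB).
    have [aE aF] := eq_off eB fB hEF.
    rewrite -setU1D2l //; apply: spl_parallel.
    * by apply: IHA => // h hh; apply: hm; rewrite inE hh.
    * exact: eq_spl hB.
    * exact: disjoint_reducedl.
    * move=> w hw1 hw2; apply: hAB.
        exact: vert_reduced hje hjf hE hjg hw1.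
      by apply: eq_vert hw2 => x hx; rewrite aE.
  + by move=> _ fB; case: (hAB m) => //; [exists e|exists f].
  + by move=> eB _; case: (hAB m) => //; [exists f|exists e].
  + move=> eB fB; have [aE aF] := eq_off eA fA hEF.
    rewrite -setU1D2r //; apply: spl_parallel.
    * exact: eq_spl hA.
    * by apply: IHB => // h hh; apply: hm; rewrite inE hh orbT.
    * by rewrite disjoint_sym; apply: disjoint_reducedl; rewrite // disjoint_sym.
    * move=> w hw1 hw2; apply: hAB.
        by apply: eq_vert hw1 => x hx; rewrite aE.
      exact: vert_reduced hje hjf hE hjg hw2.
Qed.

(** * Parallel reductions *)

(** Here an absent piece has no label, as there is no neutral element. *)
Definition splo E F A s t (o : option label) : Prop :=
  if o is Some X then spl E F A s t X else A = set0.

Definition lparo (X : label) (o : option label) : label :=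
  if o is Some Y then lpar X Y else X.

Lemma splo_parallel E F A B s t X o :
  spl E F A s t X -> splo E F B s t o -> [disjoint A & B] ->
  (forall v, vert E A v -> vert E B v -> v = s \/ v = t) ->
  spl E F (A :|: B) s t (lparo X o).
Proof.
case: o => [Y|] hA /= hB dAB hAB; last by rewrite hB setU0.
exact: spl_parallel.
Qed.

(** An edge joining the terminals cannot lie in a part of a series composition,
    so it is a factor of an iterated parallel composition. *)
Lemma spl_peel E F A s t X e :
  spl E F A s t X -> e \in A -> ejoins E e s t ->
  exists A0 o, [/\ splo E F A0 s t o, e \notin A0, A = e |: A0
    & X = lparo (F e) o].
Proof.
move=> h; elim: h => {A s t X} [e' s t hst he
    |A B s m t X Y hA _ hB _ dAB hAB|A B s t X Y hA IHA hB IHB dAB hAB].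
- rewrite inE => /eqP-> _; exists set0, None; split=> //.
  + by rewrite inE.
  + by rewrite setU0.
- have [sm As Am] := spl_facts hA; have [mt Bm Bt] := spl_facts hB.
  rewrite inE => /orP[eA|eB] hj.
    case: mt; apply/esym; apply: hAB => //; exists e => //.
    exact: ejoins_incr hj.
  case: sm; apply: hAB => //; exists e => //; exact: ejoins_incl hj.
- have key A' B' X' Y' : spl E F B' s t Y' -> [disjoint A' & B'] ->
      (forall v, vert E A' v -> vert E B' v -> v = s \/ v = t) ->
      e \in A' ->
      (exists A0 o, [/\ splo E F A0 s t o, e \notin A0, A' = e |: A0
         & X' = lparo (F e) o]) ->
      exists A0 o, [/\ splo E F A0 s t o, e \notin A0, A' :|: B' = e |: A0
         & lpar X' Y' = lparo (F e) o].
    move=> hB' dAB' hAB' eA [A0 [o [h0 eA0 AE XE]]].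
    have eB : e \notin B' by rewrite (disjointFr dAB').
    exists (A0 :|: B'), (Some (if o is Some Z then lpar Z Y' else Y')).
    split; last 1 first.
    + by rewrite XE; case: (o) => //= Z; rewrite lparA.
    + case: o h0 {XE} => [Z|] /= h0; last by rewrite h0 set0U.
      apply: spl_parallel => //.
        by apply: disjointWl dAB'; rewrite AE subsetUr.
      by move=> v vA vB; apply: hAB' => //; rewrite AE; apply/vertU; right.
    + by rewrite inE negb_or eA0 eB.
    + by rewrite AE setUA.
  rewrite inE => /orP[eA|eB] hj.
    by apply: (key A B X Y) => //; apply: IHA.
  rewrite setUC lparC; apply: (key B A Y X) => //.
  + by rewrite disjoint_sym.
  + by move=> v vB vA; apply: hAB.
  + exact: IHB.
Qed.

Lemma ejoins_ends E e s t u v : u <> v -> ejoins E e u v ->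
  (u = s \/ u = t) -> (v = s \/ v = t) -> ejoins E e s t.
Proof. by move=> uv he [us|ut] [vs|vt]; subst u v => //; rewrite ejoins_sym. Qed.

Lemma spl_merge_parallel E F E' F' A B s t X Y e f g :
  spl E F A s t X -> spl E F B s t Y -> [disjoint A & B] ->
  (forall v, vert E A v -> vert E B v -> v = s \/ v = t) ->
  e \in A -> f \in B -> ejoins E e s t -> ejoins E f s t ->
  (forall h, h != e -> h != f -> E' h = E h /\ F' h = F h) ->
  g = e \/ g = f -> ejoins E' g s t -> F' g = lpar (F e) (F f) ->
  spl E' F' (g |: ((A :|: B) :\ e :\ f)) s t (lpar X Y).
Proof.
move=> hA hB dAB hAB eA fB hje hjf hEF hg hjg hFg.
have eB : e \notin B by rewrite (disjointFr dAB).
have fA : f \notin A by rewrite (disjointFl dAB).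
have [A0 [o [h0 eA0 AE XE]]] := spl_peel hA eA hje.
have [B0 [o' [h1 fB0 BE YE]]] := spl_peel hB fB hjf.
have eB0 : e \notin B0 by apply: contra eB; rewrite BE inE => ->; rewrite orbT.
have fA0 : f \notin A0 by apply: contra fA; rewrite AE inE => ->; rewrite orbT.
have [aE aF] := eq_off eA0 fA0 hEF; have [bE bF] := eq_off eB0 fB0 hEF.
have h0' : splo E' F' A0 s t o by case: (o) h0 => //= Z; apply: eq_spl.
have h1' : splo E' F' B0 s t o' by case: (o') h1 => //= Z; apply: eq_spl.
have [st _ _] := spl_facts hA.
have gA0 : g \notin A0 by case: hg => ->.
have gB0 : g \notin B0 by case: hg => ->.
have vg v : vert E' [set g] v -> v = s \/ v = t.
  by move/vert1; rewrite (ejoins_inc _ hjg) => /orP[]/eqP->; tauto.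
apply: (@spl_cast _ _ (([set g] :|: A0) :|: B0) _ _ _
          (lparo (lparo (F' g) o) o')).
- apply: splo_parallel => //.
  + apply: splo_parallel => //; first exact: spl_edge.
      by rewrite disjoints1.
    by move=> v /vg.
  + rewrite disjointsU1 gB0 /=.
    apply: disjointWl (_ : A0 \subset A) _; first by rewrite AE subsetUr.
    by apply: disjointWr dAB; rewrite BE subsetUr.
  + move=> v /vertU[/vg//|hv] hv'; apply: hAB.
      rewrite AE; apply/vertU; right; apply: eq_vert hv => x hx; by rewrite aE.
    rewrite BE; apply/vertU; right; apply: eq_vert hv' => x hx; by rewrite bE.
- apply/setP=> x; rewrite AE BE !inE.
  case: (eqVneq x e) => [->|xe].
    rewrite (negbTE eA0) (negbTE eB0) /= !orbF.
    by case: hg => ->; rewrite ?eqxx /= ?orbF ?andbF ?orbF //; case: eqVneq.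
  case: (eqVneq x f) => [->|xf] /=.
    by rewrite (negbTE fA0) (negbTE fB0) /= !orbF.
  by rewrite -orbA; case: hg => ->; rewrite ?(negbTE xe) ?(negbTE xf).
- rewrite XE YE hFg; case: (o) (o') => [Z|] [Z'|] //=.
  + by rewrite !lparA -[lpar (lpar (F e) Z) (F f)]lparA [lpar Z (F f)]lparC lparA.
  + by rewrite -!lparA [lpar (F f) Z]lparC.
  + by rewrite lparA.
Qed.

(** Two parallel edges lie in the same part of a series composition.  If they
    lie in different parts of a parallel composition, their ends are the
    terminals, and both can be split off. *)
Lemma spl_reduce_parallel E F E' F' A s t X e f g u v :
  spl E F A s t X -> e \in A -> f \in A -> e != f ->
  ejoins E e u v -> ejoins E f u v ->
  (forall h, h != e -> h != f -> E' h = E h /\ F' h = F h) ->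
  g = e \/ g = f -> ejoins E' g u v -> F' g = lpar (F e) (F f) ->
  spl E' F' (g |: (A :\ e :\ f)) s t X.
Proof.
move=> h eA fA ef hje hjf hEF hg hjg hFg.
have hE h0 : h0 != e -> h0 != f -> E' h0 = E h0.
  by move=> h1 h2; case: (hEF h0 h1 h2).
have uv : u <> v by apply: spl_loopless h eA hje.
have vr A' w : e \in A' -> f \in A' ->
    vert E' (g |: (A' :\ e :\ f)) w -> vert E A' w.
  move=> eA' fA' /vertU[/vert1|[h0]].
    rewrite (ejoins_inc _ hjg) => /orP[]/eqP->; exists e => //.
      exact: ejoins_incl hje.
    exact: ejoins_incr hje.
  by rewrite !inE => /and3P[hf he hA'] hw; exists h0; rewrite // /einc -hE.
have [eu ev] : einc E e u /\ einc E e v.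
  by split; [apply: ejoins_incl hje|apply: ejoins_incr hje].
have [fu fv] : einc E f u /\ einc E f v.
  by split; [apply: ejoins_incl hjf|apply: ejoins_incr hjf].
elim: h eA fA => {A s t X} [e' s t hst he
    |A B s k t X Y hA IHA hB IHB dAB hAB|A B s t X Y hA IHA hB IHB dAB hAB].
- by rewrite !inE => /eqP ee /eqP fe; rewrite ee fe eqxx in ef.
- move=> eAB fAB; move: (eAB) (fAB); rewrite !inE.
  have [eA|eA] := boolP (e \in A); have [fA|fA] := boolP (f \in A) => //=.
  + move=> _ _.
    have eB : e \notin B by rewrite (disjointFr dAB).
    have fB : f \notin B by rewrite (disjointFr dAB).
    have [aE aF] := eq_off eB fB hEF.
    rewrite -setU1D2l //; apply: (spl_series (m := k)).
    * exact: IHA.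
    * exact: eq_spl hB.
    * exact: disjoint_reducedl.
    * move=> w hw1 hw2; apply: hAB; first exact: vr hw1.
      by apply: eq_vert hw2 => x hx; rewrite aE.
  + move=> _ fB; case: uv; transitivity k; [|apply: esym]; apply: hAB;
      by [exists e|exists f].
  + move=> eB _; case: uv; transitivity k; [|apply: esym]; apply: hAB;
      by [exists e|exists f].
  + move=> eB fB; have [aE aF] := eq_off eA fA hEF.
    rewrite -setU1D2r //; apply: (spl_series (m := k)).
    * exact: eq_spl hA.
    * exact: IHB.
    * by rewrite disjoint_sym; apply: disjoint_reducedl; rewrite // disjoint_sym.
    * move=> w hw1 hw2; apply: hAB; last exact: vr hw2.
      by apply: eq_vert hw1 => x hx; rewrite aE.
- move=> eAB fAB; move: (eAB) (fAB); rewrite !inE.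
  have [eA|eA] := boolP (e \in A); have [fA|fA] := boolP (f \in A) => //=.
  + move=> _ _.
    have eB : e \notin B by rewrite (disjointFr dAB).
    have fB : f \notin B by rewrite (disjointFr dAB).
    have [aE aF] := eq_off eB fB hEF.
    rewrite -setU1D2l //; apply: spl_parallel.
    * exact: IHA.
    * exact: eq_spl hB.
    * exact: disjoint_reducedl.
    * move=> w hw1 hw2; apply: hAB; first exact: vr hw1.
      by apply: eq_vert hw2 => x hx; rewrite aE.
  + move=> _ fB.
    have hu : u = s \/ u = t by apply: hAB; [exists e|exists f].
    have hv : v = s \/ v = t by apply: hAB; [exists e|exists f].
    apply: spl_merge_parallel hA hB dAB hAB eA fB _ _ hEF hg _ hFg;
      exact: ejoins_ends uv _ hu hv.
  + move=> eB _.
    have hu : u = s \/ u = t by apply: hAB; [exists f|exists e].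
    have hv : v = s \/ v = t by apply: hAB; [exists f|exists e].
    have -> : (A :|: B) :\ e :\ f = (A :|: B) :\ f :\ e.
      by apply/setP=> x; rewrite !inE andbCA.
    apply: spl_merge_parallel hA hB dAB hAB fA eB _ _ _ _ _ _;
      try exact: ejoins_ends uv _ hu hv.
    * by move=> h h1 h2; apply: hEF.
    * tauto.
    * by rewrite lparC.
  + move=> eB fB; have [aE aF] := eq_off eA fA hEF.
    rewrite -setU1D2r //; apply: spl_parallel.
    * exact: eq_spl hA.
    * exact: IHB.
    * by rewrite disjoint_sym; apply: disjoint_reducedl; rewrite // disjoint_sym.
    * move=> w hw1 hw2; apply: hAB; last exact: vr hw2.
      by apply: eq_vert hw1 => x hx; rewrite aE.
Qed.

(** * Irreducible graphs are single edges *)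

Definition par_pair E A e f : Prop :=
  [/\ e \in A, f \in A, e != f & exists u v, ejoins E e u v && ejoins E f u v].

Definition ser_pair E A s t e f : Prop :=
  [/\ e \in A, f \in A, e != f & exists u m v,
    [/\ ejoins E e u m, ejoins E f m v, m <> s, m <> t
      & forall h, h \in A -> einc E h m -> h = e \/ h = f]].

Lemma ser_pair_sub E A (C : {set I}) s t s' t' e f : ser_pair E A s t e f ->
  {subset A <= C} ->
  (forall m, vert E A m -> m <> s -> m <> t ->
     [/\ m <> s', m <> t' & forall h, h \in C -> einc E h m -> h \in A]) ->
  ser_pair E C s' t' e f.
Proof.
move=> [eA fA ef [u [m [v [he hf ms mt hm]]]]] sAC hC.
have [|ms' mt' hA] := hC m _ ms mt.
  by exists e => //; apply: ejoins_incr he.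
split; [exact: sAC|exact: sAC|by []|exists u, m, v; split=> //].
by move=> h hh hi; apply: hm => //; apply: hA.
Qed.

Lemma par_pair_sub E A (C : {set I}) e f : par_pair E A e f -> {subset A <= C} ->
  par_pair E C e f.
Proof. by move=> [eA fA ef h] sAC; split=> //; apply: sAC. Qed.

(** Reducible pairs in the parts of a composition remain reducible in the whole,
    and if both parts are single edges, these form such a pair. *)
Lemma spl_progress E F A s t X : spl E F A s t X ->
  (exists e, A = [set e]) \/
  (exists e f, par_pair E A e f \/ ser_pair E A s t e f).
Proof.
elim=> {A s t X} [e s t hst he|A B s m t X Y hA IHA hB IHB dAB hAB
    |A B s t X Y hA IHA hB IHB dAB hAB]; first by left; exists e.
- right; have [sA sB] : {subset A <= A :|: B} /\ {subset B <= A :|: B}.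
    by split=> x; rewrite inE => ->; rewrite ?orbT.
  have [sm As Am] := spl_facts hA; have [mt Bm Bt] := spl_facts hB.
  case: IHA => [[e Ae]|[e [f [hp|hs]]]]; last 2 first.
  + by exists e, f; left; apply: par_pair_sub hp sA.
  + exists e, f; right; apply: ser_pair_sub hs sA _ => k vk ks km; split=> //.
      by move=> kt; apply: km; apply: hAB; rewrite // kt.
    move=> h; rewrite inE => /orP[//|hB'] hk.
    by case: km; apply: hAB => //; exists h.
  case: IHB => [[f Bf]|[f [f' [hp|hs]]]]; last 2 first.
  + by exists f, f'; left; apply: par_pair_sub hp sB.
  + exists f, f'; right; apply: ser_pair_sub hs sB _ => k vk km kt; split=> //.
      by move=> ks; apply: km; apply: hAB; rewrite // ks.
    move=> h; rewrite inE => /orP[hA'|//] hk.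
    by case: km; apply: hAB => //; exists h.
  have eA : e \in A by rewrite Ae inE.
  have fB : f \in B by rewrite Bf inE.
  have he : ejoins E e s m.
    have := As; have := Am; rewrite Ae !vert1 /einc /ejoins.
    case: (E e) => a b /=; rewrite !xpair_eqE => h1 h2.
    by move: h1 h2 sm => /orP[]/eqP <- /orP[]/eqP <-; rewrite ?eqxx ?orbT.
  have hf : ejoins E f m t.
    have := Bm; have := Bt; rewrite Bf !vert1 /einc /ejoins.
    case: (E f) => a b /=; rewrite !xpair_eqE => h1 h2.
    by move: h1 h2 mt => /orP[]/eqP <- /orP[]/eqP <-; rewrite ?eqxx ?orbT.
  exists e, f; right; split; [exact: sA|exact: sB| |].
    by apply: contraTneq eA => ->; rewrite (disjointFl dAB).
  exists s, m, t; split=> //; first exact: nesym.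
  by move=> h; rewrite Ae Bf !inE => /orP[]/eqP->; tauto.
- right; have [sA sB] : {subset A <= A :|: B} /\ {subset B <= A :|: B}.
    by split=> x; rewrite inE => ->; rewrite ?orbT.
  have [st As At] := spl_facts hA; have [_ Bs Bt] := spl_facts hB.
  case: IHA => [[e Ae]|[e [f [hp|hs]]]]; last 2 first.
  + by exists e, f; left; apply: par_pair_sub hp sA.
  + exists e, f; right; apply: ser_pair_sub hs sA _ => k vk ks kt; split=> //.
    move=> h; rewrite inE => /orP[//|hB'] hk.
    by case: (hAB k) => //; exists h.
  case: IHB => [[f Bf]|[f [f' [hp|hs]]]]; last 2 first.
  + by exists f, f'; left; apply: par_pair_sub hp sB.
  + exists f, f'; right; apply: ser_pair_sub hs sB _ => k vk ks kt; split=> //.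
    move=> h; rewrite inE => /orP[hA'|//] hk.
    by case: (hAB k) => //; exists h.
  have eA : e \in A by rewrite Ae inE.
  have fB : f \in B by rewrite Bf inE.
  have he : ejoins E e s t.
    have := As; have := At; rewrite Ae !vert1 /einc /ejoins.
    case: (E e) => a b /=; rewrite !xpair_eqE => h1 h2.
    by move: h1 h2 st => /orP[]/eqP <- /orP[]/eqP <-; rewrite ?eqxx ?orbT.
  have hf : ejoins E f s t.
    have := Bs; have := Bt; rewrite Bf !vert1 /einc /ejoins.
    case: (E f) => a b /=; rewrite !xpair_eqE => h1 h2.
    by move: h1 h2 st => /orP[]/eqP <- /orP[]/eqP <-; rewrite ?eqxx ?orbT.
  exists e, f; left; split; [exact: sA|exact: sB| |].
    by apply: contraTneq eA => ->; rewrite (disjointFl dAB).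
  by exists s, t; rewrite he hf.
Qed.

Lemma spl_neq0 E F A s t X : spl E F A s t X -> A != set0.
Proof.
move=> h; have [_ [e eA _] _] := spl_facts h.
by apply/set0Pn; exists e.
Qed.

Lemma spl_label1 E F e s t X : spl E F [set e] s t X -> X = F e.
Proof.
move Ae: [set e] => A h; case: h Ae => {A s t X} [e' s t _ _ /set1_inj->//
    |A B s m t X Y hA hB dAB _|A B s t X Y hA hB dAB _] Ae.
all: have /set0Pn[a aA] := spl_neq0 hA; have /set0Pn[b bB] := spl_neq0 hB.
all: have ae : a = e by apply/set1P; rewrite Ae inE aA.
all: have be : b = e by apply/set1P; rewrite Ae inE bB orbT.
all: by rewrite be -ae (disjointFr dAB aA) in bB.
Qed.

End LabelledSP.

(** * Cheapest pairs of solutions *)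

(** The price of an item according to which of the two plans use it.  An item
    used by both is bought either once in the first stage, at price [a], or
    separately in the second stage of each plan. *)
Definition item_price (a b1 b2 : int) (u v : bool) : int :=
  match u, v with
  | true, true => Num.min a (b1 + b2)
  | true, false => b1
  | false, true => b2
  | false, false => 0
  end.

Section PairCost.
Variables (n : nat) (a b1 b2 : 'I_n -> int).
Implicit Types (P Q A B : {set 'I_n}) (Fam : {set 'I_n} -> Prop).

Definition pair_cost (z1 z2 : bvec n) : int :=
  \sum_i item_price (a i) (b1 i) (b2 i) (z1 i) (z2 i).

Definition is_opt (X : bvec n -> Prop) (m : int) : Prop :=
  (exists z1 z2, [/\ X z1, X z2 & pair_cost z1 z2 = m]) /\
  (forall z1 z2, X z1 -> X z2 -> m <= pair_cost z1 z2).

Definition set_cost P Q : int :=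
  \sum_i item_price (a i) (b1 i) (b2 i) (i \in P) (i \in Q).

(** [m] is the least cost of a pair from [Fam] and [Fam'].  Having a separate
    family for each plan covers the labels for one plan only, for which the
    other family is [only0]. *)
Definition attains Fam Fam' (m : int) : Prop :=
  (exists P Q, [/\ Fam P, Fam' Q & set_cost P Q = m]) /\
  (forall P Q, Fam P -> Fam' Q -> m <= set_cost P Q).

Lemma attains_is_opt Fam (X : bvec n -> Prop) m :
  (forall P, Fam P <-> X [ffun i => i \in P]) -> attains Fam Fam m -> is_opt X m.
Proof.
move=> hX [[P [Q [hP hQ e]]] h]; split.
  exists [ffun i => i \in P], [ffun i => i \in Q]; split; try exact/hX.
  by rewrite -e; apply: eq_bigr => i _; rewrite !ffunE.
move=> z1 z2 h1 h2.
have zE (z : bvec n) : [ffun i => i \in [set i | z i]] = z.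
  by apply/ffunP=> i; rewrite ffunE inE.
have := h [set i | z1 i] [set i | z2 i]; rewrite !hX !zE => /(_ h1 h2).
rewrite /set_cost /pair_cost.
by under eq_bigr do rewrite !inE.
Qed.

Lemma set_costU A B P P' Q Q' : [disjoint A & B] ->
  P \subset A -> P' \subset A -> Q \subset B -> Q' \subset B ->
  set_cost (P :|: Q) (P' :|: Q') = set_cost P P' + set_cost Q Q'.
Proof.
move=> dAB hP hP' hQ hQ'; rewrite /set_cost -big_split /=.
apply: eq_bigr => i _; rewrite !inE.
have [iA|iA] := boolP (i \in A).
  have iB : i \notin B by rewrite (disjointFr dAB).
  have /negbTE-> : i \notin Q by apply: contra iB; apply: (subsetP hQ).
  have /negbTE-> : i \notin Q' by apply: contra iB; apply: (subsetP hQ').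
  by rewrite !orbF addr0.
have /negbTE-> : i \notin P by apply: contra iA; apply: (subsetP hP).
have /negbTE-> : i \notin P' by apply: contra iA; apply: (subsetP hP').
by rewrite add0r.
Qed.

Definition only0 P : Prop := P = set0.
Definition cup Fam Fam' P : Prop :=
  exists P1 P2, [/\ Fam P1, Fam' P2 & P = P1 :|: P2].
Definition supp Fam A : Prop := forall P, Fam P -> P \subset A.

Lemma supp0 A : supp only0 A.
Proof. by move=> P ->; exact: sub0set. Qed.

Lemma attains_ext F1 F2 F1' F2' m :
  (forall P, F1 P <-> F1' P) -> (forall P, F2 P <-> F2' P) ->
  attains F1 F2 m -> attains F1' F2' m.
Proof.
move=> h1 h2 [[P [Q [hP hQ e]]] h]; split.
  by exists P, Q; split=> //; [apply/h1|apply/h2].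
by move=> P' Q' /h1 hP' /h2 hQ'; apply: h.
Qed.

(** Costs add up over disjoint pieces, so that pairs can be optimized piece by
    piece. *)
Lemma attains_cup A B F1 F2 G1 G2 m k : [disjoint A & B] ->
  supp F1 A -> supp F2 A -> supp G1 B -> supp G2 B ->
  attains F1 F2 m -> attains G1 G2 k ->
  attains (cup F1 G1) (cup F2 G2) (m + k).
Proof.
move=> dAB s1 s2 s3 s4 [[P [Q [hP hQ e]]] h] [[P' [Q' [hP' hQ' e']]] h']; split.
  exists (P :|: P'), (Q :|: Q'); split; [by exists P, P'|by exists Q, Q'|].
  by rewrite (set_costU dAB) ?e ?e' //; [exact: s1|exact: s2|exact: s3|exact: s4].
move=> _ _ [P1 [P2 [h1 h2 ->]]] [Q1 [Q2 [h3 h4 ->]]].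
rewrite (set_costU dAB) ?lerD //;
  [exact: h|exact: h'|exact: s1|exact: s2|exact: s3|exact: s4].
Qed.

Lemma cup00 P : cup only0 only0 P <-> only0 P.
Proof.
by split=> [[_ [_ [-> -> ->]]]|->]; [rewrite setU0|exists set0, set0; rewrite setU0].
Qed.

Lemma cup0r F P : cup F only0 P <-> F P.
Proof.
by split=> [[P1 [_ [h -> ->]]]|h]; [rewrite setU0|exists P, set0; rewrite setU0].
Qed.

Lemma cup0l F P : cup only0 F P <-> F P.
Proof.
by split=> [[_ [P1 [-> h ->]]]|h]; [rewrite set0U|exists set0, P; rewrite set0U].
Qed.

Lemma attains_or F F' G G' m1 m2 m3 m4 :
  attains F G m1 -> attains F' G' m2 -> attains F G' m3 -> attains F' G m4 ->
  attains (fun P => F P \/ F' P) (fun P => G P \/ G' P)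
    (Num.min (Num.min m1 m2) (Num.min m3 m4)).
Proof.
move=> [[P1 [Q1 [h1 k1 e1]]] l1] [[P2 [Q2 [h2 k2 e2]]] l2].
move=> [[P3 [Q3 [h3 k3 e3]]] l3] [[P4 [Q4 [h4 k4 e4]]] l4]; split; last first.
  move=> P Q [hP|hP] [hQ|hQ]; rewrite !ge_min.
  - by rewrite l1.
  - by rewrite l3 ?orbT.
  - by rewrite l4 ?orbT.
  - by rewrite l2 ?orbT.
case: (leP (Num.min m1 m2) (Num.min m3 m4)) => _.
  case: (leP m1 m2) => _; [exists P1, Q1|exists P2, Q2]; split=> //; tauto.
case: (leP m3 m4) => _; [exists P3, Q3|exists P4, Q4]; split=> //; tauto.
Qed.

Definition label_of (i : 'I_n) : label :=
  Label (b1 i) (b2 i) (Num.min (a i) (b1 i + b2 i)).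

(** [X] is the label of a piece [A] whose solutions are the members of
    [Fam]. *)
Definition label_ok A Fam (X : label) : Prop :=
  [/\ supp Fam A, attains Fam only0 (lab1 X), attains only0 Fam (lab2 X)
    & attains Fam Fam (lab12 X)].

Lemma label_ok_ext A Fam Fam' X : (forall P, Fam P <-> Fam' P) ->
  label_ok A Fam X -> label_ok A Fam' X.
Proof.
move=> h [s h1 h2 h3]; split; first by move=> P /h; exact: s.
- exact: attains_ext h1.
- exact: attains_ext h2.
- exact: attains_ext h3.
Qed.

Lemma label_ok_edge e : label_ok [set e] (fun P => P = [set e]) (label_of e).
Proof.
have c P Q : P \subset [set e] -> Q \subset [set e] ->
    set_cost P Q = item_price (a e) (b1 e) (b2 e) (e \in P) (e \in Q).
  move=> hP hQ; rewrite /set_cost (bigD1 e) //= big1 ?addr0 // => i ie.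
  have /negbTE-> : i \notin P by apply: contra ie => /(subsetP hP); rewrite inE.
  by have /negbTE-> : i \notin Q by apply: contra ie => /(subsetP hQ); rewrite inE.
split; first by move=> P ->.
- split; [exists [set e], set0|move=> _ _ -> ->]; rewrite ?c ?sub0set //;
    by rewrite !inE eqxx.
- split; [exists set0, [set e]|move=> _ _ -> ->]; rewrite ?c ?sub0set //;
    by rewrite !inE eqxx.
- split; [exists [set e], [set e]|move=> _ _ -> ->]; rewrite ?c //;
    by rewrite !inE eqxx.
Qed.

Lemma label_ok_series A B F G X Y : [disjoint A & B] ->
  label_ok A F X -> label_ok B G Y -> label_ok (A :|: B) (cup F G) (lser X Y).
Proof.
move=> dAB [s h1 h2 h3] [s' h1' h2' h3']; have s0 := @supp0; split.
- by move=> _ [P1 [P2 [/s hP /s' hQ ->]]]; apply: setUSS.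
- by apply: attains_ext (attains_cup dAB s (s0 A) s' (s0 B) h1 h1') => // P;
    exact: cup00.
- by apply: attains_ext (attains_cup dAB (s0 A) s (s0 B) s' h2 h2') => // P;
    exact: cup00.
- exact: (attains_cup dAB s s s' s' h3 h3').
Qed.

Lemma label_ok_parallel A B F G X Y : [disjoint A & B] ->
  label_ok A F X -> label_ok B G Y ->
  label_ok (A :|: B) (fun P => F P \/ G P) (lpar X Y).
Proof.
move=> dAB [s h1 h2 h3] [s' h1' h2' h3'].
have m1 (x y : int) : Num.min x y = Num.min (Num.min x y) (Num.min x y) by lia.
have o0 P : only0 P \/ only0 P <-> only0 P by tauto.
have s0 := @supp0.
split.
- move=> P [/s hP|/s' hP]; apply: subset_trans hP _.
    exact: subsetUl.
  exact: subsetUr.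
- rewrite /= m1.
  by apply: attains_ext (attains_or h1 h1' h1 h1') => //; exact: o0.
- rewrite /= m1 [X in Num.min _ X]minC.
  apply: attains_ext (attains_or h2 h2' h2' h2) => //; exact: o0.
- apply: attains_or h3 h3' _ _ => //.
    apply: attains_ext (attains_cup dAB s (s0 A) (s0 B) s' h1 h2') => P.
      exact: cup0r.
    exact: cup0l.
  apply: attains_ext (attains_cup dAB (s0 A) s s' (s0 B) h2 h1') => P.
    exact: cup0l.
  exact: cup0r.
Qed.

End PairCost.

(** * Paths in series-parallel graphs *)

Section Paths.
Variables (n : nat) (a b1 b2 : 'I_n -> int) (G : graph_inst n).
Implicit Types (A B : {set 'I_n}) (s t u v w : 'I_(nv G)).

Definition end_points (e : 'I_n) : int * int :=
  (((ends G e).1 : nat)%:Z, ((ends G e).2 : nat)%:Z).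

Definition simple_path A s t (P : {set 'I_n}) : Prop :=
  exists es vs, [/\ walk s es vs, uniq (s :: vs), last s vs = t,
    {subset es <= A} & P = [set e in es]].

Lemma vertsP A v :
  reflect (exists2 e, e \in A & (v == (ends G e).1) || (v == (ends G e).2))
    (v \in verts G A).
Proof.
rewrite inE; apply: (iffP existsP) => [[e /andP[eA h]]|[e eA h]]; exists e => //.
by rewrite eA.
Qed.

Lemma joins_verts A e u v : e \in A -> joins e u v ->
  (u \in verts G A) && (v \in verts G A).
Proof.
move=> eA he; apply/andP; split; apply/vertsP; exists e => //;
  by move: he => /orP[]/eqP->; rewrite /= eqxx ?orbT.
Qed.

Lemma vertsE A v : v \in verts G A <-> vert end_points A (v : nat)%:Z.
Proof.
split=> [/vertsP[e eA h]|[e eA h]]; [|apply/vertsP]; exists e => //; move: h;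
  by rewrite /einc /= !eqz_nat -!val_eqE /= ![(v : nat) == _]eq_sym.
Qed.

Lemma joinsE e u v :
  joins e u v = ejoins end_points e (u : nat)%:Z (v : nat)%:Z.
Proof.
by rewrite /joins /ejoins /end_points; case: (ends G e) => x y;
  rewrite !xpair_eqE !eqz_nat.
Qed.

Lemma walk_cat u es vs1 vs2 : walk u es (vs1 ++ vs2) ->
  exists es1 es2, [/\ es = es1 ++ es2, walk u es1 vs1
    & walk (last u vs1) es2 vs2].
Proof.
elim: vs1 u es => [|v vs1 IH] u es /=; first by exists [::], es.
case: es => [//|e es] /andP[he /IH[es1 [es2 [-> h1 h2]]]].
by exists (e :: es1), es2; rewrite /= he.
Qed.

Lemma cat_walk u es1 es2 vs1 vs2 : walk u es1 vs1 ->
  walk (last u vs1) es2 vs2 -> walk u (es1 ++ es2) (vs1 ++ vs2).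
Proof.
elim: es1 u vs1 => [|e es1 IH] u [|v vs1] //= /andP[-> h1] h2; exact: IH.
Qed.

Lemma walk_verts A u es vs v : walk u es vs -> {subset es <= A} ->
  v \in vs -> v \in verts G A.
Proof.
elim: es u vs => [|e es IH] u [|v' vs] //= /andP[he h1] sA.
have /andP[_ v'A] := joins_verts (sA e (mem_head _ _)) he.
rewrite inE => /orP[/eqP->//|]; apply: IH h1 _ => x xes.
by apply: sA; rewrite inE xes orbT.
Qed.

(** A walk can only change over between two parts of the graph at a vertex
    that they share. *)
Lemma walk_stay A B e u v es vs : e \in A -> joins e u v -> walk v es vs ->
  {subset es <= A :|: B} ->
  (forall w, w \in belast v vs -> w \in verts G A -> w \in verts G B -> False) ->
  {subset e :: es <= A}.
Proof.
elim: es e u v vs => [|e' es IH] e u v vs eA he.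
  by move=> _ _ _ x; rewrite inE => /eqP->.
case: vs => [//|v' vs] /= /andP[he' hw] sAB hv.
have /andP[_ vA] := joins_verts eA he.
have e'A : e' \in A.
  have := sAB e' (mem_head _ _); rewrite inE => /orP[//|e'B].
  have /andP[vB _] := joins_verts e'B he'.
  by case: (hv v) => //; rewrite mem_head.
have h : {subset e' :: es <= A}.
  apply: IH e'A he' hw _ _ => [x xes|w wv]; first by apply: sAB; rewrite inE xes orbT.
  by apply: hv; rewrite inE wv orbT.
by move=> x; rewrite inE => /orP[/eqP->//|/h].
Qed.

Lemma belast_mem (T : eqType) (x w : T) (p : seq T) : uniq (x :: p) ->
  w \in belast x p -> w != last x p.
Proof.
rewrite lastI rcons_uniq => /andP[h _] hw.
by apply: contraNneq h => <-.
Qed.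

Lemma path_edge e s t P : s <> t -> joins e s t ->
  simple_path [set e] s t P <-> P = [set e].
Proof.
move=> st he; split; last first.
  move=> ->; exists [:: e], [:: t]; split=> //=.
  - by rewrite he.
  - by rewrite inE andbT; apply/eqP.
  - by move=> x; rewrite !inE.
  - by apply/setP=> x; rewrite !inE.
case=> -[|e1 es] [[|v1 vs] [hw us lt sub Pe]] //.
move: hw us lt => /= /andP[h1 hw] /and3P[us uv _] lt.
have ee : e1 = e by apply/set1P; apply: sub; rewrite mem_head.
move: h1 he hw; rewrite ee !joinsE => h1 he hw.
have v1t : v1 = t.
  apply/val_inj; move: h1; rewrite ejoins_sym => h1.
  by move: he; rewrite ejoins_sym => he; have [] := ejoins_inj h1 he.
case: es vs hw us lt uv sub Pe => [|e2 es] [|v2 vs] //= hw us lt uv sub Pe.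
  by rewrite Pe ee; apply/setP=> x; rewrite !inE.
have e2e : e2 = e by apply/set1P; apply: sub; rewrite !inE eqxx orbT.
move: hw => /andP[]; rewrite e2e joinsE v1t ejoins_sym => h2 _.
have [v2s] := ejoins_inj h2 he.
by move: us; rewrite !inE (val_inj v2s) eqxx orbT.
Qed.

(** A path from [s] to [t] must pass through the joining vertex [m], and as it
    does so only once, it stays in [A] before and in [B] afterwards. *)
Lemma path_series A B s m t P :
  s \in verts G A -> t \in verts G B -> s <> m -> m <> t ->
  verts G A :&: verts G B = [set m] ->
  simple_path (A :|: B) s t P <-> cup (simple_path A s m) (simple_path B m t) P.
Proof.
move=> sA tB sm mt vAB.
have sh w : w \in verts G A -> w \in verts G B -> w = m.
  by move=> wA wB; apply/set1P; rewrite -vAB inE wA.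
split; last first.
  case=> _ [_ [[es1 [vs1 [w1 u1 l1 s1 ->]]] [es2 [vs2 [w2 u2 l2 s2 ->]]] ->]].
  exists (es1 ++ es2), (vs1 ++ vs2); split.
  - by apply: cat_walk w1 _; rewrite l1.
  - have [mv2 uv2] : m \notin vs2 /\ uniq vs2 by move: u2 => /= /andP[].
    rewrite -cat_cons cat_uniq u1 uv2 andbT.
    apply/hasPn => w wv2; apply: contra mv2 => wv1.
    have wB : w \in verts G B by apply: walk_verts w2 s2 wv2.
    have wA : w \in verts G A.
      by move: wv1; rewrite inE => /orP[/eqP->//|]; apply: walk_verts w1 s1.
    by rewrite -(sh w wA wB).
  - by rewrite last_cat l1.
  - move=> x; rewrite mem_cat inE => /orP[/s1->//|/s2->]; exact: orbT.
  - by apply/setP=> x; rewrite !inE mem_cat.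
case=> es [vs [w u l sAB ->]].
have sB : s \notin verts G B by apply/negP => /(sh s sA).
have tA : t \notin verts G A by apply/negP => /sh /(_ tB) tm; apply: mt.
have first e v : e \in A :|: B -> joins e s v -> e \in A.
  rewrite inE => /orP[//|eB] he.
  by have /andP[] := joins_verts eB he; rewrite (negbTE sB).
have mvs : m \in vs.
  apply: contraT => mvs.
  case: es vs w u l sAB mvs => [|e es] [|v vs] // w u l sAB mvs.
    by move: l sB => /= ->; rewrite tB.
  move: w => /= /andP[he hw].
  have eA : e \in A by apply: first he; apply: sAB; rewrite mem_head.
  have h : {subset e :: es <= A}.
    apply: walk_stay eA he hw _ _.
      by move=> x xes; apply: sAB; rewrite inE xes orbT.
    move=> x /mem_belast xv xA xB; move: mvs; rewrite -(sh x xA xB).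
    by rewrite xv.
  case/negP: tA; apply: (walk_verts (u := s) (es := e :: es) (vs := v :: vs)) => //.
    by rewrite /= he.
  by rewrite -l /= mem_last.
case/splitPr: mvs w u l => vs1 vs2 w u l.
move: w; rewrite -cat_rcons => /walk_cat[es1 [es2 [ee w1]]].
rewrite last_rcons => w2.
have [u1 u2] : uniq (s :: rcons vs1 m) /\ uniq (m :: vs2).
  move: u; rewrite -cat_cons cat_uniq => /and3P[h1 h2 h3]; split=> //.
  rewrite -rcons_cons rcons_uniq h1 andbT.
  by move: h2; rewrite /= negb_or => /andP[].
have l2 : last m vs2 = t by move: l; rewrite last_cat /=.
have [s1 s2] : {subset es1 <= A :|: B} /\ {subset es2 <= A :|: B}.
  by split=> x xe; apply: sAB; rewrite ee mem_cat xe ?orbT.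
have h1 : {subset es1 <= A}.
  case: es1 w1 s1 {ee} => [//|e es1]; case def: (rcons vs1 m) => [|v vs3] //=.
  move=> /andP[he hw] s1.
  have eA : e \in A by apply: first he; apply: s1; rewrite mem_head.
  apply: walk_stay eA he hw _ _.
    by move=> x xes; apply: s1; rewrite inE xes orbT.
  move=> x xv xA xB; have xm := sh x xA xB.
  have : uniq (v :: vs3) by move: u1; rewrite -def => /andP[].
  move=> /belast_mem /(_ xv); rewrite -[last v vs3]/(last s (v :: vs3)) -def.
  by rewrite last_rcons xm eqxx.
have h2 : {subset es2 <= B}.
  case: es2 vs2 w2 s2 u2 l2 {ee u l} => [//|e es2] [//|v vs3] /=.
  move=> /andP[he hw] s2 /andP[mv _] l2.
  have eB : e \in B.
    have := s2 e (mem_head _ _); rewrite inE => /orP[eA|//].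
    have h : {subset e :: es2 <= A}.
      apply: walk_stay eA he hw _ _.
        by move=> x xes; apply: s2; rewrite inE xes orbT.
      by move=> x /mem_belast xv xA xB; move: mv; rewrite -(sh x xA xB) xv.
    case/negP: tA; apply: (walk_verts (u := m) (es := e :: es2) (vs := v :: vs3)) => //.
      by rewrite /= he.
    by rewrite -l2 /= mem_last.
  apply: (walk_stay (B := A)) eB he hw _ _.
    by move=> x xes; rewrite setUC; apply: s2; rewrite inE xes orbT.
  by move=> x /mem_belast xv xB xA; move: mv; rewrite -(sh x xA xB) xv.
exists [set e in es1], [set e in es2]; split.
- by exists es1, (rcons vs1 m); split; rewrite ?last_rcons.
- by exists es2, vs2.
- by apply/setP=> x; rewrite ee !inE mem_cat.
Qed.

(** The parts only share the terminals, which a path does not meet on the way,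
    so that it stays in the part of its first edge. *)
Lemma path_parallel A B s t P : s <> t ->
  verts G A :&: verts G B = [set s; t] ->
  simple_path (A :|: B) s t P <-> simple_path A s t P \/ simple_path B s t P.
Proof.
move=> st vAB; split; last first.
  case=> -[es [vs [w u l sub Pe]]]; exists es, vs; split=> // x /sub xA;
    by rewrite inE xA ?orbT.
have half A' B' e es v vs : verts G A' :&: verts G B' = [set s; t] ->
    e \in A' -> joins e s v -> walk v es vs -> uniq [:: s, v & vs] ->
    last v vs = t -> {subset e :: es <= A' :|: B'} ->
    simple_path A' s t [set e' in e :: es].
  move=> vAB' eA he hw u l sAB; exists (e :: es), (v :: vs); split=> //=.
    by rewrite he.
  apply: (walk_stay (B := B')) eA he hw _ _.
    by move=> x xes; apply: sAB; rewrite inE xes orbT.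
  move=> x xv xA xB; have : x \in [set s; t] by rewrite -vAB' inE xA.
  rewrite !inE => /orP[/eqP xs|/eqP xt].
    by move: u => /= /andP[]; rewrite -xs (mem_belast xv).
  by move: u => /= /andP[_ /belast_mem /(_ xv)]; rewrite l xt eqxx.
case=> -[|e es] [[|v vs] [w u l sAB ->]] //; move: w => //= /andP[he hw].
have := sAB e (mem_head _ _); rewrite inE => /orP[eA|eB]; [left|right].
  exact: half vAB eA he hw u l sAB.
apply: half eB he hw u l _; first by rewrite setIC; exact: vAB.
by rewrite setUC.
Qed.

(** A series-parallel graph and its family of paths are built up by the same
    compositions, and each composition of families is matched by one of
    labels. *)
Lemma sp_label A s t : @sp n G A s t ->
  exists2 X, spl end_points (label_of a b1 b2) A (s : nat)%:Z (t : nat)%:Z X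
    & label_ok a b1 b2 A (simple_path A s t) X.
Proof.
elim=> {A s t} [e s t st he|A B s m t _ [X hX vX] _ [Y hY vY] dAB vAB
    |A B s t _ [X hX vX] _ [Y hY vY] dAB vAB].
- exists (label_of a b1 b2 e).
    apply: spl_edge; last by rewrite -joinsE.
    by move=> [] /val_inj.
  apply: label_ok_ext (label_ok_edge a b1 b2 e) => P.
  by split=> /(path_edge P st he).
- have [sm sA mA] := spl_facts hX; have [mt mB tB] := spl_facts hY.
  move: sA mA mB tB; rewrite -!vertsE => sA mA mB tB.
  exists (lser X Y).
    apply: spl_series hX hY dAB _ => v [e eA hv] hv'.
    have [w vw] : exists w : 'I_(nv G), v = (w : nat)%:Z.
      by move: hv => /orP[]/eqP<- /=; eexists.
    rewrite vw in hv hv' *; congr (Posz (nat_of_ord _)); apply/set1P.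
    by rewrite -vAB inE; apply/andP; split; apply/vertsE => //; exists e.
  apply: label_ok_ext (label_ok_series dAB vX vY) => P.
  have sm' : s <> m by move=> h; apply: sm; rewrite h.
  have mt' : m <> t by move=> h; apply: mt; rewrite h.
  by have := path_series P sA tB sm' mt' vAB; tauto.
- have [st sA tA] := spl_facts hX.
  exists (lpar X Y).
    apply: spl_parallel hX hY dAB _ => v [e eA hv] hv'.
    have [w vw] : exists w : 'I_(nv G), v = (w : nat)%:Z.
      by move: hv => /orP[]/eqP<- /=; eexists.
    rewrite vw in hv hv' *.
    have : w \in [set s; t].
      by rewrite -vAB inE; apply/andP; split; apply/vertsE => //; exists e.
    by rewrite !inE => /orP[]/eqP->; [left|right].
  apply: label_ok_ext (label_ok_parallel dAB vX vY) => P.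
  have st' : s <> t by move=> h; apply: st; rewrite h.
  by have := path_parallel P st' vAB; tauto.
Qed.

Lemma series_parallel_label : series_parallel G ->
  exists2 X, spl end_points (label_of a b1 b2) [set: 'I_n]
      (src G : nat)%:Z (snk G : nat)%:Z X
    & is_opt a b1 b2 (st_paths G) (lab12 X).
Proof.
case=> /sp_label[X hX [_ _ _ h]] _; exists X => //.
apply: attains_is_opt h => P; split=> [[es [vs [w u l _ ->]]]|[es [vs [w u l hP]]]].
  by exists es, vs; split=> //; apply/ffunP=> i; rewrite !ffunE inE.
exists es, vs; split=> //; first by move=> x; rewrite inE.
by apply/setP=> i; move/ffunP: hP => /(_ i); rewrite !ffunE inE.
Qed.

End Paths.

(** * Representative selection as a path problem *)

Section Chain.
Variables (n : nat) (a b1 b2 : 'I_n -> int) (pt : 'I_n -> nat).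

(** The representatives are the edges of a path along a chain of vertices,
    consecutive ones being joined by the items of one part. *)
Definition chain_ends (i : 'I_n) : int * int := ((pt i)%:Z, (pt i).+1%:Z).

(** A bunch of parallel edges is decomposed by splitting off one edge after the
    other; its paths are the single edges. *)
Lemma bunch_label j (B : {set 'I_n}) : B != set0 ->
  (forall i, i \in B -> pt i = j) ->
  exists2 X, spl chain_ends (label_of a b1 b2) B j%:Z j.+1%:Z X
    & label_ok a b1 b2 B (fun P => exists2 i, i \in B & P = [set i]) X.
Proof.
have [k] := ubnP #|B|; elim: k B => // k IH B hk /set0Pn[i iB] hB.
have jn : j%:Z <> j.+1%:Z by lia.
have he : spl chain_ends (label_of a b1 b2) [set i] j%:Z j.+1%:Z (label_of a b1 b2 i).
  by apply: spl_edge => //; rewrite /ejoins /chain_ends (hB i iB) eqxx.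
have BE : [set i] :|: (B :\ i) = B by rewrite setD1K.
have [B0|Bn0] := eqVneq (B :\ i) set0.
  rewrite B0 setU0 in BE; exists (label_of a b1 b2 i); first by rewrite -BE.
  rewrite -BE; apply: label_ok_ext (label_ok_edge a b1 b2 i) => P.
  by split=> [->|[i' /set1P-> ->]] //; exists i; rewrite ?inE.
have [||X hX vX] := IH (B :\ i) _ Bn0.
- by move: hk; rewrite (cardsD1 i B) iB ltnS.
- by move=> i' /setD1P[_ /hB].
have dB : [disjoint [set i] & B :\ i] by rewrite disjoints1 !inE eqxx.
exists (lpar (label_of a b1 b2 i) X).
  rewrite -{1}BE; apply: spl_parallel he hX dB _ => v /vert1.
  rewrite /einc /chain_ends (hB i iB) /= => /orP[]/eqP<-; tauto.
rewrite -{1}BE; apply: label_ok_ext (label_ok_parallel dB (label_ok_edge _ _ _ i) vX).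
move=> P; split=> [[->|[i' /setD1P[_ i'B] ->]]|[i' i'B ->]].
- by exists i.
- by exists i'.
have [->|ne] := eqVneq i' i; first by left.
by right; exists i' => //; rewrite !inE ne.
Qed.

Definition below (j : nat) : {set 'I_n} := [set i | (pt i < j)%N].

Definition reps (j : nat) (P : {set 'I_n}) : Prop :=
  P \subset below j /\
  forall k, (k < j)%N -> exists i, P :&: [set i | pt i == k] = [set i].

Lemma chain_label j : (forall k, (k <= j)%N -> exists i, pt i = k) ->
  exists2 X, spl chain_ends (label_of a b1 b2) (below j.+1) 0 j.+1%:Z X
    & label_ok a b1 b2 (below j.+1) (reps j.+1) X.
Proof.
elim: j => [|j IH] hne.
  have b0 i : i \in below 1 -> pt i = 0%N by rewrite inE ltnS leqn0 => /eqP.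
  have bn0 : below 1 != set0.
    have [i hi] := hne 0%N (leqnn _); apply/set0Pn; exists i.
    by rewrite inE hi.
  have bE : [set i | pt i == 0%N] = below 1.
    by apply/setP=> i; rewrite !inE ltnS leqn0.
  have [X hX vX] := bunch_label bn0 b0; exists X => //.
  apply: label_ok_ext vX => P; split=> [[i iB ->]|[sP hP]].
    split; first by rewrite sub1set.
    move=> k; rewrite ltnS leqn0 => /eqP->; exists i.
    by rewrite bE; apply/setIidPl; rewrite sub1set.
  have [i] := hP 0%N isT; rewrite bE; move/setIidPl: (sP) => -> Pi; exists i => //.
  by rewrite -sub1set -Pi.
have [|X hX vX] := IH; first by move=> k kj; apply: hne; apply: leqW.
pose B := [set i | pt i == j.+1].
have Bn0 : B != set0.
  by have [i hi] := hne j.+1 (leqnn _); apply/set0Pn; exists i; rewrite inE hi.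
have Bj i : i \in B -> pt i = j.+1 by rewrite inE => /eqP.
have [Y hY vY] := bunch_label Bn0 Bj.
have bE : below j.+2 = below j.+1 :|: B.
  by apply/setP=> i; rewrite !inE; lia.
have dB : [disjoint below j.+1 & B].
  rewrite -setI_eq0; apply/eqP/setP=> i; rewrite !inE; lia.
exists (lser X Y).
  rewrite bE; apply: spl_series hX hY dB _ => v [i iA hi] [i' iB' hi'].
  move: iA iB' hi hi'; rewrite !inE /einc /chain_ends /= => iA /eqP-> hi hi'.
  move: hi hi' => /orP[]/eqP<- /orP[]/eqP; lia.
rewrite {1}bE; apply: label_ok_ext (label_ok_series dB vX vY) => P; split.
  move=> [P1 [_ [[s1 h1] [i iB ->] ->]]]; split.
    by rewrite bE setUSS // sub1set.
  move=> k; rewrite ltnS leq_eqVlt => /orP[/eqP->|kj].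
    exists i; rewrite -/B setIUl (_ : P1 :&: B = set0).
      by rewrite set0U; apply/setIidPl; rewrite sub1set.
    by apply: disjoint_setI0; apply: disjointWl s1 dB.
  have [i' hi'] := h1 k kj; exists i'; rewrite setIUl hi'.
  rewrite (_ : [set i] :&: _ = set0) ?setU0 //.
  apply/setP=> x; rewrite !inE; case: eqP => // -> /=.
  by rewrite (Bj i iB); lia.
move=> [sP hP]; have [i hi] := hP j.+1 (ltnSn _).
exists (P :&: below j.+1), [set i]; split.
- split; first exact: subsetIr.
  move=> k kj; have [i' hi'] := hP k (ltnW kj); exists i'.
  rewrite -hi'; apply/setP=> x; rewrite !inE; case: (x \in P) => //=.
  by case: eqP => [->|_]; rewrite ?kj ?andbF.
- exists i => //; have : i \in P :&: B by rewrite hi inE.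
  by rewrite inE => /andP[].
- by rewrite -hi -setIUr -bE; apply/esym/setIidPl.
Qed.

End Chain.

Section RepSelection.
Variables (n : nat) (a b1 b2 : 'I_n -> int) (J : rep_inst n).

Lemma rep_label : (0 < ell J)%N -> nom_wf (n := n) (J : nom_inst rep_selection n) ->
  exists2 X, spl (chain_ends (fun i => part_of J i)) (label_of a b1 b2)
      [set: 'I_n] 0 (ell J)%:Z X
    & is_opt a b1 b2 (nom_feas (n := n) (J : nom_inst rep_selection n)) (lab12 X).
Proof.
move=> l0 wf; pose pt i : nat := part_of J i.
have [|X] := @chain_label n a b1 b2 pt (ell J).-1.
  move=> k; rewrite -ltnS prednK // => kl.
  have /eqP/set0Pn[i] := wf (Ordinal kl).
  by rewrite inE => /eqP hi; exists i; rewrite /pt hi.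
rewrite prednK // => hX [_ _ _ vX].
have bT : below pt (ell J) = [set: 'I_n].
  by apply/setP=> i; rewrite !inE; exact: ltn_ord.
rewrite bT in hX; exists X => //.
apply: attains_is_opt vX => P.
have sumE (k : 'I_(ell J)) : (\sum_(i in part J k) [ffun i => i \in P] i)%N
    = #|P :&: [set i | pt i == k]|.
  rewrite -sum1_card big_mkcond [RHS]big_mkcond /=; apply: eq_bigr => i _.
  by rewrite ffunE !inE -val_eqE /=; case: (i \in P); case: eqP.
split=> [[_ hP] k|hP].
  by rewrite sumE; have [i ->] := hP k (ltn_ord k); rewrite cards1.
split; first by rewrite bT subsetT.
move=> k kl; have := hP (Ordinal kl); rewrite sumE => /eqP/cards1P[i hi].
by exists i.
Qed.

Lemma rep_empty : (ell J = 0)%N ->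
  is_opt a b1 b2 (nom_feas (n := n) (J : nom_inst rep_selection n)) 0.
Proof.
move=> l0.
have nj (j : 'I_(ell J)) : False by case: j => x; rewrite l0.
have no (i : 'I_n) : False := nj (part_of J i).
split; last by move=> z1 z2 _ _; rewrite /pair_cost big1 // => i; case: (no i).
exists [ffun=> false], [ffun=> false]; split; last by rewrite /pair_cost big1 // => i; case: (no i).
  by move=> j; case: (nj j).
by move=> j; case: (nj j).
Qed.

End RepSelection.

(** * Solvers for the two-plan problem *)

(** Numbers of registers and arrays shared by all programs: [rN] holds the
    number of items, [rOff] the position in the input at which the description
    of the nominal problem begins. *)
Notation rN := 2%N.
Notation rOff := 6%N.
Notation rOut := 11%N.
Notation aA := 8%N.
Notation aB1 := 9%N.
Notation aB2 := 10%N.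

Definition holds (n a : nat) (f : 'I_n -> int) (st : state) : Prop :=
  forall i : 'I_n, arr st a (i : nat)%:Z = f i.

(** What the main program relies on: [solver] computes the least cost of a pair
    of solutions from the prices in the arrays [aA], [aB1] and [aB2]. *)
Definition solves (P : nominal) (solver : cmd) : Prop :=
  forall B n (nom : nom_inst P n) (off : nat) st (a b1 b2 : 'I_n -> int)
    (Q : state -> Prop),
    nom_wf nom -> (exists z, nom_feas nom z) -> (n < B)%N ->
    (forall i, 0 <= a i) -> (forall i, 0 <= b1 i) -> (forall i, 0 <= b2 i) ->
    reg st rN = n%:Z -> reg st rOff = off%:Z ->
    (forall k, arr st 0 (off + k)%:Z = nth 0 (nom_enc nom) k) ->
    holds aA a st -> holds aB1 b1 st -> holds aB2 b2 st ->
    (forall st', same (mregs solver) (marrs solver) st st' ->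
       is_opt a b1 b2 (nom_feas nom) (reg st' rOut) -> Q st') ->
    wp B solver Q st.

Definition CIfEq (e1 e2 : expr) (c1 c2 : cmd) : cmd :=
  CIf (Sub e1 e2) c2 (CIf (Sub e2 e1) c2 c1).

Lemma wp_ifeq B e1 e2 c1 c2 Q st : okE B st e1 -> okE B st e2 ->
  (eval st e1 = eval st e2 -> wp B c1 Q st) ->
  (eval st e1 <> eval st e2 -> wp B c2 Q st) -> wp B (CIfEq e1 e2 c1 c2) Q st.
Proof.
move=> h1 h2 heq hne; apply: wp_if => /=; rewrite ?h1 ?h2 //.
  by move=> h; apply: hne; lia.
move=> h; apply: wp_if => /=; rewrite ?h1 ?h2 // => h'.
  by apply: hne; lia.
by apply: heq; lia.
Qed.

Definition CMin (r : nat) (e : expr) : cmd :=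
  CIf (Sub (Reg r) e) (CAsgn r e) CSkip.

Lemma wp_min B r e (Q : state -> Prop) st : okE B st e ->
  (forall st', (forall r', reg st' r' =
       if r' == r then Num.min (reg st r) (eval st e) else reg st r') ->
     arr st' = arr st -> Q st') -> wp B (CMin r e) Q st.
Proof.
move=> he hQ; apply: wp_if => /=; first by rewrite he.
  move=> h; apply: wp_asgn => //; apply: hQ => //= r'.
  by case: eqP => // _; lia.
move=> h; apply: wp_skip; apply: hQ => // r'.
by case: eqP => // ->; lia.
Qed.

(** * The series-parallel reduction algorithm *)

(** Each loop counter is followed by the register that holds its bound. *)
Notation sE := 40%N.
Notation sF := 42%N.
Notation sG := 44%N.
Notation sRound := 46%N.
Notation sM := 48%N.
Notation sFlag := 49%N.
Notation sTmp := 50%N.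
Notation sSrc := 51%N.
Notation sSnk := 52%N.
Notation sL1 := 53%N.
Notation sL2 := 54%N.
Notation sL12 := 55%N.
Notation sTmp2 := 56%N.
Notation aAl := 20%N.
Notation aU := 21%N.
Notation aV := 22%N.
Notation aF1 := 23%N.
Notation aF2 := 24%N.
Notation aF12 := 25%N.

Definition aSel (x : bool) : nat := if x then aU else aV.
Definition sel (T : Type) (x : bool) (p : T * T) : T := if x then p.1 else p.2.

Section Graphs.
Variable n : nat.

(** The array [aAl] marks the edges that have not been reduced away. *)
Record graph_in (st : state) (A : {set 'I_n}) (E : 'I_n -> int * int)
    (F : 'I_n -> label) : Prop := GraphIn {
  gi_alive : holds aAl (fun i => (i \in A : nat)%:Z) st;
  gi_end : forall x, holds (aSel x) (fun i => sel x (E i)) st;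
  gi_lab1 : holds aF1 (fun i => lab1 (F i)) st;
  gi_lab2 : holds aF2 (fun i => lab2 (F i)) st;
  gi_lab12 : holds aF12 (fun i => lab12 (F i)) st }.

Lemma graph_in_same rs bs st st' A E F :
  all (fun a => a \notin bs) [:: aAl; aU; aV; aF1; aF2; aF12] ->
  same rs bs st st' -> graph_in st A E F -> graph_in st' A E F.
Proof.
case/and5P=> h1 h2 h3 h4 /and3P[h5 h6 _] hs [g1 g2 g3 g4 g5].
split.
- by move=> i; rewrite (sameA _ hs) // g1.
- by move=> x i; rewrite (sameA _ hs) ?g2 //; case: (x).
- by move=> i; rewrite (sameA _ hs) // g3.
- by move=> i; rewrite (sameA _ hs) // g4.
- by move=> i; rewrite (sameA _ hs) // g5.
Qed.

End Graphs.

(** The tests for a reducible pair of edges, distinguished by which ends of the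
    two edges are compared. *)
Inductive test := TPar of bool | TSer of bool & bool.

Definition redex n (tst : test) (A : {set 'I_n}) (E : 'I_n -> int * int)
    (s t : int) (e f : 'I_n) : Prop :=
  [/\ e \in A, f \in A & e != f] /\
  match tst with
  | TPar x => (E e).1 = sel x (E f) /\ (E e).2 = sel (~~ x) (E f)
  | TSer x y => let m := sel x (E e) in
      [/\ m = sel y (E f), m <> s, m <> t
        & forall h, h \in A -> einc E h m -> h = e \/ h = f]
  end.

Definition cmd_par : cmd :=
  CSeq (CAsgn sL1 (Get aF1 (Reg sE)))
  (CSeq (CMin sL1 (Get aF1 (Reg sF)))
  (CSeq (CAsgn sL2 (Get aF2 (Reg sE)))
  (CSeq (CMin sL2 (Get aF2 (Reg sF)))
  (CSeq (CAsgn sL12 (Get aF12 (Reg sE)))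
  (CSeq (CMin sL12 (Get aF12 (Reg sF)))
  (CSeq (CMin sL12 (Add (Get aF1 (Reg sE)) (Get aF2 (Reg sF))))
  (CSeq (CMin sL12 (Add (Get aF2 (Reg sE)) (Get aF1 (Reg sF))))
  (CSeq (CPut aF1 (Reg sE) (Reg sL1))
  (CSeq (CPut aF2 (Reg sE) (Reg sL2))
  (CSeq (CPut aF12 (Reg sE) (Reg sL12))
        (CPut aAl (Reg sF) (Const 0)))))))))))).

Definition cmd_ser (x y : bool) : cmd :=
  CSeq (CAsgn sTmp (Get (aSel (~~ x)) (Reg sE)))
  (CSeq (CAsgn sTmp2 (Get (aSel (~~ y)) (Reg sF)))
  (CSeq (CPut aU (Reg sE) (Reg sTmp))
  (CSeq (CPut aV (Reg sE) (Reg sTmp2))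
  (CSeq (CPut aF1 (Reg sE) (Add (Get aF1 (Reg sE)) (Get aF1 (Reg sF))))
  (CSeq (CPut aF2 (Reg sE) (Add (Get aF2 (Reg sE)) (Get aF2 (Reg sF))))
  (CSeq (CPut aF12 (Reg sE) (Add (Get aF12 (Reg sE)) (Get aF12 (Reg sF))))
        (CPut aAl (Reg sF) (Const 0)))))))).

(** Finds out whether any third edge meets the vertex [sM], which would rule out
    a series reduction there. *)
Definition cmd_deg2 : cmd :=
  CSeq (CAsgn sFlag (Const 1))
  (CFor sG 45 (Reg rN)
    (CIf (Get aAl (Reg sG))
      (CIfEq (Reg sG) (Reg sE) CSkip (CIfEq (Reg sG) (Reg sF) CSkip
        (CSeq (CIfEq (Get aU (Reg sG)) (Reg sM) (CAsgn sFlag (Const 0)) CSkip)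
              (CIfEq (Get aV (Reg sG)) (Reg sM) (CAsgn sFlag (Const 0)) CSkip))))
      CSkip)).

Definition cmd_test (tst : test) : cmd :=
  CIf (Get aAl (Reg sE)) (CIf (Get aAl (Reg sF))
    (CIfEq (Reg sE) (Reg sF) CSkip
      (match tst with
       | TPar x =>
           CIfEq (Get aU (Reg sE)) (Get (aSel x) (Reg sF))
             (CIfEq (Get aV (Reg sE)) (Get (aSel (~~ x)) (Reg sF)) cmd_par CSkip)
             CSkip
       | TSer x y =>
           CSeq (CAsgn sM (Get (aSel x) (Reg sE)))
             (CIfEq (Reg sM) (Get (aSel y) (Reg sF))
               (CIfEq (Reg sM) (Reg sSrc) CSkip
                 (CIfEq (Reg sM) (Reg sSnk) CSkip
                   (CSeq cmd_deg2 (CIf (Reg sFlag) (cmd_ser x y) CSkip))))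
               CSkip)
       end)) CSkip) CSkip.

Definition cmd_tests : cmd :=
  CSeq (cmd_test (TPar true)) (CSeq (cmd_test (TPar false))
  (CSeq (cmd_test (TSer true true)) (CSeq (cmd_test (TSer true false))
  (CSeq (cmd_test (TSer false true)) (cmd_test (TSer false false)))))).

Definition cmd_pass : cmd :=
  CFor sE 41 (Reg rN) (CFor sF 43 (Reg rN) cmd_tests).

(** A pass that reduces no pair has tested all of them on the same graph, which
    is then irreducible and hence a single edge.  So [n] passes suffice. *)
Definition cmd_reduce : cmd :=
  CSeq (CFor sG 45 (Reg rN)
    (CSeq (CPut aAl (Reg sG) (Const 1))
    (CSeq (CPut aF1 (Reg sG) (Get aB1 (Reg sG)))
    (CSeq (CPut aF2 (Reg sG) (Get aB2 (Reg sG)))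
    (CSeq (CAsgn sL12 (Get aA (Reg sG)))
    (CSeq (CMin sL12 (Add (Get aB1 (Reg sG)) (Get aB2 (Reg sG))))
          (CPut aF12 (Reg sG) (Reg sL12))))))))
  (CSeq (CFor sRound 47 (Reg rN) cmd_pass)
  (CSeq (CAsgn rOut (Const 0))
    (CFor sG 45 (Reg rN)
      (CIf (Get aAl (Reg sG)) (CAsgn rOut (Get aF12 (Reg sG))) CSkip)))).

Section Degree.
Variables (n B : nat).
Hypothesis nB : (n < B)%N.

Lemma alive_int (b : bool) : (0 < (b : nat)%:Z) = b.
Proof. by case: b. Qed.

Lemma wp_deg2 st A E F (e f : 'I_n) (Q : state -> Prop) :
  graph_in st A E F -> reg st rN = n%:Z ->
  reg st sE = (e : nat)%:Z -> reg st sF = (f : nat)%:Z ->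
  (forall st', same (mregs cmd_deg2) (marrs cmd_deg2) st st' ->
     (0 < reg st' sFlag <->
      forall h, h \in A -> einc E h (reg st sM) -> h = e \/ h = f) -> Q st') ->
  wp B cmd_deg2 Q st.
Proof.
move=> hg hN hE hF hQ; apply: wp_seq; apply: wp_asgn => //.
set st1 := set_reg _ _ _.
pose Inv k st' := (0 < reg st' sFlag <->
  forall h : 'I_n, (h < k)%N -> h \in A -> einc E h (reg st sM) -> h = e \/ h = f).
apply: (wp_for (k := n) (Inv := Inv)) => //; first exact: ltnW.
  move=> k st' kn rk hs hI; have [al hend _ _ _] := hg.
  have hA a i : arr st' a i = arr st a i by rewrite (sameA _ hs).
  have rE : reg st' sE = (e : nat)%:Z by rewrite (sameR hs).
  have rF : reg st' sF = (f : nat)%:Z by rewrite (sameR hs).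
  have rM : reg st' sM = reg st sM by rewrite (sameR hs).
  pose i := Ordinal kn.
  have upd (b : bool) st2 : (b <-> (i \in A -> einc E i (reg st sM) -> i = e \/ i = f)) ->
      (0 < reg st2 sFlag <-> (0 < reg st' sFlag /\ b)) ->
      Inv k.+1 (set_reg st2 sG k.+1%:Z).
    move=> hb hfl; rewrite /Inv /=; split.
      move=> /hfl[/hI h1 /hb h2] h; rewrite ltnS leq_eqVlt => /orP[/eqP hk|].
        by have -> : h = i by apply: val_inj.
      exact: h1.
    move=> h; apply/hfl; split; last by apply/hb; exact: h.
    by apply/hI => h' hk; apply: h; exact: leqW.
  have evA : arr st' aAl (reg st' sG) = (i \in A : nat)%:Z.
    by rewrite rk hA -[k]/(i : nat) al.
  have evU : arr st' aU (reg st' sG) = (E i).1.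
    by rewrite rk hA -[k]/(i : nat) (hend true).
  have evV : arr st' aV (reg st' sG) = (E i).2.
    by rewrite rk hA -[k]/(i : nat) (hend false).
  apply: wp_if => //= hal; last first.
    apply: wp_skip; apply: (upd true) => //.
      split=> // _ iA; move: hal; rewrite evA iA //.
    by split=> [|[]].
  apply: wp_ifeq => //= h1.
    apply: wp_skip; apply: (upd true) => //; last by split=> [|[]].
    split=> // _ _ _; left; apply: val_inj => /=; rewrite rk rE in h1.
    by case: h1.
  apply: wp_ifeq => //= h2.
    apply: wp_skip; apply: (upd true) => //; last by split=> [|[]].
    split=> // _ _ _; right; apply: val_inj => /=; rewrite rk rF in h2.
    by case: h2.
  have iA : i \in A by move: hal; rewrite evA alive_int.
  have no : ~ (i = e \/ i = f).
    by case=> ie; [apply: h1; rewrite rk rE -ie|apply: h2; rewrite rk rF -ie].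
  have fin (b : bool) : einc E i (reg st sM) = ~~ b ->
      (b <-> (i \in A -> einc E i (reg st sM) -> i = e \/ i = f)).
    case: b => /= he; split=> //; first by rewrite he.
    by move=> /(_ iA he).
  apply: wp_seq; apply: wp_ifeq => //= h3.
    apply: wp_asgn => //=; apply: wp_ifeq => //= h4.
      apply: wp_asgn => //; apply: (upd false) => /=; last by split=> [|[]].
      by apply: fin; rewrite /einc -evU h3 rM eqxx.
    apply: wp_skip; apply: (upd false) => /=; last by split=> [|[]].
    by apply: fin; rewrite /einc -evU h3 rM eqxx.
  apply: wp_skip; apply: wp_ifeq => //= h4.
    apply: wp_asgn => //; apply: (upd false) => /=; last by split=> [|[]].
    by apply: fin; rewrite /einc -evV h4 rM eqxx orbT.
  apply: wp_skip; apply: (upd true); last by split=> [|[]].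
  apply: fin => /=; rewrite /einc -evU -evV -rM.
  by apply/negbTE; rewrite negb_or; apply/andP; split; apply/eqP.
move=> st' hs hI; apply: hQ.
  apply: (same_trans (s2 := st1) (rs := [:: sFlag]) (bs := [::])) hs => //.
  - by move=> x; rewrite !inE => ->.
  - by move=> x; rewrite !inE => /orP[]->; rewrite ?orbT // => ->; rewrite ?orbT.
  - by apply: same_set_reg; rewrite inE.
by split=> [/hI h h' *|h]; [apply: h|apply/hI => h' _; apply: h].
Qed.

End Degree.

Section Reduce.
Variables (n B : nat) (s t : int) (X : label).
Hypothesis nB : (n < B)%N.

Definition merged (T : Type) (F : 'I_n -> T) (e : 'I_n) (v : T) (i : 'I_n) : T :=
  if i == e then v else F i.

Lemma eq_ordz (i j : 'I_n) : ((i : nat)%:Z == (j : nat)%:Z) = (i == j).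
Proof. by rewrite eqz_nat val_eqE. Qed.

Lemma wp_par st (A : {set 'I_n}) E F (e f : 'I_n) :
  graph_in st A E F -> reg st sE = (e : nat)%:Z -> reg st sF = (f : nat)%:Z ->
  e != f ->
  wp B cmd_par (fun st' => graph_in st' (A :\ f) E
    (merged F e (lpar (F e) (F f)))) st.
Proof.
move=> [g1 g2 g3 g4 g5] hE hF ef.
apply: wp_seq; apply: wp_asgn => //.
apply: wp_seq; apply: wp_min => //= s1 r1 a1.
apply: wp_seq; apply: wp_asgn => //=.
apply: wp_seq; apply: wp_min => //= s2 r2 a2.
apply: wp_seq; apply: wp_asgn => //=.
apply: wp_seq; apply: wp_min => //= s3 r3 a3.
apply: wp_seq; apply: wp_min => //= s4 r4 a4.
apply: wp_seq; apply: wp_min => //= s5 r5 a5.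
apply: wp_seq; apply: wp_put => //=.
apply: wp_seq; apply: wp_put => //=.
apply: wp_seq; apply: wp_put => //=.
apply: wp_put => //=.
have EE : [/\ reg s1 sE = (e : nat)%:Z, reg s2 sE = (e : nat)%:Z,
    reg s3 sE = (e : nat)%:Z & reg s4 sE = (e : nat)%:Z /\
    reg s5 sE = (e : nat)%:Z].
  by split; last split; rewrite ?r5 /= ?r4 /= ?r3 /= ?r2 /= ?r1 /=.
have FF : [/\ reg s1 sF = (f : nat)%:Z, reg s2 sF = (f : nat)%:Z,
    reg s3 sF = (f : nat)%:Z & reg s4 sF = (f : nat)%:Z /\
    reg s5 sF = (f : nat)%:Z].
  by split; last split; rewrite ?r5 /= ?r4 /= ?r3 /= ?r2 /= ?r1 /=.
have [E1 E2 E3 [E4 E5]] := EE; have [F1 F2 F3 [F4 F5]] := FF.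
have v1 : reg s5 sL1 = lab1 (lpar (F e) (F f)).
  by rewrite r5 /= r4 /= r3 /= r2 /= r1 /= hE hF !g3.
have v2 : reg s5 sL2 = lab2 (lpar (F e) (F f)).
  by rewrite r5 /= r4 /= r3 /= r2 /= E1 F1 a1 /= !g4.
have v3 : reg s5 sL12 = lab12 (lpar (F e) (F f)).
  rewrite r5 /= r4 /= r3 /= E2 F2 E3 F3 E4 F4 a4 a3 /= a2 /= a1 /= !g3 !g4 !g5.
  by rewrite -minA.
have aE a i : arr s5 a i = arr st a i.
  by rewrite a5 a4 a3 /= a2 /= a1.
split=> [i|x i|i|i|i] /=.
- by rewrite F5 eq_ordz !inE aE; case: eqP => //= _; rewrite g1.
- by case: x => /=; rewrite aE; [apply: (g2 true)|apply: (g2 false)].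
- by rewrite E5 eq_ordz v1 aE g3 /merged; case: eqP.
- by rewrite E5 eq_ordz v2 aE g4 /merged; case: eqP.
- by rewrite E5 eq_ordz v3 aE g5 /merged; case: eqP.
Qed.

Lemma wp_ser st (A : {set 'I_n}) E F (e f : 'I_n) x y :
  graph_in st A E F -> reg st sE = (e : nat)%:Z -> reg st sF = (f : nat)%:Z ->
  wp B (cmd_ser x y) (fun st' => graph_in st' (A :\ f)
    (merged E e (sel (~~ x) (E e), sel (~~ y) (E f)))
    (merged F e (lser (F e) (F f)))) st.
Proof.
move=> [g1 g2 g3 g4 g5] hE hF.
do 7! (apply: wp_seq; first [apply: wp_asgn => //= | apply: wp_put => //=]).
apply: wp_put => //=; rewrite ?hE ?hF.
split=> [i|z i|i|i|i] /=.
- by rewrite eq_ordz !inE; case: eqP => //= _; rewrite g1.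
- rewrite /merged; case: z => /=; rewrite eq_ordz; case: eqP => //= _.
  + by rewrite g2.
  + exact: (g2 true).
  + by rewrite g2.
  + exact: (g2 false).
- by rewrite eq_ordz !g3 /merged; case: eqP.
- by rewrite eq_ordz !g4 /merged; case: eqP.
- by rewrite eq_ordz !g5 /merged; case: eqP.
Qed.

(** The state of a pass that began with [c] edges: either an edge has already
    been removed, or none of the pairs tested so far, those in [P], can be
    reduced. *)
Definition pass_inv (c : nat) (P : test -> 'I_n -> 'I_n -> Prop)
    (st : state) : Prop :=
  exists (A : {set 'I_n}) E F, [/\ graph_in st A E F, spl E F A s t X,
    (#|A| <= c)%N
    & (#|A| < c)%N \/ forall tst e f, P tst e f -> ~ redex tst A E s t e f].

Lemma pass_inv_sub c (P P' : test -> 'I_n -> 'I_n -> Prop) st :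
  (forall tst e f, P' tst e f -> P tst e f) ->
  pass_inv c P st -> pass_inv c P' st.
Proof.
move=> hP [A [E [F [h1 h2 h3 h4]]]]; exists A, E, F; split=> //.
by case: h4 => h4; [left|right=> ? ? ? /hP; apply: h4].
Qed.

Lemma ejoins_sel (E : 'I_n -> int * int) (e : 'I_n) (x : bool) :
  ejoins E e (sel x (E e)) (sel (~~ x) (E e)).
Proof.
by rewrite /ejoins; case: x; case: (E e) => a b; rewrite /= eqxx ?orbT.
Qed.

Lemma setD1U1 (A : {set 'I_n}) e f : e \in A -> e != f ->
  e |: (A :\ e :\ f) = A :\ f.
Proof.
move=> eA ef; apply/setP=> x; rewrite !inE; case: (eqVneq x e) => //= ->.
by rewrite ef eA.
Qed.

(** A successful test applies a reduction, which keeps the label [X] and removes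
    an edge; a failed one adds its pair to those known to be irreducible. *)
Lemma wp_test tst c P st (e f : 'I_n) :
  pass_inv c P st -> reg st rN = n%:Z -> reg st sSrc = s -> reg st sSnk = t ->
  reg st sE = (e : nat)%:Z -> reg st sF = (f : nat)%:Z ->
  wp B (cmd_test tst)
    (pass_inv c (fun tst' e' f' =>
       P tst' e' f' \/ [/\ tst' = tst, e' = e & f' = f])) st.
Proof.
move=> [A [E [F [hg hX hc hP]]]] hN hs ht hE hF.
pose Q := pass_inv c (fun tst' e' f' =>
       P tst' e' f' \/ [/\ tst' = tst, e' = e & f' = f]).
have [g1 g2 g3 g4 g5] := hg.
have unred st' : graph_in st' A E F -> ~ redex tst A E s t e f -> Q st'.
  move=> hg' no; exists A, E, F; split=> //.
  case: hP => h; [by left|right=> tst' e' f' [/h//|[-> -> ->]//]].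
have small : e \in A -> f \in A -> e != f ->
    (#|A :\ f| <= c)%N /\ (#|A :\ f| < c)%N.
  by move=> _ fA _; move: hc; rewrite (cardsD1 f A) fA add1n => h; split=> //; exact: ltnW.
apply: wp_if => //=; rewrite ?hE ?hF g1; last first.
  move=> h; apply: wp_skip; apply: unred => // -[[eA _ _] _].
  by rewrite eA in h.
rewrite alive_int => eA; apply: wp_if => //=; rewrite hF g1; last first.
  move=> h; apply: wp_skip; apply: unred => // -[[_ fA _] _].
  by rewrite fA in h.
rewrite alive_int => fA; apply: wp_ifeq => //=; rewrite hE hF.
  move=> [] /val_inj ef; apply: wp_skip; apply: unred => // -[[_ _]].
  by rewrite ef eqxx.
move=> efn; have ef : e != f by apply/eqP => ef; apply: efn; rewrite ef.
have [c1 c2] := small eA fA ef.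
have off (T : Type) (H : 'I_n -> T) v h : h != e -> merged H e v h = H h.
  by rewrite /merged => /negbTE->.
case: tst @Q unred => [x|x y] Q unred.
- have gU : arr st aU (e : nat)%:Z = (E e).1 by exact: (g2 true).
  have gV : arr st aV (e : nat)%:Z = (E e).2 by exact: (g2 false).
  apply: wp_ifeq => //=; rewrite hE hF g2 gU => h1; last first.
    by apply: wp_skip; apply: unred => // -[_ []].
  apply: wp_ifeq => //=; rewrite hE hF g2 gV => h2; last first.
    by apply: wp_skip; apply: unred => // -[_ []].
  apply: wp_frame (wp_par hg hE hF ef) _ => st' _ hg'.
  exists (A :\ f), E, (merged F e (lpar (F e) (F f))); split=> //; last by left.
  rewrite -(setD1U1 eA ef).
  have he : ejoins E e (E e).1 (E e).2 by exact: (ejoins_sel E e true).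
  have hf : ejoins E f (E e).1 (E e).2 by rewrite h1 h2; exact: ejoins_sel.
  apply: (spl_reduce_parallel hX eA fA ef he hf _ _ he).
  + by move=> h he' _; rewrite off.
  + by left.
  + by rewrite /merged eqxx.
- apply: wp_seq; apply: wp_asgn => //=; rewrite hE g2; set m := sel x (E e).
  apply: wp_ifeq => //=; rewrite hF g2 => h1; last first.
    by apply: wp_skip; apply: unred => // -[_ []].
  apply: wp_ifeq => //=; rewrite hs => h2.
    by apply: wp_skip; apply: unred => // -[_ []].
  apply: wp_ifeq => //=; rewrite ht => h3.
    by apply: wp_skip; apply: unred => // -[_ []].
  apply: wp_seq; apply: (wp_deg2 nB (A := A) (E := E) (F := F) (e := e) (f := f));
    rewrite //.
  move=> st' hs' /= hfl.
  have hg' : graph_in st' A E F by apply: graph_in_same hs' _ => //; case: hg.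
  have hE' : reg st' sE = (e : nat)%:Z by rewrite (sameR hs').
  have hF' : reg st' sF = (f : nat)%:Z by rewrite (sameR hs').
  apply: wp_if => //= h4; last first.
    apply: wp_skip; apply: unred => // -[_ [_ _ _ h5]].
    by move: h4; rewrite leNgt => /negP; apply; apply/hfl.
  apply: wp_frame (wp_ser x y hg' hE' hF') _ => st2 _ hg2.
  exists (A :\ f), (merged E e (sel (~~ x) (E e), sel (~~ y) (E f))),
    (merged F e (lser (F e) (F f))); split=> //; last by left.
  rewrite -(setD1U1 eA ef).
  have he : ejoins E e (sel (~~ x) (E e)) m.
    by rewrite ejoins_sym; exact: ejoins_sel.
  have hf : ejoins E f m (sel (~~ y) (E f)) by rewrite h1; exact: ejoins_sel.
  apply: (spl_reduce_series hX eA fA ef he hf) => //.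
  + by apply/hfl.
  + by move=> h he' _; rewrite !off.
  + by left.
  + by rewrite /merged /ejoins eqxx eqxx.
  + by rewrite /merged eqxx.
Qed.

Lemma wp_tests c P st (e f : 'I_n) :
  pass_inv c P st -> reg st rN = n%:Z -> reg st sSrc = s -> reg st sSnk = t ->
  reg st sE = (e : nat)%:Z -> reg st sF = (f : nat)%:Z ->
  wp B cmd_tests
    (pass_inv c (fun tst' e' f' => P tst' e' f' \/ e' = e /\ f' = f)) st.
Proof.
move=> hI hN hs ht hE hF.
have next tst c2 P1 (Q : state -> Prop) st1 : pass_inv c P1 st1 ->
    reg st1 rN = n%:Z -> reg st1 sSrc = s -> reg st1 sSnk = t ->
    reg st1 sE = (e : nat)%:Z -> reg st1 sF = (f : nat)%:Z ->
    (forall st2, pass_inv c (fun tst' e' f' =>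
        P1 tst' e' f' \/ [/\ tst' = tst, e' = e & f' = f]) st2 ->
      reg st2 rN = n%:Z -> reg st2 sSrc = s -> reg st2 sSnk = t ->
      reg st2 sE = (e : nat)%:Z -> reg st2 sF = (f : nat)%:Z -> wp B c2 Q st2) ->
    wp B (CSeq (cmd_test tst) c2) Q st1.
  move=> h1 h2 h3 h4 h5 h6 h7; apply: wp_seq.
  apply: wp_frame (wp_test tst h1 h2 h3 h4 h5 h6) _ => st2 hs2 hI2.
  by apply: h7 => //; rewrite (sameR hs2) //; case: (tst) => [[]|[] []].
do 5! apply: (next _ _ _ _ _ hI hN hs ht hE hF)
  => {st hI hN hs ht hE hF} st hI hN hs ht hE hF.
apply: wp_mono (wp_test _ hI hN hs ht hE hF) => st2.
apply: pass_inv_sub => tst' e' f' [h|[-> ->]]; first by tauto.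
by case: tst' => [[]|[] []]; do 5? [by right | left]; right.
Qed.

Lemma wp_pass c st :
  pass_inv c (fun _ _ _ => False) st ->
  reg st rN = n%:Z -> reg st sSrc = s -> reg st sSnk = t ->
  wp B cmd_pass (pass_inv c (fun _ _ _ => True)) st.
Proof.
move=> hI hN hs ht.
pose I1 k := pass_inv c (fun _ e f => (e < k)%N).
apply: (wp_for (k := n) (Inv := I1)) => //; first exact: ltnW.
- case: hI => A [E [F [h1 h2 h3 h4]]]; exists A, E, F; split=> //.
    by case: h1.
  by right.
- move=> i st1 iN ri sm1 hI1.
  have [hN1 hs1 ht1] : [/\ reg st1 rN = n%:Z, reg st1 sSrc = s & reg st1 sSnk = t].
    by rewrite !(sameR sm1).
  pose I2 k := pass_inv c (fun _ e f => (e < i)%N \/ (e : nat) = i /\ (f < k)%N).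
  apply: (wp_for (k := n) (Inv := I2)) => //; first exact: ltnW.
  + case: hI1 => A [E [F [h1 h2 h3 h4]]]; exists A, E, F; split=> //; first by case: h1.
    by case: h4 => h4; [left|right=> ? ? ? []; [apply: h4|case]].
  + move=> j st2 jN rj sm2 hI2.
    have [hN2 hs2 ht2] : [/\ reg st2 rN = n%:Z, reg st2 sSrc = s & reg st2 sSnk = t].
      by rewrite !(sameR sm2).
    have ri2 : reg st2 sE = (Ordinal iN : nat)%:Z by rewrite (sameR sm2).
    apply: wp_mono (wp_tests (f := Ordinal jN) hI2 hN2 hs2 ht2 ri2 rj) => st3.
    case=> A [E [F [h1 h2 h3 h4]]]; exists A, E, F; split=> //; first by case: h1.
    case: h4 => h4; [by left|right=> tst e f he; apply: h4].
    case: he => [|[he hf]]; first by tauto.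
    move: hf; rewrite ltnS leq_eqVlt => /orP[/eqP hf|]; last by tauto.
    by right; split; apply: val_inj.
  + move=> st2 sm2; case=> A [E [F [h1 h2 h3 h4]]]; exists A, E, F; split=> //.
      by case: h1.
    case: h4 => h4; [by left|right=> tst e f he; apply: h4].
    by move: he; rewrite ltnS leq_eqVlt => /orP[/eqP he|]; [right|left].
- by move=> st1 _; apply: pass_inv_sub => tst e f _ /=.
Qed.

Lemma irreducible_edge E F (A : {set 'I_n}) : spl E F A s t X ->
  (forall tst e f, ~ redex tst A E s t e f) -> exists e, A = [set e].
Proof.
move=> hX no; have [//|[e [f hred]]] := spl_progress hX.
have ends u v (g : 'I_n) : ejoins E g u v ->
    exists x, sel x (E g) = u /\ sel (~~ x) (E g) = v.
  by move=> /orP[]/eqP->; [exists true|exists false].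
case: hred => [[eA fA ef [u [v /andP[he hf]]]]|[eA fA ef [u [m [v [he hf ms mt hm]]]]]].
  have [x [x1 x2]] := ends _ _ _ he; have [y [y1 y2]] := ends _ _ _ hf.
  case: (no (TPar (if x then y else ~~ y)) e f); split=> //.
  by case: x x1 x2 => /= -> ->; rewrite ?negbK.
have [x [x1 x2]] := ends _ _ _ he; have [y [y1 y2]] := ends _ _ _ hf.
case: (no (TSer (~~ x) y) e f); split=> //=.
by rewrite x2 y1.
Qed.

End Reduce.

Lemma wp_reduce n B st (a b1 b2 : 'I_n -> int) (E : 'I_n -> int * int) s t X :
  (n < B)%N -> reg st rN = n%:Z -> reg st sSrc = s -> reg st sSnk = t ->
  holds aA a st -> holds aB1 b1 st -> holds aB2 b2 st ->
  (forall x, holds (aSel x) (fun i => sel x (E i)) st) ->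
  spl E (label_of a b1 b2) [set: 'I_n] s t X ->
  wp B cmd_reduce (fun st' => reg st' rOut = lab12 X) st.
Proof.
move=> nB hN hs ht ha hb1 hb2 hE hX; apply: wp_seq.
pose F := label_of a b1 b2.
pose I1 k st' := [/\ forall i : 'I_n, (i < k)%N -> arr st' aAl (i : nat)%:Z = 1,
  forall i : 'I_n, (i < k)%N -> arr st' aF1 (i : nat)%:Z = lab1 (F i),
  forall i : 'I_n, (i < k)%N -> arr st' aF2 (i : nat)%:Z = lab2 (F i)
  & forall i : 'I_n, (i < k)%N -> arr st' aF12 (i : nat)%:Z = lab12 (F i)].
apply: (wp_for (k := n) (Inv := I1)) => //; first exact: ltnW.
  move=> k st1 kn rk sm [i1 i2 i3 i4]; pose i := Ordinal kn.
  have hA j : j \in [:: aA; aB1; aB2] -> arr st1 j k%:Z = arr st j (i : nat)%:Z.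
    by rewrite !inE => /or3P[]/eqP->; rewrite (sameA _ sm).
  do 3! (apply: wp_seq; apply: wp_put => //=).
  apply: wp_seq; apply: wp_asgn => //=.
  apply: wp_seq; apply: wp_min => //= st2 r2 a2.
  apply: wp_put => //=; rewrite /I1 /= !r2 /= rk a2 /= rk !hA // ha hb1 hb2.
  split=> j; rewrite ltnS leq_eqVlt eqz_nat => /orP[/eqP jk|jk];
    first [by have -> : j = i by [apply: val_inj]; rewrite eqxx
          |by rewrite (ltn_eqF jk) (i1, i2, i3, i4)].
move=> st1 sm1 [i1 i2 i3 i4].
have hg : graph_in st1 [set: 'I_n] E F.
  split=> [i|x i|i|i|i]; rewrite ?i1 ?i2 ?i3 ?i4 ?inE //.
  by rewrite (sameA _ sm1) ?hE //; case: (x).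
have [hN1 hs1 ht1] : [/\ reg st1 rN = n%:Z, reg st1 sSrc = s & reg st1 sSnk = t].
  by rewrite !(sameR sm1).
apply: wp_seq.
pose I2 k st' := exists (A : {set 'I_n}) E F, [/\ graph_in st' A E F,
   spl E F A s t X & (#|A| + k <= n)%N \/ (#|A| <= 1)%N].
apply: (wp_for (k := n) (Inv := I2)) => //; first exact: ltnW.
- exists [set: 'I_n], E, F; split=> //; first by case: hg.
  by left; rewrite cardsT card_ord addn0.
- move=> k st2 kn _ sm2 [A [E' [F' [hg' hX' hk]]]].
  have [hN2 hs2 ht2] : [/\ reg st2 rN = n%:Z, reg st2 sSrc = s & reg st2 sSnk = t].
    by rewrite !(sameR sm2).
  have hI : pass_inv s t X #|A| (fun (_ : test) (_ _ : 'I_n) => False) st2.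
    by exists A, E', F'; split=> //; right.
  apply: wp_mono (wp_pass nB hI hN2 hs2 ht2) => st3 [A3 [E3 [F3 [g3 X3 c3 d3]]]].
  exists A3, E3, F3; split=> //; first by case: g3.
  case: d3 => [lt|irr]; first by lia.
  right; have [|e ->] := irreducible_edge X3; last by rewrite cards1.
  by move=> tst e f; apply: irr.
move=> st2 sm2 [A [E' [F' [hg' hX' hk]]]].
have [e Ae] : exists e, A = [set e].
  apply/cards1P; have : (0 < #|A|)%N by rewrite card_gt0; apply: spl_neq0 hX'.
  by lia.
rewrite Ae in hg' hX'; have XE := spl_label1 hX'.
apply: wp_seq; apply: wp_asgn => //.
have hN2 : reg st2 rN = n%:Z by rewrite (sameR sm2).
pose I3 k st' := (e < k)%N -> reg st' rOut = lab12 X.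
apply: (wp_for (k := n) (Inv := I3)) => //; first exact: ltnW.
- move=> k st3 kn rk sm3 hI; pose i := Ordinal kn.
  have hA j x : arr st3 j x = arr st2 j x by rewrite (sameA _ sm3).
  have [h1 _ _ _ h5] := hg'.
  apply: wp_if => //=; rewrite rk hA -[k]/(i : nat) h1 ?alive_int inE => hi.
    by apply: wp_asgn => //= _; rewrite rk hA -[k]/(i : nat) h5 XE (eqP hi).
  suff h : I3 k.+1 (set_reg st3 sG k.+1%:Z) by [].
  rewrite /I3 /= ltnS leq_eqVlt => /orP[/eqP ek|/hI//].
  by have ie : i = e by [apply: val_inj]; rewrite ie eqxx in hi.
- by move=> st3 _; apply; exact: ltn_ord.
Qed.

(** A representative selection problem with no parts has no items either, and
    is not covered by the series-parallel graphs. *)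
Lemma wp_reduce0 B st : (0 < B)%N -> reg st rN = 0 ->
  wp B cmd_reduce (fun st' => reg st' rOut = 0) st.
Proof.
move=> B0 hN; apply: wp_seq.
apply: (wp_for (k := 0) (Inv := fun _ _ => True)) => // st1 sm1 _.
have hN1 : reg st1 rN = 0 by rewrite (sameR sm1).
apply: wp_seq; apply: (wp_for (k := 0) (Inv := fun _ _ => True)) => // st2 sm2 _.
have hN2 : reg st2 rN = 0 by rewrite (sameR sm2).
apply: wp_seq; apply: wp_asgn => //=.
exact: (wp_for (k := 0) (Inv := fun _ st' => reg st' rOut = 0)).
Qed.

Definition cmd_load_graph : cmd :=
  CSeq (CAsgn sSrc (Get 0 (Add (Reg rOff) (Const 1))))
  (CSeq (CAsgn sSnk (Get 0 (Add (Reg rOff) (Const 2))))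
    (CFor sG 45 (Reg rN)
      (CSeq (CPut aU (Reg sG)
               (Get 0 (Add (Reg rOff) (Add (Const 3) (Add (Reg sG) (Reg sG))))))
            (CPut aV (Reg sG)
               (Get 0 (Add (Reg rOff) (Add (Const 4) (Add (Reg sG) (Reg sG))))))))).

(** The item [i] of part [j] becomes an edge from [j] to [j.+1]. *)
Definition cmd_load_parts : cmd :=
  CSeq (CAsgn sSrc (Const 0))
  (CSeq (CAsgn sSnk (Get 0 (Reg rOff)))
    (CFor sG 45 (Reg rN)
      (CSeq (CPut aU (Reg sG)
               (Get 0 (Add (Reg rOff) (Add (Const 1) (Reg sG)))))
            (CPut aV (Reg sG)
               (Add (Get 0 (Add (Reg rOff) (Add (Const 1) (Reg sG)))) (Const 1)))))).

Definition graph_solver : cmd := CSeq cmd_load_graph cmd_reduce.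
Definition rep_solver : cmd := CSeq cmd_load_parts cmd_reduce.

Lemma wp_load n B (E : 'I_n -> int * int) eU eV st k0 k1 (Q : state -> Prop) :
  (n <= B)%N -> okE B st k0 -> okE B (set_reg st sSrc (eval st k0)) k1 ->
  reg st rN = n%:Z ->
  (forall (i : 'I_n) st', reg st' sG = (i : nat)%:Z -> reg st' rOff = reg st rOff ->
     (forall j, arr st' 0 j = arr st 0 j) ->
     [/\ okE B st' eU, okE B st' eV, eval st' eU = (E i).1
       & eval st' eV = (E i).2]) ->
  (forall st', same [:: sG; 45; sSrc; sSnk]%N [:: aU; aV] st st' ->
     reg st' sSrc = eval st k0 ->
     reg st' sSnk = eval (set_reg st sSrc (eval st k0)) k1 ->
     (forall x, holds (aSel x) (fun i => sel x (E i)) st') -> Q st') ->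
  wp B (CSeq (CAsgn sSrc k0) (CSeq (CAsgn sSnk k1)
    (CFor sG 45 (Reg rN) (CSeq (CPut aU (Reg sG) eU) (CPut aV (Reg sG) eV)))))
    Q st.
Proof.
move=> nB ok0 ok1 hN hE hQ.
apply: wp_seq; apply: wp_asgn => //; apply: wp_seq; apply: wp_asgn => //.
set st1 := set_reg _ _ _.
have sm1 : same [:: sG; 45; sSrc; sSnk]%N [:: aU; aV] st st1.
  apply: (same_trans (s2 := set_reg st sSrc (eval st k0))
    (rs := [:: sSrc]) (rs' := [:: sSnk]) (bs := [::]) (bs' := [::])) => //.
  - by move=> x; rewrite !inE => /eqP->.
  - by move=> x; rewrite !inE => /eqP->.
  - by apply: same_set_reg; rewrite inE.
  - by apply: same_set_reg; rewrite inE.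
pose Inv k st' := forall i : 'I_n, (i < k)%N ->
  arr st' aU (i : nat)%:Z = (E i).1 /\ arr st' aV (i : nat)%:Z = (E i).2.
apply: (wp_for (k := n) (Inv := Inv)) => //.
- move=> k st2 kn rk sm2 hI; pose i := Ordinal kn.
  have ro : reg st2 rOff = reg st rOff by rewrite (sameR sm2).
  have ao j : arr st2 0 j = arr st 0 j by rewrite (sameA _ sm2).
  have [o1 o2 e1 e2] := hE i st2 rk ro ao.
  have [o1' o2' e1' e2'] :=
    hE i (set_arr st2 aU (reg st2 sG) (eval st2 eU)) rk ro ao.
  apply: wp_seq; apply: wp_put => //; apply: wp_put => //.
  rewrite e2' e1 /= rk => j; rewrite ltnS leq_eqVlt /= eqz_nat => /orP[/eqP jk|jk].
    by have -> : j = i by [apply: val_inj]; rewrite eqxx.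
  by rewrite (ltn_eqF jk); apply: hI.
- move=> st2 sm2 hI; apply: hQ.
  + apply: same_trans sm1 sm2 => // x; rewrite !inE.
    by move=> /orP[]->; rewrite ?orbT.
  + by rewrite (sameR sm2).
  + by rewrite (sameR sm2).
  + by move=> x i; have [h1 h2] := hI i (ltn_ord i); case: x.
Qed.

Lemma graph_solver_ok : solves sp_shortest_path graph_solver.
Proof.
move=> B n G off st a b1 b2 Q wf _ nB _ _ _ hN hO hin ha hb1 hb2 hQ.
have [X hX hopt] := series_parallel_label a b1 b2 wf.
apply: wp_frame (_ : wp B _ (fun st' => reg st' rOut = lab12 X) st) _; last first.
  by move=> st' hs e; apply: hQ; rewrite ?e.
have encE k : (k < n)%N -> forall i : 'I_n, k = i ->
    arr st 0 (off + (3 + (i + i)))%:Z = (end_points G i).1 /\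
    arr st 0 (off + (4 + (i + i)))%:Z = (end_points G i).2.
  move=> _ i _; rewrite !hin.
  have flat (s1 : seq 'I_n) (j : nat) x0 : (j < size s1)%N ->
    nth 0 (flatten [seq [:: ((ends G e).1 : nat)%:Z; ((ends G e).2 : nat)%:Z] | e <- s1])
       (j + j) = ((ends G (nth x0 s1 j)).1 : nat)%:Z /\
    nth 0 (flatten [seq [:: ((ends G e).1 : nat)%:Z; ((ends G e).2 : nat)%:Z] | e <- s1])
       (j + j).+1 = ((ends G (nth x0 s1 j)).2 : nat)%:Z.
    elim: s1 j => [//|e s1 IH] [|j] //= hj.
    by rewrite addnS /=; apply: IH.
  have [|h1 h2] := flat (enum 'I_n) i i; first by rewrite size_enum_ord.
  by rewrite nth_ord_enum in h1 h2; exact: (conj h1 h2).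
apply: wp_seq; apply: (wp_load (E := end_points G)) => //.
- exact: ltnW.
- move=> i st' rG rO aO; rewrite /= rG rO hO !aO.
  by have [] := encE i (ltn_ord i) i erefl; rewrite !PoszD => -> ->.
move=> st' sm e1 e2 hE; apply: (wp_reduce nB) hX => //.
- by rewrite (sameR sm).
- by rewrite e1 /= hO -PoszD hin.
- by rewrite e2 /= hO -PoszD hin.
- by move=> i; rewrite (sameA _ sm).
- by move=> i; rewrite (sameA _ sm).
- by move=> i; rewrite (sameA _ sm).
Qed.

Lemma rep_solver_ok : solves rep_selection rep_solver.
Proof.
move=> B n J off st a b1 b2 Q wf _ nB _ _ _ hN hO hin ha hb1 hb2 hQ.
have encE (i : 'I_n) : arr st 0 (off + (1 + i))%:Z = (part_of J i : nat)%:Z.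
  rewrite hin; transitivity (nth 0 [seq (part_of J i : nat)%:Z | i <- enum 'I_n] i).
    by [].
  by rewrite (nth_map i) ?size_enum_ord // nth_ord_enum.
have [l0|l0] := posnP (ell J).
  have n0 : n = 0%N.
    case: (n) (J) l0 => [//|n'] J' l0.
    by case: (part_of J' ord0) => j; rewrite l0.
  apply: wp_frame (_ : wp B _ (fun st' => reg st' rOut = 0) st) _; last first.
    by move=> st' hs e; apply: hQ; rewrite ?e //; apply: rep_empty.
  apply: wp_seq; apply: (wp_load (E := fun=> (0, 0)) (n := n)) => //.
  + exact: ltnW.
  + by rewrite n0 => -[].
  move=> st' sm _ _ _; apply: wp_reduce0; first by lia.
  by rewrite (sameR sm) // hN n0.
have [X hX hopt] := rep_label a b1 b2 l0 wf.
apply: wp_frame (_ : wp B _ (fun st' => reg st' rOut = lab12 X) st) _; last first.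
  by move=> st' hs e; apply: hQ; rewrite ?e.
apply: wp_seq; apply: (wp_load (E := chain_ends (fun i => part_of J i))) => //.
- exact: ltnW.
- move=> i st' rG rO aO; rewrite /= rG rO hO !aO.
  by have := encE i; rewrite !PoszD => ->; split=> //; rewrite /chain_ends /=; lia.
move=> st' sm e1 e2 hE; apply: (wp_reduce nB) hX => //.
- by rewrite (sameR sm).
- by rewrite e2 /= hO -[off]addn0 hin.
- by move=> i; rewrite (sameA _ sm).
- by move=> i; rewrite (sameA _ sm).
- by move=> i; rewrite (sameA _ sm).
Qed.

(** * Dynamic programming for selection *)

Section SelectionTable.
Variables (a b1 b2 : nat -> int) (top : int).

(** The least cost of a pair of sets with [u] and [v] elements among the first
    [i] items.  A value of at least [top] means that there is no such pair. *)
Fixpoint table (i u v : nat) : int :=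
  match i with
  | 0%N => if (u == 0%N) && (v == 0%N) then 0 else top
  | i'.+1 =>
      let t0 := table i' u v in
      let t1 := if (0 < u)%N then Num.min t0 (table i' u.-1 v + b1 i') else t0 in
      let t2 := if (0 < v)%N then Num.min t1 (table i' u v.-1 + b2 i') else t1 in
      if (0 < u)%N && (0 < v)%N then
        Num.min t2 (table i' u.-1 v.-1 + Num.min (a i') (b1 i' + b2 i'))
      else t2
  end.

Definition prefix_cost (i : nat) (z1 z2 : nat -> bool) : int :=
  \sum_(j < i) item_price (a j) (b1 j) (b2 j) (z1 j) (z2 j).

Definition prefix_card (i : nat) (z : nat -> bool) : nat := \sum_(j < i) z j.

Lemma table_le i z1 z2 :
  table i (prefix_card i z1) (prefix_card i z2) <= prefix_cost i z1 z2.
Proof.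
elim: i => [|i IH].
  by rewrite /prefix_card /prefix_cost !big_ord0.
rewrite /prefix_card /prefix_cost !big_ord_recr /=.
move: IH; rewrite -/(prefix_card i z1) -/(prefix_card i z2) -/(prefix_cost i z1 z2).
move: (prefix_card i z1) (prefix_card i z2) (prefix_cost i z1 z2) => u v c IH.
case: (z1 i); case: (z2 i); rewrite ?addn1 ?addn0 ?addr0 /=.
- by rewrite ge_min lerD2r IH orbT.
- by case: (v) IH => [|v'] IH /=; rewrite !ge_min lerD2r IH !orbT.
- by case: (u) IH => [|u'] IH /=; rewrite !ge_min lerD2r IH !orbT.
- by case: (u) (v) IH => [|u'] [|v'] IH /=; rewrite ?ge_min IH.
Qed.

Hypothesis b1_ge0 : forall i, 0 <= b1 i.
Hypothesis b2_ge0 : forall i, 0 <= b2 i.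
Hypothesis a_ge0 : forall i, 0 <= a i.

Lemma prefix_ext i z1 z2 x1 x2 : (forall j, (j < i)%N -> z1 j = x1 j) ->
  (forall j, (j < i)%N -> z2 j = x2 j) ->
  [/\ prefix_card i z1 = prefix_card i x1, prefix_card i z2 = prefix_card i x2
    & prefix_cost i z1 z2 = prefix_cost i x1 x2].
Proof.
by move=> h1 h2; split; apply: eq_bigr => j _; rewrite ?h1 ?h2.
Qed.

(** Since prices are nonnegative, an entry below [top] cannot have been obtained
    from an entry that marks an impossible pair. *)
Lemma table_attained i u v : table i u v < top ->
  exists z1 z2, [/\ prefix_card i z1 = u, prefix_card i z2 = v
    & prefix_cost i z1 z2 = table i u v].
Proof.
elim: i u v => [|i IH] u v.
  rewrite /=; case: andP => [[/eqP-> /eqP->] _|_]; last by rewrite ltxx.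
  by exists xpred0, xpred0; rewrite /prefix_card /prefix_cost !big_ord0.
pose P x := x < top -> exists z1 z2, [/\ prefix_card i.+1 z1 = u,
   prefix_card i.+1 z2 = v & prefix_cost i.+1 z1 z2 = x].
have step (e1 e2 : bool) u' v' c : (u' + e1 = u)%N -> (v' + e2 = v)%N ->
    item_price (a i) (b1 i) (b2 i) e1 e2 = c -> 0 <= c -> P (table i u' v' + c).
  move=> hu hv hc c0 hlt; have [|z1 [z2 [h1 h2 h3]]] := IH u' v'; first by lia.
  pose x1 j := if j == i then e1 else z1 j.
  pose x2 j := if j == i then e2 else z2 j.
  exists x1, x2; rewrite /prefix_card /prefix_cost !big_ord_recr /=.
  have [||k1 k2 k3] := @prefix_ext i x1 x2 z1 z2.
  - by move=> j; rewrite /x1; case: eqP => // ->; rewrite ltnn.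
  - by move=> j; rewrite /x2; case: eqP => // ->; rewrite ltnn.
  rewrite -/(prefix_card i x1) -/(prefix_card i x2) -/(prefix_cost i x1 x2).
  by rewrite k1 k2 k3 /x1 /x2 eqxx h1 h2 h3 hu hv hc.
have pmin x y : P x -> P y -> P (Num.min x y) by move=> hx hy; case: (leP x y).
have p0 : P (table i u v).
  by rewrite -[table _ _ _]addr0; apply: (step false false); rewrite ?addn0.
have p1 : P (if (0 < u)%N then Num.min (table i u v) (table i u.-1 v + b1 i)
             else table i u v).
  case: posnP => // u0; apply: pmin => //.
  by apply: (step true false); rewrite ?addn0 ?addn1 ?prednK.
have p2 x : P x -> P (if (0 < v)%N then Num.min x (table i u v.-1 + b2 i) else x).
  move=> hx; case: posnP => // v0; apply: pmin => //.
  by apply: (step false true); rewrite ?addn0 ?addn1 ?prednK.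
rewrite /=; case: andP => [[u0 v0]|_]; last exact: p2.
apply: pmin; first exact: p2.
apply: (step true true); rewrite ?addn1 ?prednK //.
by have := a_ge0 i; have := b1_ge0 i; have := b2_ge0 i; lia.
Qed.

End SelectionTable.

Notation lP := 60%N.
Notation lTop := 61%N.
Notation lW := 62%N.
Notation lI := 63%N.
Notation lU := 65%N.
Notation lV := 67%N.
Notation lT := 69%N.
Notation lC := 70%N.
Notation aT := 26%N.

(** The three indices of the table are packed into one by reading them as
    digits to the base [n.+1], which is kept in [lW]. *)
Definition cell (i u v : expr) : expr :=
  Add (Mul (Add (Mul i (Reg lW)) u) (Reg lW)) v.

Definition pred_of (e : expr) : expr := Sub e (Const 1).

Definition cmd_cell : cmd :=
  CSeq (CAsgn lT (Get aT (cell (Reg lI) (Reg lU) (Reg lV))))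
  (CSeq (CIf (Reg lU) (CMin lT (Add
      (Get aT (cell (Reg lI) (pred_of (Reg lU)) (Reg lV))) (Get aB1 (Reg lI)))) CSkip)
  (CSeq (CIf (Reg lV) (CMin lT (Add
      (Get aT (cell (Reg lI) (Reg lU) (pred_of (Reg lV)))) (Get aB2 (Reg lI)))) CSkip)
  (CSeq (CIf (Reg lU) (CIf (Reg lV) (CMin lT (Add
      (Get aT (cell (Reg lI) (pred_of (Reg lU)) (pred_of (Reg lV)))) (Reg lC)))
      CSkip) CSkip)
    (CPut aT (cell (Add (Reg lI) (Const 1)) (Reg lU) (Reg lV)) (Reg lT))))).

Definition cmd_cell0 : cmd :=
  CSeq (CAsgn lT (Reg lTop))
  (CSeq (CIf (Reg lU) CSkip (CIf (Reg lV) CSkip (CAsgn lT (Const 0))))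
    (CPut aT (cell (Const 0) (Reg lU) (Reg lV)) (Reg lT))).

Definition sel_solver : cmd :=
  CSeq (CAsgn lP (Get 0 (Reg rOff)))
  (CSeq (CAsgn lTop (Const 1))
  (CSeq (CFor lI 64 (Reg rN) (CAsgn lTop (Add (Reg lTop)
      (Add (Get aA (Reg lI)) (Add (Get aB1 (Reg lI)) (Get aB2 (Reg lI)))))))
  (CSeq (CAsgn lW (Add (Reg rN) (Const 1)))
  (CSeq (CFor lU 66 (Reg lW) (CFor lV 68 (Reg lW) cmd_cell0))
  (CSeq (CFor lI 64 (Reg rN)
    (CSeq (CAsgn lC (Get aA (Reg lI)))
    (CSeq (CMin lC (Add (Get aB1 (Reg lI)) (Get aB2 (Reg lI))))
      (CFor lU 66 (Reg lW) (CFor lV 68 (Reg lW) cmd_cell)))))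
    (CAsgn rOut (Get aT (cell (Reg rN) (Reg lP) (Reg lP))))))))).

Section SelectionSolver.
Variables (n B : nat).
Hypothesis nB : (n < B)%N.

Definition cell_index (i u v : nat) : nat := ((i * n.+1 + u) * n.+1 + v)%N.

Lemma pair_index_inj w x y u v : (u < w)%N -> (v < w)%N ->
  (x * w + u = y * w + v)%N -> x = y /\ u = v.
Proof.
move=> uw vw e; have w0 : (0 < w)%N by apply: leq_ltn_trans uw.
have xy : x = y.
  by move/(congr1 (fun z => z %/ w)%N): e; rewrite !divnMDl // !divn_small // !addn0.
by split=> //; move: e; rewrite xy => /addnI.
Qed.

Lemma cell_index_inj i u v i' u' v' :
  (u <= n)%N -> (v <= n)%N -> (u' <= n)%N -> (v' <= n)%N ->
  cell_index i u v = cell_index i' u' v' -> [/\ i = i', u = u' & v = v'].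
Proof.
move=> hu hv hu' hv' /(pair_index_inj (w := n.+1) hv hv')[e ->].
by have [-> ->] := pair_index_inj (w := n.+1) hu hu' e.
Qed.

Lemma okE_cell st i u v : reg st lW = n.+1%:Z ->
  okE B st i -> okE B st u -> okE B st v -> okE B st (cell i u v).
Proof.
move=> hW /= -> -> ->; rewrite hW.
have -> : (`|n.+1%:Z| <= 2 ^ B)%N.
  by apply: leq_trans nB _; apply: ltnW; exact: ltn_expl.
by rewrite !orbT.
Qed.

Lemma eval_cell st ei eu ev (i u v : nat) : reg st lW = n.+1%:Z ->
  eval st ei = i%:Z -> eval st eu = u%:Z -> eval st ev = v%:Z ->
  eval st (cell ei eu ev) = (cell_index i u v)%:Z.
Proof. by move=> hW /= -> -> ->; rewrite hW /cell_index !PoszD !PoszM !PoszD !PoszM. Qed.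

Variables (a b1 b2 : nat -> int) (top : int).
Local Notation tab := (table a b1 b2 top).

Definition filled (P : nat -> nat -> nat -> Prop) (st : state) : Prop :=
  forall i u v, (u <= n)%N -> (v <= n)%N -> P i u v ->
    arr st aT (cell_index i u v)%:Z = tab i u v.

Lemma filled_put (P P' : nat -> nat -> nat -> Prop) st i u v x :
  (u <= n)%N -> (v <= n)%N -> filled P st -> x = tab i u v ->
  (forall i' u' v', P' i' u' v' -> P i' u' v' \/ [/\ i' = i, u' = u & v' = v]) ->
  filled P' (set_arr st aT (cell_index i u v)%:Z x).
Proof.
move=> hu hv hP -> hP' i' u' v' hu' hv' /hP' h /=; rewrite eqz_nat.
case: eqP => [/cell_index_inj[//|//|//|//|-> -> ->//]|ne].
by case: h => [|[ei eu ev]]; [apply: hP|case: ne; rewrite ei eu ev].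
Qed.

Lemma wp_cell0 P P' st u v : (u <= n)%N -> (v <= n)%N ->
  reg st lW = n.+1%:Z -> reg st lTop = top ->
  reg st lU = u%:Z -> reg st lV = v%:Z -> filled P st ->
  (forall i' u' v', P' i' u' v' -> P i' u' v' \/ [/\ i' = 0%N, u' = u & v' = v]) ->
  wp B cmd_cell0 (filled P') st.
Proof.
move=> un vn hW hT hU hV hP hP'.
apply: wp_seq; apply: wp_asgn => //=; rewrite hT; apply: wp_seq.
have fin st' : reg st' lT = tab 0 u v -> reg st' lU = u%:Z -> reg st' lV = v%:Z ->
    reg st' lW = n.+1%:Z -> filled P st' ->
    wp B (CPut aT (cell (Const 0) (Reg lU) (Reg lV)) (Reg lT)) (filled P') st'.
  move=> hT' hU' hV' hW' hF; apply: wp_put => //; first exact: okE_cell.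
  rewrite (@eval_cell _ _ _ _ 0%N u v) //.
  by apply: filled_put hP'.
apply: wp_if => //=; rewrite hU => hu.
  apply: wp_skip; apply: fin => //=.
  by case: (u) hu.
have u0 : u = 0%N by lia.
apply: wp_if => //=; rewrite hV => hv.
  apply: wp_skip; apply: fin => //=.
  by case: (v) hv => // v'; rewrite andbF.
have v0 : v = 0%N by lia.
by apply: wp_asgn => //; apply: fin => //=; rewrite u0 v0.
Qed.

Lemma wp_cell P P' st i u v : (u <= n)%N -> (v <= n)%N ->
  reg st lW = n.+1%:Z -> reg st lI = i%:Z ->
  reg st lU = u%:Z -> reg st lV = v%:Z -> filled P st ->
  (forall u' v', P i u' v') ->
  arr st aB1 i%:Z = b1 i -> arr st aB2 i%:Z = b2 i ->
  reg st lC = Num.min (a i) (b1 i + b2 i) ->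
  (forall i' u' v', P' i' u' v' -> P i' u' v' \/ [/\ i' = i.+1, u' = u & v' = v]) ->
  wp B cmd_cell (filled P') st.
Proof.
move=> un vn hW hI hU hV hP hi hb1 hb2 hC hP'.
apply: wp_seq; apply: wp_asgn; first exact: (@okE_cell _ (Reg lI) (Reg lU) (Reg lV)).
have -> : eval st (Get aT (cell (Reg lI) (Reg lU) (Reg lV))) = tab i u v.
  by rewrite /eval -/eval (@eval_cell _ _ _ _ i u v) // hP.
pose ok st' x := [/\ reg st' lT = x, arr st' = arr st
   & forall r, r != lT -> reg st' r = reg st r].
have ok0 : ok (set_reg st lT (tab i u v)) (tab i u v).
  by split=> //= r /negbTE->.
have key st' x eu ev (u' v' : nat) : ok st' x -> (u' <= n)%N -> (v' <= n)%N ->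
    okE B st' eu -> okE B st' ev -> eval st' eu = u'%:Z -> eval st' ev = v'%:Z ->
    okE B st' (Get aT (cell (Reg lI) eu ev)) /\
    eval st' (Get aT (cell (Reg lI) eu ev)) = tab i u' v'.
  move=> [h1 h2 h3] hu' hv' o1 o2 e1 e2.
  have hW' : reg st' lW = n.+1%:Z by rewrite h3.
  split; first by apply: (@okE_cell _ (Reg lI) eu ev).
  by rewrite /eval -/eval (@eval_cell _ _ _ _ i u' v') ?h2 ?hP //= h3.
have rU st' x : ok st' x -> eval st' (Reg lU) = u%:Z by move=> [_ _ h3] /=; rewrite h3.
have rV st' x : ok st' x -> eval st' (Reg lV) = v%:Z by move=> [_ _ h3] /=; rewrite h3.
have rB1 st' x : ok st' x -> eval st' (Get aB1 (Reg lI)) = b1 i.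
  by move=> [_ h2 h3] /=; rewrite h3 // h2 hI hb1.
have rB2 st' x : ok st' x -> eval st' (Get aB2 (Reg lI)) = b2 i.
  by move=> [_ h2 h3] /=; rewrite h3 // h2 hI hb2.
have rC st' x : ok st' x -> eval st' (Reg lC) = Num.min (a i) (b1 i + b2 i).
  by move=> [_ h2 h3] /=; rewrite h3.
have pU st' x : ok st' x -> (0 < u)%N -> eval st' (pred_of (Reg lU)) = u.-1%:Z.
  by move=> h u0; have /= -> := rU _ _ h; lia.
have pV st' x : ok st' x -> (0 < v)%N -> eval st' (pred_of (Reg lV)) = v.-1%:Z.
  by move=> h v0; have /= -> := rV _ _ h; lia.
have un' : (u.-1 <= n)%N by apply: leq_trans (leq_pred _) un.
have vn' : (v.-1 <= n)%N by apply: leq_trans (leq_pred _) vn.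
have stage bb g e x y st' : ok st' x -> okE B st' g -> (0 < eval st' g) = bb ->
    (bb -> okE B st' e /\ eval st' e = y) ->
    wp B (CIf g (CMin lT e) CSkip)
      (fun s => ok s (if bb then Num.min x y else x)) st'.
  move=> [h1 h2 h3] og <- he; apply: wp_if => // h.
    have [oe ee] := he h; apply: wp_min => // st'' r'' a''.
    rewrite h; split; first by rewrite r'' eqxx h1 ee.
      by rewrite a''.
    by move=> r rT; rewrite r'' (negbTE rT) h3.
  by rewrite ltNge h; apply: wp_skip.
move: ok0; move: (set_reg st lT _) => st1 ok1.
apply: wp_seq; apply: wp_mono (stage (0 < u)%N _ _ _ (tab i u.-1 v + b1 i) _ ok1
  _ _ _) => // [st2 ok2||u0].
- apply: wp_seq; apply: wp_mono (stage (0 < v)%N _ _ _ (tab i u v.-1 + b2 i) _ ok2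
    _ _ _) => // [st3 ok3||v0].
  + apply: wp_seq; apply: (wp_mono (Q := fun s => ok s (tab i.+1 u v))).
      move=> s [h1 h2 h3]; apply: wp_put => //.
        by apply: okE_cell; rewrite // h3.
      have eI : eval s (Add (Reg lI) (Const 1)) = i.+1%:Z.
        by rewrite /= h3 // hI -addn1 PoszD.
      have eU : eval s (Reg lU) = u%:Z by rewrite /= h3.
      have eV : eval s (Reg lV) = v%:Z by rewrite /= h3.
      have eW : reg s lW = n.+1%:Z by rewrite h3.
      rewrite (eval_cell eW eI eU eV) /= h1.
      by apply: filled_put hP' => // i' u' v'; rewrite h2; exact: hP.
    have [h1 h2 h3] := ok3.
    apply: wp_if => //= hu; last first.
      have u0 : u = 0%N by move: hu; rewrite h3 // hU; lia.
      by apply: wp_skip; move: ok3; rewrite u0.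
    have u0 : (0 < u)%N by move: hu; rewrite h3 // hU; lia.
    apply: wp_mono (stage (0 < v)%N _ _ _ (tab i u.-1 v.-1 +
       Num.min (a i) (b1 i + b2 i)) _ ok3 _ _ _) => // [s||v0].
    * by rewrite /= u0.
    * by rewrite (rV _ _ ok3).
    * have [o e] := key _ _ (pred_of (Reg lU)) (pred_of (Reg lV)) _ _ ok3 un' vn'
        isT isT (pU _ _ ok3 u0) (pV _ _ ok3 v0).
      split; first by move: o => /= ->.
      by move: e => /= ->; have /= -> := rC _ _ ok3.
  + by rewrite (rV _ _ ok2).
  + have [o e] := key _ _ (Reg lU) (pred_of (Reg lV)) _ _ ok2 un vn'
        isT isT (rU _ _ ok2) (pV _ _ ok2 v0).
    split; first by move: o => /= ->.
    by move: e => /= ->; have /= -> := rB2 _ _ ok2.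
- by rewrite (rU _ _ ok1).
- have [o e] := key _ _ (pred_of (Reg lU)) (Reg lV) _ _ ok1 un' vn
        isT isT (pU _ _ ok1 u0) (rV _ _ ok1).
  split; first by move: o => /= ->.
  by move: e => /= ->; have /= -> := rB1 _ _ ok1.
Qed.

End SelectionSolver.

(** Loop counters range over numbers rather than items, and the default value,
    taken at [n], will serve as an additional candidate for a price. *)
Definition ext (T : Type) (x0 : T) n (f : 'I_n -> T) (i : nat) : T :=
  if insub i is Some j then f j else x0.

Lemma extE (T : Type) (x0 : T) n (f : 'I_n -> T) (i : 'I_n) : ext x0 f i = f i.
Proof. by rewrite /ext valK. Qed.

Lemma pair_cost_prefix n (a b1 b2 : 'I_n -> int) (z1 z2 : bvec n) :
  pair_cost a b1 b2 z1 z2 =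
  prefix_cost (ext 0 a) (ext 0 b1) (ext 0 b2) n (ext false z1) (ext false z2).
Proof. by apply: eq_bigr => i _; rewrite !extE. Qed.

Lemma card_prefix n (z : bvec n) :
  (\sum_i z i)%N = prefix_card n (ext false z).
Proof. by apply: eq_bigr => i _; rewrite extE. Qed.

Lemma item_price_le (a b1 b2 : int) u v : 0 <= a -> 0 <= b1 -> 0 <= b2 ->
  item_price a b1 b2 u v <= a + (b1 + b2).
Proof. by case: u; case: v => /=; lia. Qed.

(** All pairs cost less than [top], so the entry for [p] and [p], which is at
    most the cost of a feasible pair, is attained. *)
Lemma table_is_opt n (a b1 b2 : 'I_n -> int) (p : nat) (top : int) :
  (forall i, 0 <= a i) -> (forall i, 0 <= b1 i) -> (forall i, 0 <= b2 i) ->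
  (exists z : bvec n, nom_feas (n := n) (p : nom_inst selection n) z) ->
  top = 1 + \sum_(i < n) (a i + (b1 i + b2 i)) ->
  is_opt a b1 b2 (nom_feas (n := n) (p : nom_inst selection n))
    (table (ext 0 a) (ext 0 b1) (ext 0 b2) top n p p).
Proof.
move=> a0 b10 b20 [z hz] topE.
have ext0 (f : 'I_n -> int) : (forall i, 0 <= f i) -> forall i, 0 <= ext 0 f i.
  by move=> h i; rewrite /ext; case: insubP.
have le z1 z2 : nom_feas (n := n) (p : nom_inst selection n) z1 ->
    nom_feas (n := n) (p : nom_inst selection n) z2 ->
    table (ext 0 a) (ext 0 b1) (ext 0 b2) top n p p <= pair_cost a b1 b2 z1 z2.
  move=> h1 h2; rewrite pair_cost_prefix.
  have := table_le (ext 0 a) (ext 0 b1) (ext 0 b2) top n (ext false z1) (ext false z2).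
  by rewrite -!card_prefix h1 h2.
split=> //.
have lt : table (ext 0 a) (ext 0 b1) (ext 0 b2) top n p p < top.
  apply: le_lt_trans (le z z hz hz) _; rewrite topE.
  have : pair_cost a b1 b2 z z <= \sum_(i < n) (a i + (b1 i + b2 i)).
    by apply: ler_sum => i _; apply: item_price_le.
  by lia.
have [z1 [z2 [h1 h2 h3]]] := table_attained (ext0 _ b10) (ext0 _ b20) (ext0 _ a0) lt.
have ez (y : nat -> bool) i : (i < n)%N -> ext false [ffun i : 'I_n => y i] i = y i.
  by move=> hi; rewrite -[i]/(Ordinal hi : nat) extE ffunE.
have [e1 e2 e3] := prefix_ext (ext 0 a) (ext 0 b1) (ext 0 b2) (ez z1) (ez z2).
exists [ffun i : 'I_n => z1 i], [ffun i : 'I_n => z2 i]; split.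
- by rewrite /= card_prefix e1.
- by rewrite /= card_prefix e2.
- by rewrite pair_cost_prefix e3.
Qed.

Lemma sel_solver_ok : solves selection sel_solver.
Proof.
move=> B n p off st a b1 b2 Q _ hz nB a0 b10 b20 hN hO hin ha hb1 hb2 hQ.
pose a' := ext 0 a; pose b1' := ext 0 b1; pose b2' := ext 0 b2.
pose top := 1 + \sum_(i < n) (a i + (b1 i + b2 i)).
have pn : (p <= n)%N.
  have [z <-] := hz; rewrite -[X in (_ <= X)%N]card_ord -sum1_card.
  by apply: leq_sum => i _; case: (z i).
apply: wp_frame (_ : wp B _ (fun st' => reg st' rOut = table a' b1' b2' top n p p) st) _;
  last by move=> st' hs e; apply: hQ; rewrite ?e //; apply: table_is_opt.
apply: wp_seq; apply: wp_asgn => //=.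
rewrite hO -[off]addn0 hin /=.
apply: wp_seq; apply: wp_asgn => //=; set st1 := set_reg _ lTop 1.
apply: wp_seq.
pose I1 k st' := reg st' lTop = 1 + \sum_(i < k) (a' i + (b1' i + b2' i)).
apply: (wp_for (k := n) (Inv := I1)) => //; first exact: ltnW.
- by rewrite /I1 /= big_ord0 addr0.
- move=> k st2 kn rk sm hI; apply: wp_asgn => //=.
  have [va vb1 vb2] : [/\ arr st2 aA k%:Z = a' k, arr st2 aB1 k%:Z = b1' k
      & arr st2 aB2 k%:Z = b2' k].
    by rewrite !(sameA _ sm) //= -[k]/(Ordinal kn : nat) ha hb1 hb2 /a' /b1' /b2' !extE.
  by rewrite /I1 /= big_ord_recr /= rk va vb1 vb2 hI -[LHS]addrA.
move=> st2 sm2; rewrite /I1 => hT2.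
have {hT2} hT2 : reg st2 lTop = top.
  by rewrite hT2; congr (_ + _); apply: eq_bigr => i _; rewrite /a' /b1' /b2' !extE.
have hN2 : reg st2 rN = n%:Z by rewrite (sameR sm2).
have hP2 : reg st2 lP = p%:Z by rewrite (sameR sm2).
have hA2 x : x \in [:: aA; aB1; aB2] -> forall i, arr st2 x i = arr st x i.
  by rewrite !inE => /or3P[]/eqP-> i; rewrite (sameA _ sm2).
apply: wp_seq; apply: wp_asgn => //=.
set st3 := set_reg _ lW _.
have hW3 : reg st3 lW = n.+1%:Z by rewrite /= hN2; lia.
apply: wp_seq.
pose full i := filled n a' b1' b2' top (fun i' _ _ => i' = i).
apply: (wp_for (k := n.+1) (Inv := fun u => filled n a' b1' b2' top
   (fun i' u' _ => i' = 0%N /\ (u' < u)%N))) => //.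
- by move=> i u v _ _ [].
- move=> u st4 un ru sm4 hF4.
  have hW4 : reg st4 lW = n.+1%:Z by rewrite (sameR sm4).
  apply: (wp_for (k := n.+1) (Inv := fun v => filled n a' b1' b2' top
     (fun i' u' v' => i' = 0%N /\ ((u' < u)%N \/ u' = u /\ (v' < v)%N)))) => //.
  + by move=> i u' v' h1 h2 [h3 [h|[]//]]; apply: hF4.
  + move=> v st5 vn rv sm5 hF5.
    apply: wp_mono (wp_cell0 nB (u := u) (v := v) un vn _ _ _ rv hF5 _).
    * by move=> st6; exact.
    * by rewrite (sameR sm5).
    * by rewrite (sameR sm5) // (sameR sm4).
    * by rewrite (sameR sm5).
    * move=> i' u' v' [-> [h|[-> ]]]; first by left; tauto.
      by rewrite ltnS leq_eqVlt => /orP[/eqP->|h]; [right|left; tauto].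
  + move=> st5 sm5 hF5 i u' v' h1 h2 [hi]; rewrite ltnS leq_eqVlt => h.
    apply: hF5 => //; split=> //; move: h => /orP[/eqP->|]; [right|left] => //.
move=> st4 sm4 hF4.
have {hF4} hF4 : full 0%N st4.
  by move=> i u v un vn hi; apply: hF4; rewrite ?ltnS.
have hW4 : reg st4 lW = n.+1%:Z by rewrite (sameR sm4).
have hN4 : reg st4 rN = n%:Z by rewrite (sameR sm4).
apply: wp_seq; apply: (wp_for (k := n) (Inv := full)) => //; first exact: ltnW.
- move=> i st5 iN ri sm5 hF5.
  have hA5 x : x \in [:: aA; aB1; aB2] -> forall j, arr st5 x j = arr st x j.
    move=> hx j; rewrite -(hA2 x hx); move: hx; rewrite !inE.
    by move=> /or3P[]/eqP->; rewrite (sameA _ sm5) // (sameA _ sm4).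
  pose o := Ordinal iN.
  have [va vb1 vb2] : [/\ arr st5 aA i%:Z = a' i, arr st5 aB1 i%:Z = b1' i
      & arr st5 aB2 i%:Z = b2' i].
    by rewrite !hA5 // -[i]/(o : nat) ha hb1 hb2 /a' /b1' /b2' !extE.
  apply: wp_seq; apply: wp_asgn => //.
  apply: wp_seq; apply: wp_min => //= st6 r6 a6.
  have hC6 : reg st6 lC = Num.min (a' i) (b1' i + b2' i).
    by rewrite r6 /= ri va vb1 vb2.
  have hW6 : reg st6 lW = n.+1%:Z by rewrite r6 /= (sameR sm5).
  have hi6 : reg st6 lI = i%:Z by rewrite r6 /=.
  pose I2 u := filled n a' b1' b2' top (fun i' u' v' => i' = i \/
    i' = i.+1 /\ (u' < u)%N).
  apply: (wp_for (k := n.+1) (Inv := I2)) => //.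
  + move=> i' u v hu hv [h|[]//]; rewrite /= a6 /=; exact: hF5.
  + move=> u st7 un ru sm7 hF7.
    have hW7 : reg st7 lW = n.+1%:Z by rewrite (sameR sm7).
    apply: (wp_for (k := n.+1) (Inv := fun v => filled n a' b1' b2' top
     (fun i' u' v' => i' = i \/
        i' = i.+1 /\ ((u' < u)%N \/ u' = u /\ (v' < v)%N)))) => //.
    * by move=> i' u' v' h1 h2 [h|[h3 [h|[]//]]]; apply: hF7 => //; tauto.
    * move=> v st8 vn rv sm8 hF8.
      apply: wp_mono (wp_cell nB (i := i) (u := u) (v := v) un vn _ _ _ rv hF8 _ _ _ _ _).
      -- by move=> st9; exact.
      -- by rewrite (sameR sm8).
      -- by rewrite (sameR sm8) // (sameR sm7).
      -- by rewrite (sameR sm8).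
      -- by move=> u' v'; left.
      -- by rewrite (sameA _ sm8) // (sameA _ sm7) // a6.
      -- by rewrite (sameA _ sm8) // (sameA _ sm7) // a6.
      -- by rewrite (sameR sm8) // (sameR sm7).
      -- move=> i' u' v' [->|[-> [h|[-> ]]]]; [by left; tauto|by left; tauto|].
         by rewrite ltnS leq_eqVlt => /orP[/eqP->|h]; [right|left; tauto].
    * move=> st8 sm8 hF8 i' u' v' h1 h2 [hi|[hi]].
        by apply: hF8 => //; left.
      rewrite ltnS leq_eqVlt => h.
      by apply: hF8 => //; right; split=> //; move: h => /orP[/eqP->|];
        [right|left].
  + move=> st7 sm7 hF7 i' u' v' h1 h2 hi.
    by apply: hF7 => //; right.
move=> st5 sm5 hF5.
have hW5 : reg st5 lW = n.+1%:Z by rewrite (sameR sm5).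
have hN5 : reg st5 rN = n%:Z by rewrite (sameR sm5).
have hP5 : reg st5 lP = p%:Z by rewrite (sameR sm5) // (sameR sm4).
apply: wp_asgn; first exact: (okE_cell nB (i := Reg rN) (u := Reg lP) (v := Reg lP)).
transitivity (arr st5 aT (eval st5 (cell (Reg rN) (Reg lP) (Reg lP)))); first by [].
by rewrite (@eval_cell n st5 (Reg rN) (Reg lP) (Reg lP) n p p) ?hF5.
Qed.

From mathcomp Require Import all_classical all_reals ereal.
Require Import Defs.

Import Order.TTheory GRing.Theory Num.Theory.

(** * Minimax on an interval *)

Definition pos (R : realDomainType) (t : R) : R := Num.max 0 t.

Lemma posP (R : realDomainType) (t : R) :
  (0 <= t /\ pos t = t) \/ (t <= 0 /\ pos t = 0).
Proof.
by rewrite /pos; case: (leP 0 t) => h; [left|right]; split=> //; exact: ltW.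
Qed.

Section Minimax.
Variable R : realType.

(** Helly's theorem on a line.  Each affine function is at least [M] on a
    half-line; these have a common point in the interval from 0 to [G] if each
    of them meets the interval and any two of them in opposite directions
    meet. *)
Lemma line_minimax (K : finType) (P : pred K) (al s : K -> R) (G M : R) :
  0 <= G ->
  (forall k, P k -> s k <= 0 -> M <= al k) ->
  (forall k, P k -> 0 <= s k -> M <= al k + s k * G) ->
  (forall i j, P i -> P j -> s i < 0 -> 0 < s j ->
     M * (s j - s i) <= s j * al i - s i * al j) ->
  exists2 g, 0 <= g <= G & forall k, P k -> M <= al k + s k * g.
Proof.
move=> hG h1 h2 h3.
pose t k := (M - al k) / s k.
pose g := \big[Order.max/0]_(k | P k && (0 < s k)) t k.
have g0 : 0 <= g by exact: bigmax_ge_id.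
exists g.
  rewrite g0; apply: bigmax_le => // k /andP[Pk sk].
  by rewrite ler_pdivrMr //; have := h2 k Pk (ltW sk); lra.
move=> k Pk; case: (ltrP 0 (s k)) => sk.
  have : t k <= g by apply: le_bigmax_cond; rewrite Pk sk.
  by rewrite ler_pdivrMr //; lra.
rewrite /g; apply: (big_ind (fun g => M <= al k + s k * g)) => /=.
- by rewrite mulr0 addr0; apply: h1.
- by move=> x y hx hy; case: (leP x y).
move=> j /andP[Pj sj]; case: (ltrP (s k) 0) => sk0; last first.
  have -> : s k = 0 by apply/eqP; rewrite eq_le sk sk0.
  by rewrite mul0r addr0; apply: h1.
have h := h3 _ _ Pk Pj sk0 sj.
rewrite /t mulrA -(ler_pM2r sj) mulrDl divfK ?gt_eqF //; lra.
Qed.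

(** * The fractional knapsack of the adversary *)

Section Knapsack.
Variables (n : nat) (lo hi : 'rV[R]_n) (z : bvec n).

(** The cost of [z] when each item is capped by the price [p] of the
    budget: the Lagrangian dual function of the adversary's problem, without
    the term for the budget. *)
Definition capped (p : R) : R :=
  \sum_i (lo 0 i + pos (hi 0 i - lo 0 i - p)) * (z i)%:R.

(** Weak duality: paying [p] for each unit of the budget, an item yields at most
    its excess over [p]. *)
Lemma capped_ub (p g : R) (de : 'I_n -> R) : 0 <= p ->
  (forall i, 0 <= de i <= 1) -> \sum_i de i <= g ->
  \sum_i (lo 0 i + (hi 0 i - lo 0 i) * de i) * (z i)%:R <= g * p + capped p.
Proof.
move=> p0 hde hg.
apply: (@le_trans _ _ ((\sum_i de i) * p + capped p)); last first.
  by rewrite lerD2r ler_wpM2r.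
rewrite mulr_suml /capped -big_split /=; apply: ler_sum => i _.
have /andP[d0 d1] := hde i; case: (z i); rewrite ?mulr1 ?mulr0 ?addr0; last first.
  exact: mulr_ge0.
case: (posP (hi 0 i - lo 0 i - p)) => -[hp ->]; nra.
Qed.

Hypothesis lohi : forall i, lo 0 i <= hi 0 i.

(** Strong duality, by the greedy solution: [p] is the least price such that the
    items of larger width do not overrun the budget.  Items wider than
    [p] are raised fully, those of width [p] are raised by the same fraction
    [th].  That the optimal price is 0 or the width of an item is what makes
    the search for it finite. *)
Lemma capped_tight (g : R) : 0 <= g ->
  exists (p : R) (de : 'I_n -> R),
    [/\ p = 0 \/ (exists i, p = hi 0 i - lo 0 i), forall i, 0 <= de i <= 1,
        \sum_i de i <= g
      & \sum_i (lo 0 i + (hi 0 i - lo 0 i) * de i) * (z i)%:R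
          = g * p + capped p].
Proof.
move=> g0; pose u i := hi 0 i - lo 0 i.
have u0 i : 0 <= u i by rewrite subr_ge0.
pose val o := if o is Some i then u i else 0 : R.
pose gt p := \sum_i ((z i) && (p < u i))%:R : R.
pose eq p := \sum_i ((z i) && (u i == p))%:R : R.
have eq0 p : 0 <= eq p by apply: sumr_ge0.
have [om _ hom] : exists2 o, true & forall o', val o' <= val o.
  have [o _ ho] := arg_maxP (T := R) val (erefl : predT (None : option 'I_n)).
  by exists o => // o'; apply: ho.
have gtm : gt (val om) <= g.
  rewrite /gt big1 // => i _; have := hom (Some i) => /= h.
  by rewrite ltNge h andbF.
have [o go ho] := arg_minP (P := fun o => gt (val o) <= g) val gtm.
set p := val o in go ho.
have p0 : 0 <= p by rewrite /p; case: (o) => //= i; exact: u0.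
have [th [th0 th1 hth]] : exists th, [/\ 0 <= th, th <= 1 &
    (gt p + th * eq p <= g) /\ p * (gt p + th * eq p) = p * g].
  have [pe|pn0] := eqVneq p 0.
    exists 0; split; rewrite ?ler01 //; split; first by rewrite mul0r addr0.
    by rewrite pe !mul0r.
  have pp : 0 < p by rewrite lt0r pn0.
  have hge : g < gt p + eq p.
    rewrite ltNge; apply/negP => hle.
    have [q hq mq] := arg_maxP (T := R) (P := fun o => val o < p) val
                        (pp : val (None : option 'I_n) < p).
    have : gt (val q) <= g.
      apply: le_trans hle; rewrite /gt /eq -big_split /=.
      apply: ler_sum => i _; case: (z i) => /=; last by rewrite addr0.
      case: (ltgtP p (u i)) => h //=; rewrite ?addr0 ?add0r ?lern1 ?leq_b1 //.
      by have := mq (Some i) h => /=; rewrite leNgt => /negbTE ->.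
    by move=> /ho; rewrite leNgt hq.
  have eqp : 0 < eq p by lra.
  exists ((g - gt p) / eq p); split.
  - by rewrite divr_ge0 // subr_ge0.
  - by rewrite ler_pdivrMr //; lra.
  - by rewrite divfK ?gt_eqF // addrC subrK.
pose de i : R := (z i && (p < u i))%:R + th * (z i && (u i == p))%:R.
have sde : \sum_i de i = gt p + th * eq p.
  by rewrite /de big_split /= mulr_sumr.
exists p, de; split.
- by rewrite /p; case: (o) => [i|] /=; [right; exists i|left].
- move=> i; rewrite /de; case: (z i); rewrite /= ?mulr0 ?addr0 ?lexx ?ler01 //.
  by case: ltgtP; rewrite /= ?mulr0 ?addr0 ?mulr1 ?add0r ?lexx ?ler01 ?th0 ?th1.
- by rewrite sde; case: hth.
- rewrite [g * p]mulrC -(proj2 hth) -sde mulr_sumr /capped -big_split /=.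
  apply: eq_bigr => i _; rewrite /de -/(u i); have := u0 i.
  case: (z i); rewrite /= ?mulr0 ?addr0 ?mulr0 ?mulr1 //.
  case: (posP (u i - p)) => -[hp ->]; case: ltgtP => h /=; nra.
Qed.

End Knapsack.

(** * Two-stage duality *)

Section Duality.
Variables (n : nat) (D : budget_data R n) (X : set (bvec n)).
Hypothesis wf : budget_wf D.

Notation Ga := (Gam D).
Definition cap1 (x : bvec n) (p : R) : R := capped (c_lo D) (c_hi D) x p.
Definition cap2 (y : bvec n) (p : R) : R := capped (d_lo D) (d_hi D) y p.

(** [q] and [p] are the prices of the budget in the two stages; the bound
    that they give on the cost is affine in the budget spent in the first
    stage, with slope [q - p] and this value at 0. *)
Definition dual_val (q p : R) (x y : bvec n) : R :=
  Ga * p + cap1 x q + cap2 y p.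

(** The least upper bound that two such affine functions, the first falling and
    the second rising, give on the worst case over the amount spent in the first
    stage.  Any other pair only contributes its first member. *)
Definition pair_val (q1 p1 q2 p2 : R) (x y1 y2 : bvec n) : R :=
  if (q1 < p1) && (p2 < q2) then
    ((q2 - p2) * dual_val q1 p1 x y1 + (p1 - q1) * dual_val q2 p2 x y2)
      / ((q2 - p2) + (p1 - q1))
  else Ga * Num.max q1 p1 + cap1 x q1 + cap2 y1 p1.

(** Whatever amount [g] of the budget the adversary spends in the first stage,
    the better of the answers [y1] and [y2] costs at most the minimum of two
    affine functions of [g], of which [pair_val] bounds the maximum. *)
Lemma rob_value_le (q1 p1 q2 p2 : R) (x y1 y2 : bvec n) :
  0 <= q1 -> 0 <= p1 -> 0 <= q2 -> 0 <= p2 -> X2 X x y1 -> X2 X x y2 ->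
  (rob_value D X x <= (pair_val q1 p1 q2 p2 x y1 y2)%:E)%E.
Proof.
move=> q10 p10 q20 p20 Xy1 Xy2; have [hc hd hG] := wf.
apply: ge_ereal_sup => _ [c Uc <-].
pose de i := (c 0 i - c_lo D 0 i) / (c_hi D 0 i - c_lo D 0 i).
pose g := \sum_i de i.
have [_ [d0 [d01 cE sd]]] := Uc.
have deE i : de i = if c_hi D 0 i - c_lo D 0 i == 0 then 0 else d0 0 i.
  rewrite /de cE addrAC subrr add0r; case: eqP => [->|/eqP h].
    by rewrite mul0r mul0r.
  by rewrite mulrAC divff // mul1r.
have de01 i : 0 <= de i <= 1.
  by rewrite deE; case: ifP => // _; rewrite lexx ler01.
have gle : g <= Ga.
  apply: le_trans sd; apply: ler_sum => i _; rewrite deE.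
  by case: ifP => // _; case/andP: (d01 i).
have g0 : 0 <= g by apply: sumr_ge0 => i _; case/andP: (de01 i).
have cE' i : c 0 i = c_lo D 0 i + (c_hi D 0 i - c_lo D 0 i) * de i.
  by rewrite deE cE; case: eqP => // ->; rewrite !mul0r.
have bnd q p y : 0 <= q -> 0 <= p -> X2 X x y ->
    (ereal_inf [set ereal_sup [set (cost c x + cost d y)%:E | d in U2 D c]
       | y in X2 X x]%classic <= (dual_val q p x y + (q - p) * g)%:E)%E.
  move=> hq hp Xy; apply: le_trans (_ : _ <= ereal_sup
      [set (cost c x + cost d y)%:E | d in U2 D c]%classic)%E _.
    by apply: ereal_inf_lbound; exists y.
  apply: ge_ereal_sup => _ [d [_ [d1 [d101 dE sd1]]] <-].
  rewrite lee_fin.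
  have h1 : cost c x <= g * q + cap1 x q.
    have := @capped_ub n (c_lo D) (c_hi D) x q g de hq de01 (lexx _).
    by under eq_bigr do rewrite -cE'.
  have h2 : cost d y <= (Ga - g) * p + cap2 y p.
    have := @capped_ub n (d_lo D) (d_hi D) y p (Ga - g) (d1 0) hp d101 sd1.
    by under eq_bigr do rewrite -dE.
  by rewrite /dual_val; lra.
rewrite /pair_val; case: ifP => h.
  have /andP[a1 a2] := h.
  have b1 := bnd q1 p1 y1 q10 p10 Xy1; have b2 := bnd q2 p2 y2 q20 p20 Xy2.
  set I := ereal_inf _ in b1 b2 *.
  have : (I <= (Num.min (dual_val q1 p1 x y1 + (q1 - p1) * g)
                 (dual_val q2 p2 x y2 + (q2 - p2) * g))%:E)%E.
    by rewrite /Num.min; case: ifP.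
  move=> hI; apply: le_trans hI _; rewrite lee_fin.
  rewrite ler_pdivlMr; last by lra.
  move: (dual_val _ _ _ _) (dual_val _ _ _ _) => A B.
  by rewrite /Num.min; case: ifP => [/ltW hh|/negbT]; rewrite -?leNgt; nra.
apply: le_trans (bnd q1 p1 y1 q10 p10 Xy1) _; rewrite lee_fin /dual_val.
by rewrite /Num.max; case: ifP => [/ltW hh|/negbT]; rewrite -?leNgt; nra.
Qed.

Definition width (lo hi : 'rV[R]_n) (p : R) : Prop :=
  p = 0 \/ exists i, p = hi 0 i - lo 0 i.

(** The worst case for given [g] and [y] is the minimum of the affine functions
    over the finitely many optimal prices.  If all pairs of functions leave room
    for [M], then by [line_minimax] so does some [g] for all functions at once;
    an adversary who spends [g] optimally enforces the cost [M]. *)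
Lemma rob_value_ge (x : bvec n) (M : R) :
  (forall q1 p1 q2 p2 y1 y2,
     width (c_lo D) (c_hi D) q1 -> width (d_lo D) (d_hi D) p1 ->
     width (c_lo D) (c_hi D) q2 -> width (d_lo D) (d_hi D) p2 ->
     X2 X x y1 -> X2 X x y2 -> M <= pair_val q1 p1 q2 p2 x y1 y2) ->
  (M%:E <= rob_value D X x)%E.
Proof.
move=> hM; have [hc hd hG] := wf.
have hc' i : c_lo D 0 i <= c_hi D 0 i by case/andP: (hc i).
have hd' i : d_lo D 0 i <= d_hi D 0 i by case/andP: (hd i).
pose uc (o : option 'I_n) := if o is Some i then c_hi D 0 i - c_lo D 0 i else 0.
pose ud (o : option 'I_n) := if o is Some i then d_hi D 0 i - d_lo D 0 i else 0.
have wc o : width (c_lo D) (c_hi D) (uc o).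
  by case: o => [i|]; [right; exists i|left].
have wd o : width (d_lo D) (d_hi D) (ud o).
  by case: o => [i|]; [right; exists i|left].
pose K : finType := (option 'I_n * option 'I_n * bvec n)%type.
pose P (k : K) : bool := `[< X2 X x k.2 >].
pose al (k : K) := dual_val (uc k.1.1) (ud k.1.2) x k.2.
pose s (k : K) := uc k.1.1 - ud k.1.2.
have [g /andP[g0 gG] hg] : exists2 g, 0 <= g <= Ga
    & forall k, P k -> M <= al k + s k * g.
  apply: line_minimax => //.
  - move=> k /asboolP Pk sk; have := hM _ _ 0 0 _ _ (wc k.1.1) (wd k.1.2)
      (or_introl erefl) (or_introl erefl) Pk Pk.
    rewrite /pair_val ltxx andbF max_r //; move: sk; rewrite /s; lra.
  - move=> k /asboolP Pk sk; have := hM _ _ 0 0 _ _ (wc k.1.1) (wd k.1.2)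
      (or_introl erefl) (or_introl erefl) Pk Pk.
    rewrite /pair_val ltxx andbF max_l /al /dual_val; move: sk; rewrite /s; lra.
  - move=> i j /asboolP Pi /asboolP Pj si sj.
    have := hM _ _ _ _ _ _ (wc i.1.1) (wd i.1.2) (wc j.1.1) (wd j.1.2) Pi Pj.
    rewrite /pair_val ifT; last by move: si sj; rewrite /s => *; apply/andP; lra.
    rewrite ler_pdivlMr; last by move: si sj; rewrite /s; lra.
    by rewrite -/(al i) -/(al j) /s; lra.
have [q [de [hq de01 sde deE]]] := @capped_tight n (c_lo D) (c_hi D) x hc' g g0.
pose c : 'rV[R]_n := \row_i (c_lo D 0 i + (c_hi D 0 i - c_lo D 0 i) * de i).
have Uc : U1 D c.
  split=> [i|].
    rewrite mxE; have := hc i; have := de01 i => /andP[? ?] /andP[? ?].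
    by rewrite addr_ge0 // mulr_ge0 // subr_ge0.
  exists (\row_i de i); split=> [i|i|]; rewrite ?mxE //.
  by under eq_bigr do rewrite mxE; apply: le_trans gG.
have rem : Ga - g <=
    Ga - \sum_i (c 0 i - c_lo D 0 i) / (c_hi D 0 i - c_lo D 0 i).
  rewrite lerD2l lerN2; apply: le_trans sde; apply: ler_sum => i _.
  rewrite mxE addrAC subrr add0r.
  have [->|h] := eqVneq (c_hi D 0 i - c_lo D 0 i) 0.
    by rewrite !mul0r; case/andP: (de01 i).
  by rewrite mulrAC divff // mul1r.
apply: le_trans (_ : ereal_inf [set ereal_sup
  [set (cost c x + cost d y)%:E | d in U2 D c] | y in X2 X x]%classic <= _)%E;
  last by apply: ereal_sup_ubound; exists c.
apply: le_ereal_inf_tmp => _ [y Xy <-].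
have Gg : 0 <= Ga - g by rewrite subr_ge0.
have [p [ep [hp ep01 sep epE]]] := @capped_tight n (d_lo D) (d_hi D) y hd' _ Gg.
pose d : 'rV[R]_n := \row_i (d_lo D 0 i + (d_hi D 0 i - d_lo D 0 i) * ep i).
have Ud : U2 D c d.
  split=> [i|].
    rewrite mxE; have := hd i; have := ep01 i => /andP[? ?] /andP[? ?].
    by rewrite addr_ge0 // mulr_ge0 // subr_ge0.
  exists (\row_i ep i); split=> [i|i|]; rewrite ?mxE //.
  by under eq_bigr do rewrite mxE; apply: le_trans sep _.
apply: le_trans (_ : (cost c x + cost d y)%:E <= _)%E; last first.
  by apply: ereal_sup_ubound; exists d.
rewrite lee_fin.
have -> : cost c x = g * q + cap1 x q.
  by rewrite /cap1 -deE; apply: eq_bigr => i _; rewrite mxE.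
have -> : cost d y = (Ga - g) * p + cap2 y p.
  by rewrite /cap2 -epE; apply: eq_bigr => i _; rewrite mxE.
have [oq hoq] : exists o, q = uc o.
  by case: hq => [->|[i ->]]; [exists None|exists (Some i)].
have [op hop] : exists o, p = ud o.
  by case: hp => [->|[i ->]]; [exists None|exists (Some i)].
have := hg (oq, op, y) (asboolT Xy).
by rewrite /al /s /dual_val /= -hoq -hop; lra.
Qed.

End Duality.
End Minimax.

(** * From recourse solutions to pairs of plans *)

Section Triples.
Variables (n : nat) (X : set (bvec n)).
Implicit Types (x y z : bvec n).

Definition dot (c : 'I_n -> int) x : int := \sum_i c i * (x i : nat)%:Z.

(** The optimal way to realize two plans: what they share is bought in the first
    stage whenever that is cheaper, everything else in the second stage. *)
Lemma triple_of_pair (a b1 b2 : 'I_n -> int) z1 z2 : X z1 -> X z2 ->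
  exists x y1 y2, [/\ X2 X x y1, X2 X x y2
    & dot a x + dot b1 y1 + dot b2 y2 = pair_cost a b1 b2 z1 z2].
Proof.
move=> h1 h2.
pose x : bvec n := [ffun i => [&& z1 i, z2 i & a i < b1 i + b2 i]].
exists x, [ffun i => z1 i && ~~ x i], [ffun i => z2 i && ~~ x i].
split.
- split=> [i|]; first by rewrite !ffunE; case: (z1 i); case: (z2 i); case: (_ < _).
  by exists z1 => // i; rewrite !ffunE; case: (z1 i); case: (z2 i); case: (_ < _).
- split=> [i|]; first by rewrite !ffunE; case: (z1 i); case: (z2 i); case: (_ < _).
  by exists z2 => // i; rewrite !ffunE; case: (z1 i); case: (z2 i); case: (_ < _).
rewrite /dot /pair_cost -!big_split; apply: eq_bigr => i _ /=.
by rewrite !ffunE; case: (z1 i); case: (z2 i) => //=;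
  case: (ltrP (a i) (b1 i + b2 i)) => h /=; lia.
Qed.

(** Conversely, the items bought in the first stage belong to both plans, as each
    answer completes them to a feasible solution. *)
Lemma pair_of_triple (a b1 b2 : 'I_n -> int) x y1 y2 : X2 X x y1 -> X2 X x y2 ->
  exists z1 z2, [/\ X z1, X z2
    & pair_cost a b1 b2 z1 z2 <= dot a x + dot b1 y1 + dot b2 y2].
Proof.
move=> [h1 [z1 Xz1 e1]] [h2 [z2 Xz2 e2]]; exists z1, z2; split=> //.
rewrite /dot /pair_cost -!big_split; apply: ler_sum => i _ /=.
move: (e1 i) (e2 i); case: (x i); case: (y1 i); case: (y2 i); case: (z1 i);
  by case: (z2 i) => //= _ _; lia.
Qed.

Lemma is_opt_triple (a b1 b2 : 'I_n -> int) m : is_opt a b1 b2 X m ->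
  (exists x y1 y2, [/\ X2 X x y1, X2 X x y2
     & dot a x + dot b1 y1 + dot b2 y2 = m]) /\
  (forall x y1 y2, X2 X x y1 -> X2 X x y2 ->
     m <= dot a x + dot b1 y1 + dot b2 y2).
Proof.
case=> -[z1 [z2 [h1 h2 <-]]] h; split; first exact: triple_of_pair.
move=> x y1 y2 h3 h4; have [z1' [z2' [h5 h6 le]]] := pair_of_triple a b1 b2 h3 h4.
by apply: le_trans le; apply: h.
Qed.

(** A first-stage solution, read as a binary number. *)
Definition mask x : int := \sum_(i < n) 2 ^+ i * (x i : nat)%:Z.

(** The perturbations add up to less than [2 ^+ n], so they cannot make up for a
    difference of unperturbed costs: an optimal solution of the perturbed problem
    is optimal for the original one, and its mask is the remainder. *)
Lemma perturbed_opt (a b1 b2 : 'I_n -> int) m m' :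
  is_opt a b1 b2 X m ->
  is_opt (fun i => 2 ^+ n * a i + 2 ^+ i) (fun i => 2 ^+ n * b1 i)
    (fun i => 2 ^+ n * b2 i) X m' ->
  exists x y1 y2, [/\ X2 X x y1, X2 X x y2,
    dot a x + dot b1 y1 + dot b2 y2 = m & m' - 2 ^+ n * m = mask x].
Proof.
move=> /is_opt_triple[[x0 [u1 [u2 [hu1 hu2 e0]]]] lo].
move=> /is_opt_triple[[x [y1 [y2 [hy1 hy2 e]]]] lo'].
have dE x' u v : dot (fun i => 2 ^+ n * a i + 2 ^+ i) x'
    + dot (fun i => 2 ^+ n * b1 i) u + dot (fun i => 2 ^+ n * b2 i) v
    = 2 ^+ n * (dot a x' + dot b1 u + dot b2 v) + mask x'.
  rewrite /dot /mask !mulrDr !mulr_sumr -!big_split /=.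
  by apply: eq_bigr => i _; lia.
have maskb x' : 0 <= mask x' < 2 ^+ n.
  have E k : (\sum_(i < k) 2 ^+ i : int) = 2 ^+ k - 1.
    by elim: k => [|k IH]; rewrite ?big_ord0 // big_ord_recr /= IH exprS; lia.
  apply/andP; split; first by apply: sumr_ge0 => i _; rewrite mulr_ge0 // exprn_ge0.
  apply: (@le_lt_trans _ _ (\sum_(i < n) 2 ^+ i)); last by rewrite E; lia.
  apply: ler_sum => i _; case: (x' i); rewrite ?mulr1 // mulr0.
  by rewrite exprn_ge0.
move: e; rewrite dE => e.
have := lo' x0 u1 u2 hu1 hu2; rewrite dE e0 -e => le.
have cm : dot a x + dot b1 y1 + dot b2 y2 = m.
  have := lo x y1 y2 hy1 hy2; move: le (maskb x) (maskb x0).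
  have : (0 : int) < 2 ^+ n by rewrite exprn_gt0.
  move: (2 ^+ n) (dot a x + _ + _) => M c M0 le /andP[b0 b3] /andP[b4 b5] mc.
  by nia.
exists x, y1, y2; split; [exact: hy1|exact: hy2|exact: cm|].
by rewrite cm addrAC subrr add0r.
Qed.

End Triples.

(** * The dual bounds in scaled integers *)

Section Scaled.
Variables (n : nat) (cl v dl w : 'I_n -> int) (G Q : int).
Implicit Types (x y : bvec n) (q p : int).

Definition icap (lo u : 'I_n -> int) q x : int :=
  dot (fun i => lo i + pos (u i - q)) x.

(** The multipliers clear the denominator of [pair_val].  When only the first
    bound counts, they are 1 and 0, and the second answer is free of charge. *)
Definition mixed q1 p1 q2 p2 : bool := (q1 < p1) && (p2 < q2).
Definition mult1 q1 p1 q2 p2 : int := if mixed q1 p1 q2 p2 then q2 - p2 else 1.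
Definition mult2 q1 p1 q2 p2 : int := if mixed q1 p1 q2 p2 then p1 - q1 else 0.
Definition denom q1 p1 q2 p2 : int := mult1 q1 p1 q2 p2 + mult2 q1 p1 q2 p2.
Definition konst q1 p1 q2 p2 : int :=
  if mixed q1 p1 q2 p2 then (q2 - p2) * (G * p1) + (p1 - q1) * (G * p2)
  else G * Num.max q1 p1.

Definition price_a q1 p1 q2 p2 (i : 'I_n) : int :=
  mult1 q1 p1 q2 p2 * (cl i + pos (v i - q1)) +
  mult2 q1 p1 q2 p2 * (cl i + pos (v i - q2)).
Definition price_b1 q1 p1 q2 p2 (i : 'I_n) : int :=
  mult1 q1 p1 q2 p2 * (dl i + pos (w i - p1)).
Definition price_b2 q1 p1 q2 p2 (i : 'I_n) : int :=
  mult2 q1 p1 q2 p2 * (dl i + pos (w i - p2)).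

Definition triple_cost q1 p1 q2 p2 x y1 y2 : int :=
  dot (price_a q1 p1 q2 p2) x + dot (price_b1 q1 p1 q2 p2) y1
  + dot (price_b2 q1 p1 q2 p2) y2.

Definition num_val q1 p1 q2 p2 x y1 y2 : int :=
  konst q1 p1 q2 p2 + Q * triple_cost q1 p1 q2 p2 x y1 y2.

Lemma mult_ge0 q1 p1 q2 p2 :
  [/\ 0 <= mult1 q1 p1 q2 p2, 0 <= mult2 q1 p1 q2 p2 & 0 < denom q1 p1 q2 p2].
Proof.
by rewrite /denom /mult1 /mult2 /mixed; case: ifP => [/andP[h1 h2]|_]; split; lia.
Qed.

(** The dual bound is linear in [x], [y1] and [y2], so that minimizing it for
    fixed prices is the two-plan problem. *)
Lemma triple_costE q1 p1 q2 p2 x y1 y2 :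
  triple_cost q1 p1 q2 p2 x y1 y2 =
  mult1 q1 p1 q2 p2 * (icap cl v q1 x + icap dl w p1 y1) +
  mult2 q1 p1 q2 p2 * (icap cl v q2 x + icap dl w p2 y2).
Proof.
rewrite /triple_cost /icap /dot !mulrDr !mulr_sumr -!big_split /=.
by apply: eq_bigr => i _; rewrite /price_a /price_b1 /price_b2; lia.
Qed.

Variables (R : realType) (D : budget_data rat n) (X : set (bvec n)).
Hypothesis Q0 : 0 < Q.
Hypothesis clE : forall i, (cl i)%:~R = c_lo D 0 i * Q%:~R.
Hypothesis vE : forall i, (v i)%:~R = (c_hi D 0 i - c_lo D 0 i) * Q%:~R.
Hypothesis dlE : forall i, (dl i)%:~R = d_lo D 0 i * Q%:~R.
Hypothesis wE : forall i, (w i)%:~R = (d_hi D 0 i - d_lo D 0 i) * Q%:~R.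
Hypothesis GE : G%:~R = Gam D * Q%:~R.
Hypothesis wf : budget_wf D.

Local Notation Dr := (map_budget (ratr : rat -> R) D).
Local Notation "q %:S" := (q%:~R / Q%:~R : R) (at level 2, format "q %:S").

Lemma QR0 : Q%:~R != 0 :> R.
Proof. by rewrite intr_eq0 gt_eqF. Qed.

Lemma scaledE (z : int) (r : rat) : z%:~R = r * Q%:~R -> ratr r = z%:S.
Proof.
move=> e; have -> : r = z%:~R / Q%:~R.
  by rewrite e mulfK // intr_eq0 gt_eqF.
by rewrite fmorph_div /= !ratr_int.
Qed.

Lemma budget_wf_real : budget_wf Dr.
Proof.
have [h1 h2 h3] := wf; split=> [i|i|]; rewrite ?mxE /=.
- by have := h1 i; rewrite ler0q ler_rat.
- by have := h2 i; rewrite ler0q ler_rat.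
- by rewrite ler0q.
Qed.

Lemma pos_scaled (z : int) : pos (z%:S) = (pos z)%:S.
Proof.
have Qp : 0 < Q%:~R :> R by rewrite ltr0z.
case: (posP z) => -[hz ->].
  by rewrite /pos max_r // divr_ge0 ?ler0z // ltW.
by rewrite mul0r /pos max_l // pmulr_lle0 ?invr_gt0 // lerz0.
Qed.

Lemma capped_scaled (lo hi : 'rV[rat]_n) (il iu : 'I_n -> int) q x :
  (forall i, (il i)%:~R = lo 0 i * Q%:~R) ->
  (forall i, (iu i)%:~R = (hi 0 i - lo 0 i) * Q%:~R) ->
  capped (map_mx (ratr : rat -> R) lo) (map_mx ratr hi) x q%:S
    = (icap il iu q x)%:S.
Proof.
move=> h1 h2; rewrite /capped /icap /dot rmorph_sum mulr_suml.
apply: eq_bigr => i _; rewrite !mxE -rmorphB /= (scaledE (h1 i)) (scaledE (h2 i)).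
by rewrite -mulrBl -intrB pos_scaled !intrM intrD /= mulrAC -mulrDl mulrAC.
Qed.

Lemma pair_val_scaled q1 p1 q2 p2 x y1 y2 :
  pair_val Dr q1%:S p1%:S q2%:S p2%:S x y1 y2 =
  (num_val q1 p1 q2 p2 x y1 y2)%:~R / (Q * (Q * denom q1 p1 q2 p2))%:~R.
Proof.
have Qn := QR0; have Qp : 0 < Q%:~R :> R by rewrite ltr0z.
have ltS (s t : int) : (s%:S < t%:S) = (s < t).
  by rewrite ltr_pM2r ?invr_gt0 // ltr_int.
have GaE : Gam Dr = G%:S by rewrite /= (scaledE GE).
have dvE q p x' y : dual_val Dr q%:S p%:S x' y =
    (G * p + Q * (icap cl v q x' + icap dl w p y))%:~R / (Q * Q)%:~R.
  rewrite /dual_val /cap1 /cap2 /= (capped_scaled _ _ clE vE).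
  rewrite (capped_scaled _ _ dlE wE) (scaledE GE) !(intrD, intrM).
  by field.
rewrite /pair_val !ltS -/(mixed q1 p1 q2 p2) /num_val triple_costE.
have [_ _ d0] := mult_ge0 q1 p1 q2 p2.
move: d0; rewrite /konst /denom /mult1 /mult2; case: ifP => _ d0.
  have dn : (q2 - p2)%:~R + (p1 - q1)%:~R != 0 :> R.
    by rewrite -intrD intr_eq0 gt_eqF.
  rewrite !dvE -!mulrBl -!intrB !(intrD, intrM); field.
  by rewrite Qn andbT -!intrB.
rewrite /cap1 /cap2 /= (capped_scaled _ _ clE vE) (capped_scaled _ _ dlE wE).
have -> : Num.max q1%:S p1%:S = (Num.max q1 p1)%:S.
  case: (ltrP q1 p1) => h; first by rewrite max_r // ltW // ltS.
  by rewrite max_l // ler_pM2r ?invr_gt0 // ler_int.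
rewrite (scaledE GE).
by rewrite mul1r mul0r !addr0 mulr1 !(intrD, intrM); field.
Qed.

Lemma width_scaled (lo hi : 'rV[rat]_n) (iu : 'I_n -> int) r :
  (forall i, (iu i)%:~R = (hi 0 i - lo 0 i) * Q%:~R) ->
  width (map_mx (ratr : rat -> R) lo) (map_mx ratr hi) r ->
  exists2 k, (k <= n)%N & r = (ext 0 iu k)%:S.
Proof.
move=> h [->|[i ->]].
  exists n => //; rewrite /ext insubF ?ltnn // mul0r //.
exists i; first exact: ltnW.
by rewrite extE !mxE -rmorphB /= (scaledE (h i)).
Qed.

Lemma v_ge0 i : 0 <= v i.
Proof.
have [h _ _] := wf; rewrite -(ler0z rat) vE mulr_ge0 //; last by rewrite ler0z ltW.
by rewrite subr_ge0; have /andP[] := h i.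
Qed.

Lemma w_ge0 i : 0 <= w i.
Proof.
have [_ h _] := wf; rewrite -(ler0z rat) wE mulr_ge0 //; last by rewrite ler0z ltW.
by rewrite subr_ge0; have /andP[] := h i.
Qed.

Lemma cl_ge0 i : 0 <= cl i.
Proof.
have [h _ _] := wf; rewrite -(ler0z rat) clE mulr_ge0 //; last by rewrite ler0z ltW.
by have /andP[] := h i.
Qed.

Lemma dl_ge0 i : 0 <= dl i.
Proof.
have [_ h _] := wf; rewrite -(ler0z rat) dlE mulr_ge0 //; last by rewrite ler0z ltW.
by have /andP[] := h i.
Qed.

Lemma ext_ge0 (f : 'I_n -> int) k : (forall i, 0 <= f i) -> 0 <= ext 0 f k.
Proof. by move=> h; rewrite /ext; case: insubP. Qed.

Local Notation vk := (ext 0 v).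
Local Notation wk := (ext 0 w).

(** A fraction that is the value of one dual bound and at most the value of
    every other is the optimal value, by the two duality inequalities. *)
Lemma optimal_fraction (N d : int) (x : bvec n) :
  (exists k1 l1 k2 l2 y1 y2, [/\ X2 X x y1, X2 X x y2,
     N = num_val (vk k1) (wk l1) (vk k2) (wk l2) x y1 y2
     & d = denom (vk k1) (wk l1) (vk k2) (wk l2)]) ->
  (forall k1 l1 k2 l2 x' y1 y2, (k1 <= n)%N -> (l1 <= n)%N -> (k2 <= n)%N ->
     (l2 <= n)%N -> X2 X x' y1 -> X2 X x' y2 ->
     N * denom (vk k1) (wk l1) (vk k2) (wk l2)
       <= num_val (vk k1) (wk l1) (vk k2) (wk l2) x' y1 y2 * d) ->
  [/\ 0 < Q * (Q * d), Rob Dr X = (N%:~R / (Q * (Q * d))%:~R)%:E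
    & rob_value Dr X x = Rob Dr X].
Proof.
move=> [k1 [l1 [k2 [l2 [y1 [y2 [Xy1 Xy2 NE dE]]]]]]] opt.
have [_ _ d0] := mult_ge0 (vk k1) (wk l1) (vk k2) (wk l2); rewrite -dE in d0.
have q0 : 0 < Q * (Q * d) by rewrite !mulr_gt0.
pose M : R := N%:~R / (Q * (Q * d))%:~R.
have Sge (f : 'I_n -> int) k : (forall i, 0 <= f i) -> 0 <= (ext 0 f k)%:S.
  by move=> h; rewrite divr_ge0 // ler0z ?ext_ge0 // ltW.
have up : (rob_value Dr X x <= M%:E)%E.
  have -> : M = pair_val Dr (vk k1)%:S (wk l1)%:S (vk k2)%:S (wk l2)%:S x y1 y2.
    by rewrite pair_val_scaled -NE -dE.
  by apply: rob_value_le => //; first (exact: budget_wf_real); apply: Sge;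
    (exact: v_ge0 || exact: w_ge0).
have low x' : (M%:E <= rob_value Dr X x')%E.
  apply: rob_value_ge; first exact: budget_wf_real.
  move=> q1 p1 q2 p2 u1 u2 /(width_scaled vE)[i1 hi1 ->].
  move=> /(width_scaled wE)[j1 hj1 ->] /(width_scaled vE)[i2 hi2 ->].
  move=> /(width_scaled wE)[j2 hj2 ->] Xu1 Xu2.
  rewrite pair_val_scaled /M.
  have := opt _ _ _ _ _ _ _ hi1 hj1 hi2 hj2 Xu1 Xu2.
  have [_ _ d0'] := mult_ge0 (vk i1) (wk j1) (vk i2) (wk j2).
  move: (num_val _ _ _ _ _ _ _) (denom _ _ _ _) d0' => N' d' d0' le.
  have Qp : 0 < Q%:~R :> R by rewrite ltr0z.
  have dp : 0 < d%:~R :> R by rewrite ltr0z.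
  have dp' : 0 < d'%:~R :> R by rewrite ltr0z.
  rewrite ler_pdivrMr ?ltr0z // mulrAC ler_pdivlMr; last first.
    by rewrite ltr0z !mulr_gt0.
  by rewrite -!intrM ler_int; nia.
have rob : Rob Dr X = M%:E.
  apply/eqP; rewrite eq_le; apply/andP; split.
    by apply: le_trans up; apply: ereal_inf_lbound; exists x.
  by apply: le_ereal_inf_tmp => _ [x' _ <-].
by split=> //; rewrite rob; apply/eqP; rewrite eq_le up low.
Qed.

End Scaled.

(** * Scaling the input *)

(** As before, each loop counter is followed by the register that holds its
    bound.  The numbers from 40 to 79 are left to the solvers. *)
Notation rQ := 3%N.
Notation rG := 4%N.
Notation rM := 5%N.
Notation rBV := 7%N.
Notation rBD := 8%N.
Notation rMul := 9%N.
Notation rMask := 10%N.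
Notation rPert := 12%N.
Notation rNum := 80%N.
Notation rJ := 81%N.
Notation rL := 83%N.
Notation rD := 85%N.
Notation rI := 86%N.
Notation rK1 := 88%N.
Notation rL1 := 90%N.
Notation rK2 := 92%N.
Notation rL2 := 94%N.
Notation rQ1 := 96%N.
Notation rP1 := 97%N.
Notation rQ2 := 98%N.
Notation rP2 := 99%N.
Notation rM1 := 100%N.
Notation rM2 := 101%N.
Notation rK := 102%N.
Notation rDen := 103%N.
Notation rVal := 104%N.
Notation rC := 105%N.
Notation rT := 106%N.
Notation rT2 := 107%N.
Notation aZ := 2%N.
Notation aWc := 3%N.
Notation aWd := 4%N.
Notation aCL := 5%N.
Notation aDL := 6%N.
Notation aP := 7%N.

Definition twice (e : expr) : expr := Add e e.

(** Multiplying all data by the product of all denominators turns them into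
    integers whose length is still polynomial in that of the input. *)
Definition cmd_scale : cmd :=
  CSeq (CAsgn rN (Get 0 (Const 0)))
  (CSeq (CAsgn rNum (Add (Const 1) (twice (twice (Reg rN)))))
  (CSeq (CAsgn rOff (Add (Const 1) (twice (Reg rNum))))
  (CSeq (CAsgn rQ (Const 1))
    (CFor rJ 82 (Reg rNum)
      (CSeq (CAsgn rD (Get 0 (Add (Const 2) (twice (Reg rJ)))))
      (CSeq (CFor rL 84 (Reg rJ)
        (CPut aZ (Reg rL) (Mul (Get aZ (Reg rL)) (Reg rD))))
      (CSeq (CPut aZ (Reg rJ)
        (Mul (Get 0 (Add (Const 1) (twice (Reg rJ)))) (Reg rQ)))
        (CAsgn rQ (Mul (Reg rQ) (Reg rD)))))))))).

(** The arrays of widths get a last entry 0, so that the indices up to [n] run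
    over all candidates for the price of the budget.  [aP] holds the powers of
    two for the perturbation. *)
Definition cmd_derive : cmd :=
  CSeq (CAsgn rG (Get aZ (Const 0)))
  (CSeq (CAsgn rM (Const 1))
  (CSeq (CFor rI 87 (Reg rN)
    (CSeq (CAsgn rT (twice (twice (Reg rI))))
    (CSeq (CPut aCL (Reg rI) (Get aZ (Add (Const 1) (Reg rT))))
    (CSeq (CPut aWc (Reg rI) (Sub (Get aZ (Add (Const 2) (Reg rT)))
                                (Get aZ (Add (Const 1) (Reg rT)))))
    (CSeq (CPut aDL (Reg rI) (Get aZ (Add (Const 3) (Reg rT))))
    (CSeq (CPut aWd (Reg rI) (Sub (Get aZ (Add (Const 4) (Reg rT)))
                                (Get aZ (Add (Const 3) (Reg rT)))))
    (CSeq (CPut aP (Reg rI) (Reg rM))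
          (CAsgn rM (twice (Reg rM))))))))))
  (CSeq (CPut aWc (Reg rN) (Const 0))
  (CSeq (CPut aWd (Reg rN) (Const 0))
  (CSeq (CAsgn rBV (Const 1)) (CAsgn rBD (Const 0))))))).

Section Scale.
Variables (n B : nat) (w : seq int) (qs : nat -> rat).
Let m := (4 * n).+1.
Hypothesis mB : (m <= B)%N.
Hypothesis w_small : forall k, (`|(w`_k)%R| <= 2 ^ B)%N.
Hypothesis w0 : nth 0 w 0 = n%:Z.
Hypothesis w_num : forall j, (j < m)%N -> nth 0 w (1 + (j + j)) = numq (qs j).
Hypothesis w_den : forall j, (j < m)%N -> nth 0 w (2 + (j + j)) = denq (qs j).

Definition den_prod (j : nat) : int := \prod_(l < j) denq (qs l).

Definition scaled_to (P : pred nat) (q : int) (st : state) : Prop :=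
  forall l, P l -> (arr st aZ l%:Z)%:~R = qs l * q%:~R.

Lemma wp_scale st : (forall k : nat, arr st 0 k%:Z = nth 0 w k) ->
  wp B cmd_scale (fun st' => [/\ reg st' rN = n%:Z,
    reg st' rOff = (1 + (m + m))%:Z, reg st' rQ = den_prod m
    & scaled_to (fun l => l < m)%N (den_prod m) st']) st.
Proof.
move=> hin.
apply: wp_seq; apply: wp_asgn => //=; rewrite (hin 0%N) w0.
apply: wp_seq; apply: wp_asgn => //=.
have -> : 1 + (n%:Z + n%:Z + (n%:Z + n%:Z)) = m%:Z by rewrite /m; lia.
apply: wp_seq; apply: wp_asgn => //=.
apply: wp_seq; apply: wp_asgn => //=; set st1 := set_reg _ rQ 1.
pose Inv j st' := reg st' rQ = den_prod j /\
  scaled_to (fun l => l < j)%N (den_prod j) st'.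
apply: (wp_for (k := m) (Inv := Inv)) => //.
- by split; [rewrite /den_prod big_ord0|].
- move=> j st2 jm rj sm [hQ hZ].
  have hin2 (k : nat) : arr st2 0 k%:Z = nth 0 w k.
    by rewrite (sameA _ sm) //; exact: hin.
  have QS : den_prod j.+1 = den_prod j * denq (qs j) by rewrite /den_prod big_ord_recr.
  have eD : eval st2 (Get 0 (Add (Const 2) (twice (Reg rJ)))) = denq (qs j).
    by rewrite /= rj -!PoszD hin2 w_den.
  apply: wp_seq; apply: wp_asgn => //; rewrite eD.
  apply: wp_seq.
  pose Inv2 l st' := scaled_to (fun l' => l' < l)%N (den_prod j.+1) st' /\
     scaled_to (fun l' => l <= l' < j)%N (den_prod j) st'.
  have dB : (`|denq (qs j)| <= 2 ^ B)%N by rewrite -w_den.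
  have nB : (`|numq (qs j)| <= 2 ^ B)%N by rewrite -w_num.
  apply: (wp_for (k := j) (Inv := Inv2)) => //.
  + by apply: leq_trans mB; apply: ltnW.
  + move=> l st3 lj rl sm3 [h1 h2].
    have rD3 : reg st3 rD = denq (qs j) by rewrite (sameR sm3).
    apply: wp_put => //=; first by rewrite rD3 dB orbT.
    rewrite rl rD3; split=> l' /= hl'; rewrite eqz_nat.
      move: hl'; rewrite ltnS leq_eqVlt => /orP[/eqP->|hl'].
        rewrite eqxx intrM h2 ?leqnn ?lj // QS intrM mulrA //.
      by rewrite (ltn_eqF hl') h1.
    by rewrite gtn_eqF ?h2 //; lia.
  move=> st3 sm3 [h1 _].
  have rD3 : reg st3 rD = denq (qs j) by rewrite (sameR sm3).
  have rJ3 : reg st3 rJ = j%:Z by rewrite (sameR sm3).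
  have rQ3 : reg st3 rQ = den_prod j by rewrite (sameR sm3).
  have eN : eval st3 (Get 0 (Add (Const 1) (twice (Reg rJ)))) = numq (qs j).
    by rewrite /= rJ3 -!PoszD (sameA _ sm3) // hin2 w_num.
  apply: wp_seq; apply: wp_put => //; first by move: eN => /= ->; rewrite nB.
  apply: wp_asgn => /=; first by rewrite rD3 dB orbT.
  rewrite rQ3 rD3 -QS; split=> //= l' /=; rewrite rJ3 eqz_nat ltnS leq_eqVlt.
  case: eqP => [-> _|_ /= hl']; last by rewrite h1.
  move: eN; rewrite /= rJ3 => ->.
  by rewrite QS !intrM numqE mulrAC mulrA.
- move=> st2 sm [hQ hZ]; split=> //.
  + by rewrite (sameR sm).
  + by rewrite (sameR sm) //= !PoszD.
Qed.

Lemma den_prod_gt0 j : 0 < den_prod j.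
Proof. by apply: prodr_gt0 => l _; exact: denq_gt0. Qed.

Lemma den_prod_le b j : (j <= m)%N ->
  (forall k, (`|(w`_k)%R| <= 2 ^ b)%N) -> (`|den_prod j| <= 2 ^ (b * j))%N.
Proof.
move=> jm hw; elim: j jm => [|j IH] jm; first by rewrite /den_prod big_ord0 expn_gt0.
rewrite /den_prod big_ord_recr /= abszM mulnS addnC expnD.
by apply: leq_mul; [apply: IH; exact: ltnW|rewrite -w_den].
Qed.

End Scale.

Section Derive.
Variables (n B off : nat) (Q : int) (Z : nat -> int) (enc : seq int).
Hypothesis nB : (n < B)%N.

Definition zcl (i : 'I_n) : int := Z (1 + 4 * i).
Definition zv (i : 'I_n) : int := Z (2 + 4 * i) - Z (1 + 4 * i).
Definition zdl (i : 'I_n) : int := Z (3 + 4 * i).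
Definition zw (i : 'I_n) : int := Z (4 + 4 * i) - Z (3 + 4 * i).

(** What every later program may assume about the preprocessed input. *)
Record env (G : int) (cl v dl w : 'I_n -> int) (st : state) : Prop := Env {
  env_N : reg st rN = n%:Z;
  env_Off : reg st rOff = off%:Z;
  env_Q : reg st rQ = Q;
  env_G : reg st rG = G;
  env_M : reg st rM = 2 ^+ n;
  env_v : forall k, (k <= n)%N -> arr st aWc k%:Z = ext 0 v k;
  env_w : forall k, (k <= n)%N -> arr st aWd k%:Z = ext 0 w k;
  env_cl : holds aCL cl st;
  env_dl : holds aDL dl st;
  env_P : holds aP (fun i : 'I_n => 2 ^+ i) st;
  env_enc : forall k, arr st 0 (off + k)%:Z = nth 0 enc k }.

Lemma env_same rs bs G cl v dl w st st' : same rs bs st st' ->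
  all (fun r => r \notin rs) [:: rN; rQ; rG; rM; rOff] ->
  all (fun a => a \notin bs) [:: 0; aWc; aWd; aCL; aDL; aP]%N ->
  env G cl v dl w st -> env G cl v dl w st'.
Proof.
move=> sm /and5P[r1 r2 r3 r4 /andP[r5 _]] /and5P[a1 a2 a3 a4 /and3P[a5 a6 _]].
case=> e1 e2 e3 e4 e5 e6 e7 e8 e9 e10 e11.
split; rewrite ?(sameR sm) //.
- by move=> k kn; rewrite (sameA _ sm) // e6.
- by move=> k kn; rewrite (sameA _ sm) // e7.
- by move=> i; rewrite (sameA _ sm) // e8.
- by move=> i; rewrite (sameA _ sm) // e9.
- by move=> i; rewrite (sameA _ sm) // e10.
- by move=> k; rewrite (sameA _ sm) // e11.
Qed.

Lemma ext_n (f : 'I_n -> int) : ext 0 f n = 0.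
Proof. by rewrite /ext insubF // ltnn. Qed.

Lemma wp_derive st : reg st rN = n%:Z -> reg st rOff = off%:Z -> reg st rQ = Q ->
  (forall l, (l < (4 * n).+1)%N -> arr st aZ l%:Z = Z l) ->
  (forall k, arr st 0 (off + k)%:Z = nth 0 enc k) ->
  wp B cmd_derive (fun st' => [/\ env (Z 0) zcl zv zdl zw st',
    reg st' rBV = 1 & reg st' rBD = 0]) st.
Proof.
move=> hN hO hQ hZ hE.
apply: wp_seq; apply: wp_asgn => //=; rewrite (hZ 0%N) //.
apply: wp_seq; apply: wp_asgn => //=; set st1 := set_reg _ rM 1.
apply: wp_seq.
pose Inv k st' := [/\ reg st' rM = 2 ^+ k,
  forall i : 'I_n, (i < k)%N -> arr st' aCL (i : nat)%:Z = zcl i /\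
      arr st' aWc (i : nat)%:Z = zv i,
  forall i : 'I_n, (i < k)%N -> arr st' aDL (i : nat)%:Z = zdl i /\
      arr st' aWd (i : nat)%:Z = zw i
  & forall i : 'I_n, (i < k)%N -> arr st' aP (i : nat)%:Z = 2 ^+ i].
apply: (wp_for (k := n) (Inv := Inv)) => //; first exact: ltnW.
  move=> k st2 kn rk sm [i1 i2 i3 i4]; pose o := Ordinal kn.
  have hZ2 c : (0 < c <= 4)%N -> arr st2 aZ (c%:Z + (k%:Z + k%:Z + (k%:Z + k%:Z)))
      = Z (c + 4 * k)%N.
    move=> hc; rewrite -!PoszD (sameA _ sm) //= -hZ; last by lia.
    by congr (arr _ _ _); lia.
  apply: wp_seq; apply: wp_asgn => //=; rewrite rk.
  do 5! (apply: wp_seq; apply: wp_put => //=).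
  apply: wp_asgn => //=; rewrite rk.
  rewrite (hZ2 1%N) // (hZ2 2%N) // (hZ2 3%N) // (hZ2 4%N) //.
  have cs (j : 'I_n) : (j < k.+1)%N ->
      j = o \/ (j < k)%N /\ ((j : nat)%:Z == k%:Z) = false.
    rewrite ltnS leq_eqVlt => /orP[/eqP jk|jk]; first by left; apply: val_inj.
    by right; rewrite eqz_nat (ltn_eqF jk).
  split=> /= [|j /cs[->|[jk ->]]|j /cs[->|[jk ->]]|j /cs[->|[jk ->]]];
    rewrite ?eqxx //.
  - by rewrite i1 exprS; lia.
  - exact: i2.
  - exact: i3.
  - exact: i4.
move=> st2 sm [i1 i2 i3 i4].
have hN2 : reg st2 rN = n%:Z by rewrite (sameR sm).
apply: wp_seq; apply: wp_put => //=.
apply: wp_seq; apply: wp_put => //=.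
apply: wp_seq; apply: wp_asgn => //=.
apply: wp_asgn => //=.
have vk (f : 'I_n -> int) a : (forall i : 'I_n, arr st2 a (i : nat)%:Z = f i) ->
    forall k, (k <= n)%N ->
    (if k%:Z == n%:Z then 0 else arr st2 a k%:Z) = ext 0 f k.
  move=> h k; rewrite eqz_nat leq_eqVlt; case: eqP => [-> _|_ /= kn].
    by rewrite ext_n.
  by rewrite -[k]/(Ordinal kn : nat) h extE.
split=> //; split=> //=; rewrite ?(sameR sm) //= ?hN2.
- move=> k kn; rewrite hN; apply: vk => // i; exact: (i2 i (ltn_ord i)).2.
- move=> k kn; rewrite hN; apply: vk => // i; exact: (i3 i (ltn_ord i)).2.
- by move=> i; have [] := i2 i (ltn_ord i).
- by move=> i; have [] := i3 i (ltn_ord i).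
- by move=> i; apply: i4.
- by move=> k; rewrite (sameA _ sm) //; exact: hE.
Qed.

End Derive.

(** * The problem for one quadruple of prices *)

Definition CPos (r : nat) : cmd := CIf (Reg r) CSkip (CAsgn r (Const 0)).

Lemma wp_pos B r (Q : state -> Prop) st :
  (forall st', (forall r', reg st' r' = if r' == r then pos (reg st r) else reg st r') ->
     arr st' = arr st -> Q st') -> wp B (CPos r) Q st.
Proof.
move=> hQ; apply: wp_if => //= h.
  apply: wp_skip; apply: hQ => // r'.
  by case: eqP => // ->; case: (posP (reg st r)) => -[h' ->] //; lia.
apply: wp_asgn => //; apply: hQ => //= r'.
by case: eqP => // _; case: (posP (reg st r)) => -[h' ->] //; lia.
Qed.

(** The multipliers and the constant term for the four candidates at the indices
    [rK1], [rL1], [rK2] and [rL2]. *)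
Definition cmd_setup : cmd :=
  CSeq (CAsgn rQ1 (Get aWc (Reg rK1))) (CSeq (CAsgn rP1 (Get aWd (Reg rL1)))
  (CSeq (CAsgn rQ2 (Get aWc (Reg rK2))) (CSeq (CAsgn rP2 (Get aWd (Reg rL2)))
  (CSeq (CAsgn rM1 (Const 1)) (CSeq (CAsgn rM2 (Const 0))
  (CSeq (CAsgn rK (Mul (Reg rG) (Reg rQ1)))
  (CSeq (CIf (Sub (Reg rP1) (Reg rQ1))
    (CSeq (CAsgn rK (Mul (Reg rG) (Reg rP1)))
      (CIf (Sub (Reg rQ2) (Reg rP2))
        (CSeq (CAsgn rM1 (Sub (Reg rQ2) (Reg rP2)))
        (CSeq (CAsgn rM2 (Sub (Reg rP1) (Reg rQ1)))
          (CAsgn rK (Add (Mul (Reg rM1) (Mul (Reg rG) (Reg rP1)))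
                         (Mul (Reg rM2) (Mul (Reg rG) (Reg rP2)))))))
        CSkip)) CSkip)
    (CAsgn rDen (Add (Reg rM1) (Reg rM2)))))))))).

(** The prices are scaled by [rMul], and those of the first stage are perturbed
    by [rPert] times a power of two; the same code serves to find the optimal
    value and an optimal solution. *)
Definition cmd_prices : cmd :=
  CFor rI 87 (Reg rN)
    (CSeq (CAsgn rT (Sub (Get aWc (Reg rI)) (Reg rQ1)))
    (CSeq (CPos rT)
    (CSeq (CAsgn rT2 (Sub (Get aWc (Reg rI)) (Reg rQ2)))
    (CSeq (CPos rT2)
    (CSeq (CPut aA (Reg rI) (Add
        (Mul (Reg rMul) (Add (Mul (Reg rM1) (Add (Get aCL (Reg rI)) (Reg rT)))
                             (Mul (Reg rM2) (Add (Get aCL (Reg rI)) (Reg rT2)))))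
        (Mul (Reg rPert) (Get aP (Reg rI)))))
    (CSeq (CAsgn rT (Sub (Get aWd (Reg rI)) (Reg rP1)))
    (CSeq (CPos rT)
    (CSeq (CAsgn rT2 (Sub (Get aWd (Reg rI)) (Reg rP2)))
    (CSeq (CPos rT2)
    (CSeq (CPut aB1 (Reg rI) (Mul (Reg rMul)
        (Mul (Reg rM1) (Add (Get aDL (Reg rI)) (Reg rT)))))
      (CPut aB2 (Reg rI) (Mul (Reg rMul)
        (Mul (Reg rM2) (Add (Get aDL (Reg rI)) (Reg rT2))))))))))))))).

Section Tuple.
Variables (n B off : nat) (Q G : int) (enc : seq int) (cl v dl w : 'I_n -> int).
Variable (b : nat).
Hypothesis nB : (n < B)%N.
Hypothesis bB : (b < B)%N.
Hypothesis v_b : forall i, 0 <= v i <= 2 ^+ b.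
Hypothesis w_b : forall i, 0 <= w i <= 2 ^+ b.
Hypothesis G_b : 0 <= G <= 2 ^+ b.
Hypothesis Q_b : 0 <= Q <= 2 ^+ b.

Notation env := (@env n off Q enc G cl v dl w).
Notation vk := (ext 0 v).
Notation wk := (ext 0 w).

Lemma small_abs (z : int) : 0 <= z <= 2 ^+ b -> (`|z| <= 2 ^ B)%N.
Proof using bB.
move=> /andP[z0 zb]; have : (2 ^ b <= 2 ^ B)%N by rewrite leq_exp2l // ltnW.
by apply: leq_trans; rewrite -lez_nat gez0_abs // -[(2 ^ b)%N%:Z]natz natrX.
Qed.

Lemma small_abs2 (z : int) : 0 <= z <= 2 ^+ b + 2 ^+ b -> (`|z| <= 2 ^ B)%N.
Proof using bB.
clear -bB; move=> /andP[z0 zb]; have : (2 ^ b.+1 <= 2 ^ B)%N by rewrite leq_exp2l.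
apply: leq_trans; rewrite -lez_nat gez0_abs // -[(2 ^ b.+1)%N%:Z]natz natrX exprS.
by lia.
Qed.

Lemma ext_b (f : 'I_n -> int) k : (forall i, 0 <= f i <= 2 ^+ b) ->
  0 <= ext 0 f k <= 2 ^+ b.
Proof. by move=> h; rewrite /ext; case: insubP => //; rewrite lexx exprn_ge0. Qed.

Variables k1 l1 k2 l2 : nat.
Hypothesis hk1 : (k1 <= n)%N.
Hypothesis hl1 : (l1 <= n)%N.
Hypothesis hk2 : (k2 <= n)%N.
Hypothesis hl2 : (l2 <= n)%N.

Notation q1 := (vk k1).
Notation p1 := (wk l1).
Notation q2 := (vk k2).
Notation p2 := (wk l2).

Lemma mult_b : [/\ 0 <= mult1 q1 p1 q2 p2 <= 2 ^+ b,
  0 <= mult2 q1 p1 q2 p2 <= 2 ^+ b &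
  0 <= denom q1 p1 q2 p2 <= 2 ^+ b + 2 ^+ b].
Proof using v_b w_b.
clear -v_b w_b; have := ext_b k1 v_b; have := ext_b l1 w_b; have := ext_b k2 v_b.
have := ext_b l2 w_b; have : (1 : int) <= 2 ^+ b by apply: exprn_ege1.
rewrite /denom /mult1 /mult2 /mixed.
move: (2 ^+ b) (ext 0 v k1) (ext 0 w l1) (ext 0 v k2) (ext 0 w l2) => M x y z t.
by move=> hM /andP[h1 h2] /andP[h3 h4] /andP[h5 h6] /andP[h7 h8]; case: ifP;
  [move=> /andP[h9 h10]|]; split; apply/andP; lia.
Qed.

Definition tuple_regs (st : state) : Prop :=
  [/\ reg st rQ1 = q1, reg st rP1 = p1, reg st rQ2 = q2 & reg st rP2 = p2] /\
  [/\ reg st rM1 = mult1 q1 p1 q2 p2, reg st rM2 = mult2 q1 p1 q2 p2,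
      reg st rK = konst G q1 p1 q2 p2 & reg st rDen = denom q1 p1 q2 p2].

Lemma tuple_regs_same rs bs st st' : same rs bs st st' ->
  all (fun r => r \notin rs) [:: rQ1; rP1; rQ2; rP2; rM1; rM2; rK; rDen] ->
  tuple_regs st -> tuple_regs st'.
Proof.
move=> sm /and5P[r1 r2 r3 r4 /and5P[r5 r6 r7 r8 _]] [[e1 e2 e3 e4] [e5 e6 e7 e8]].
by split; split; rewrite (sameR sm).
Qed.

Lemma wp_setup st : env st ->
  reg st rK1 = k1%:Z -> reg st rL1 = l1%:Z ->
  reg st rK2 = k2%:Z -> reg st rL2 = l2%:Z ->
  wp B cmd_setup tuple_regs st.
Proof using bB v_b w_b G_b hk1 hl1 hk2 hl2.
move=> he e1 e2 e3 e4; have [_ _ _ hG _ hv hw _ _ _ _] := he.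
have Gs := small_abs G_b.
have [m1s m2s _] := mult_b.
do 6! (apply: wp_seq; apply: wp_asgn => //=).
apply: wp_seq; apply: wp_asgn => //=; first by rewrite hG Gs.
set st1 := set_reg _ rK _.
have [s1 s2 s3 s4] : [/\ reg st1 rQ1 = q1, reg st1 rP1 = p1,
    reg st1 rQ2 = q2 & reg st1 rP2 = p2].
  by rewrite /= e1 e2 e3 e4 !hv // !hw.
have [s5 s6 s7 s8] : [/\ reg st1 rM1 = 1, reg st1 rM2 = 0, reg st1 rK = G * q1
    & reg st1 rG = G].
  by rewrite /= e1 hG !hv.
move: st1 s1 s2 s3 s4 s5 s6 s7 s8 => st1 s1 s2 s3 s4 s5 s6 s7 s8 {he hG hv hw e1 e2 e3 e4}.
apply: wp_seq.
have fin st2 : [/\ reg st2 rQ1 = q1, reg st2 rP1 = p1,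
    reg st2 rQ2 = q2 & reg st2 rP2 = p2] ->
    [/\ reg st2 rM1 = mult1 q1 p1 q2 p2, reg st2 rM2 = mult2 q1 p1 q2 p2
      & reg st2 rK = konst G q1 p1 q2 p2] ->
    wp B (CAsgn rDen (Add (Reg rM1) (Reg rM2))) tuple_regs st2.
  by move=> [f1 f2 f3 f4] [f5 f6 f7]; apply: wp_asgn => //; split; split;
    rewrite //= f5 f6.
apply: wp_if => //=; rewrite s1 s2 ?subr_gt0 ?subr_le0 => h1; last first.
  apply: wp_skip; apply: fin; split => //;
    rewrite /mult1 /mult2 /konst /mixed ltNge h1 //= s7.
  by rewrite max_l.
apply: wp_seq; apply: wp_asgn => //=; first by rewrite s8 Gs.
apply: wp_if => //=; rewrite s3 s4 ?subr_gt0 ?subr_le0 => h2; last first.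
  apply: wp_skip; apply: fin; split => //;
    rewrite /mult1 /mult2 /konst /mixed [_ < vk _]ltNge h2 //= ?andbF //.
  by rewrite s8 s2 max_r // ltW.
move: m1s m2s; rewrite /mult1 /mult2 /mixed h1 h2 /= => m1s m2s.
apply: wp_seq; apply: wp_asgn => //=.
apply: wp_seq; apply: wp_asgn => //=.
apply: wp_asgn => /=; rewrite s8 s1 s2 s3 s4.
  by rewrite Gs (small_abs m1s) (small_abs m2s).
by apply: fin; split; rewrite //= ?s8 ?s1 ?s2 ?s3 ?s4 /mult1 /mult2 /konst /mixed h1 h2.
Qed.

Lemma wp_prices st (mu pe : int) : env st -> tuple_regs st ->
  reg st rMul = mu -> reg st rPert = pe ->
  (`|mu| <= 2 ^ B)%N -> (`|pe| <= 2 ^ B)%N ->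
  wp B cmd_prices (fun st' => [/\
    holds aA (fun i => mu * price_a cl v q1 p1 q2 p2 i + pe * 2 ^+ i) st',
    holds aB1 (fun i => mu * price_b1 dl w q1 p1 q2 p2 i) st' &
    holds aB2 (fun i => mu * price_b2 dl w q1 p1 q2 p2 i) st']) st.
Proof using nB bB v_b w_b.
move=> he ht hmu hpe smu spe; have [m1s m2s _] := mult_b.
have [s1 s2] := (small_abs m1s, small_abs m2s).
pose Inv k st' := forall i : 'I_n, (i < k)%N ->
  [/\ arr st' aA (i : nat)%:Z = mu * price_a cl v q1 p1 q2 p2 i + pe * 2 ^+ i,
      arr st' aB1 (i : nat)%:Z = mu * price_b1 dl w q1 p1 q2 p2 i &
      arr st' aB2 (i : nat)%:Z = mu * price_b2 dl w q1 p1 q2 p2 i].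
apply: (wp_for (k := n) (Inv := Inv)) => //.
- exact: env_N he.
- exact: ltnW.
- move=> k st1 kn rk sm hI; pose o := Ordinal kn.
  have he1 : env st1 by apply: env_same sm _ _ he.
  have ht1 : tuple_regs st1 by apply: tuple_regs_same sm _ ht.
  have hmu1 : reg st1 rMul = mu by rewrite (sameR sm).
  have hpe1 : reg st1 rPert = pe by rewrite (sameR sm).
  have [_ _ _ _ _ hv hw hcl hdl hP _] := he1.
  have [[t1 t2 t3 t4] [t5 t6 _ _]] := ht1.
  have vE : arr st1 aWc k%:Z = v o by rewrite hv ?(ltnW kn) // -[k]/(o : nat) extE.
  have wE : arr st1 aWd k%:Z = w o by rewrite hw ?(ltnW kn) // -[k]/(o : nat) extE.
  have clE : arr st1 aCL k%:Z = cl o by exact: (hcl o).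
  have dlE : arr st1 aDL k%:Z = dl o by exact: (hdl o).
  have PE : arr st1 aP k%:Z = 2 ^+ k by exact: (hP o).
  apply: wp_seq; apply: wp_asgn => //=; apply: wp_seq; apply: wp_pos => st2 r2 a2.
  apply: wp_seq; apply: wp_asgn => //=; apply: wp_seq; apply: wp_pos => st3 r3 a3.
  apply: wp_seq; apply: wp_put => //=.
    rewrite !r3 /= !r2 /= hmu1 hpe1 t5 t6 smu spe s1 s2 //.
  apply: wp_seq; apply: wp_asgn => //=; apply: wp_seq; apply: wp_pos => st4 r4 a4.
  apply: wp_seq; apply: wp_asgn => //=; apply: wp_seq; apply: wp_pos => st5 r5 a5.
  apply: wp_seq; apply: wp_put => //=.
    rewrite !r5 /= !r4 /= !r3 /= !r2 /= hmu1 t5 smu s1 //.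
  apply: wp_put => //=.
    rewrite !r5 /= !r4 /= !r3 /= !r2 /= hmu1 t6 smu s2 //.
  rewrite /Inv /= !r5 /= !r4 /= !r3 /= !r2 /= a5 /= a4 /= a3 /= a2 /= ?r3 /= ?r2 /= ?a2 /=.
  rewrite hmu1 hpe1 rk t1 t2 t3 t4 t5 t6 vE wE clE dlE PE.
  move=> j; rewrite ltnS leq_eqVlt /= eqz_nat => /orP[/eqP jk|jk].
    by have -> : j = o by [apply: val_inj]; rewrite eqxx.
  by rewrite (ltn_eqF jk); apply: hI.
- by move=> st1 _ hI; split=> i; have [] := hI i (ltn_ord i).
Qed.

End Tuple.

(** * The search over all quadruples of prices *)

(** After an improvement the perturbed problem is solved as well, in order to
    read off a first-stage solution. *)
Definition cmd_update (solver : cmd) : cmd :=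
  CSeq (CAsgn rBV (Reg rVal)) (CSeq (CAsgn rBD (Reg rDen))
  (CSeq (CAsgn rMul (Reg rM)) (CSeq (CAsgn rPert (Const 1))
  (CSeq cmd_prices (CSeq solver
    (CAsgn rMask (Sub (Reg rOut) (Mul (Reg rM) (Reg rC))))))))).

Definition cmd_eval (solver : cmd) : cmd :=
  CSeq (CAsgn rMul (Const 1)) (CSeq (CAsgn rPert (Const 0))
  (CSeq cmd_prices (CSeq solver (CSeq (CAsgn rC (Reg rOut))
  (CSeq (CAsgn rVal (Add (Reg rK) (Mul (Reg rQ) (Reg rC))))
    (CIf (Sub (Mul (Reg rBV) (Reg rDen)) (Mul (Reg rVal) (Reg rBD)))
      (cmd_update solver) CSkip)))))).

Definition cmd_upto (r l : nat) (c : cmd) : cmd :=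
  CFor r l (Add (Reg rN) (Const 1)) c.

Definition cmd_search4 (solver : cmd) : cmd :=
  cmd_upto rL2 95 (CSeq cmd_setup (cmd_eval solver)).
Definition cmd_search3 (solver : cmd) : cmd := cmd_upto rK2 93 (cmd_search4 solver).
Definition cmd_search2 (solver : cmd) : cmd := cmd_upto rL1 91 (cmd_search3 solver).
Definition cmd_search (solver : cmd) : cmd := cmd_upto rK1 89 (cmd_search2 solver).

(** The discipline that lets the search call a solver without losing its own
    data. *)
Definition local (solver : cmd) : bool :=
  [&& wfc solver, all (fun r => (r == rOut) || (40 <= r < 80)) (mregs solver)
    & all (fun a => 20 <= a < 40) (marrs solver)]%N.

(** Fractions are compared by cross-multiplication, which also makes sense for
    the initial value 1 / 0. *)
Lemma fraction_lt_trans (bv bd N d N' d' : int) : 0 < d -> 0 < d' -> 0 <= bd ->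
  N * bd < bv * d -> bv * d' <= N' * bd -> N * d' <= N' * d.
Proof.
move=> d0 d0' bd0 hlt le.
have bd_pos : 0 < bd.
  rewrite lt0r bd0 andbT; apply/eqP => bd00; rewrite bd00 !mulr0 in hlt le.
  by have : 0 < bv; nia.
rewrite -(ler_pM2r bd_pos); apply: (@le_trans _ _ (bv * d * d')).
  by rewrite mulrAC; apply: ler_wpM2r; apply: ltW.
by rewrite mulrAC [N' * d * bd]mulrAC; apply: ler_wpM2r => //; apply: ltW.
Qed.

Section Search.
Variables (P : nominal) (solver : cmd).
Hypothesis solver_ok : solves P solver.
Hypothesis solver_local : local solver.
Variables (n B off b : nat) (nom : nom_inst P n) (Q G : int).
Variables (cl v dl w : 'I_n -> int).
Hypothesis wf : nom_wf nom.
Hypothesis feas : exists z, nom_feas nom z.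
Hypothesis nB : (n < B)%N.
Hypothesis bB : (b < B)%N.
Hypothesis v_b : forall i, 0 <= v i <= 2 ^+ b.
Hypothesis w_b : forall i, 0 <= w i <= 2 ^+ b.
Hypothesis G_b : 0 <= G <= 2 ^+ b.
Hypothesis Q_b : 0 <= Q <= 2 ^+ b.
Hypothesis cl0 : forall i, 0 <= cl i.
Hypothesis dl0 : forall i, 0 <= dl i.

Notation env := (@env n off Q (nom_enc nom) G cl v dl w).
Notation vk := (ext 0 v).
Notation wk := (ext 0 w).
Notation X := (nom_feas nom).
Notation nval k1 l1 k2 l2 :=
  (num_val cl v dl w G Q (vk k1) (wk l1) (vk k2) (wk l2)).
Notation den k1 l1 k2 l2 := (denom (vk k1) (wk l1) (vk k2) (wk l2)).

Lemma solver_regF r : ~~ ((r == rOut) || (40 <= r < 80))%N ->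
  (r \in mregs solver) = false.
Proof.
move=> h; apply/negbTE; apply: contra h; have /and3P[_ /allP h _] := solver_local.
exact: h.
Qed.

Lemma solver_arrF a : ~~ (20 <= a < 40)%N -> (a \in marrs solver) = false.
Proof.
move=> h; apply/negbTE; apply: contra h; have /and3P[_ _ /allP h] := solver_local.
exact: h.
Qed.

(** Initially the best value is the fraction 1 / 0, that is, infinity. *)
Definition best (st : state) : Prop :=
  (reg st rBV = 1 /\ reg st rBD = 0) \/
  exists k1 l1 k2 l2 x y1 y2,
    [/\ X2 X x y1, X2 X x y2, reg st rBV = nval k1 l1 k2 l2 x y1 y2,
        reg st rBD = den k1 l1 k2 l2 & reg st rMask = mask x].

Definition beats (st : state) (k1 l1 k2 l2 : nat) : Prop :=
  forall x y1 y2, X2 X x y1 -> X2 X x y2 ->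
    reg st rBV * den k1 l1 k2 l2 <= nval k1 l1 k2 l2 x y1 y2 * reg st rBD.

(** A part of the search that visits the quadruples in [S] ends with a value
    that beats these and still beats what it has beaten before. *)
Definition scanned (S : nat -> nat -> nat -> nat -> Prop) (st st' : state) :
    Prop :=
  [/\ best st', forall k1 l1 k2 l2, beats st k1 l1 k2 l2 -> beats st' k1 l1 k2 l2
    & forall k1 l1 k2 l2, S k1 l1 k2 l2 -> beats st' k1 l1 k2 l2].

Lemma best_eq st st' : reg st' rBV = reg st rBV -> reg st' rBD = reg st rBD ->
  reg st' rMask = reg st rMask -> best st -> best st'.
Proof. by rewrite /best => -> -> ->. Qed.

Lemma beats_eq st st' k1 l1 k2 l2 : reg st' rBV = reg st rBV ->
  reg st' rBD = reg st rBD -> beats st k1 l1 k2 l2 -> beats st' k1 l1 k2 l2.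
Proof. by rewrite /beats => -> ->. Qed.

Lemma best_den st : best st -> 0 <= reg st rBD <= 2 ^+ b + 2 ^+ b.
Proof.
case=> [[_ ->]|[k1 [l1 [k2 [l2 [x [y1 [y2 [_ _ _ -> _]]]]]]]]].
  by rewrite addr_ge0 ?exprn_ge0.
by have [] := mult_b v_b w_b k1 l1 k2 l2.
Qed.

Lemma small_2n : (`|2 ^+ n : int| <= 2 ^ B)%N.
Proof. by rewrite abszX leq_exp2l // ltnW. Qed.

Lemma wp_solver st (a b1 b2 : 'I_n -> int) : env st ->
  (forall i, 0 <= a i) -> (forall i, 0 <= b1 i) -> (forall i, 0 <= b2 i) ->
  holds aA a st -> holds aB1 b1 st -> holds aB2 b2 st ->
  wp B solver (fun st' => is_opt a b1 b2 X (reg st' rOut)) st.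
Proof.
move=> [hN hO _ _ _ _ _ _ _ _ hE] a0 b10 b20 ha hb1 hb2.
exact: (solver_ok (off := off) wf feas nB a0 b10 b20 hN hO hE ha hb1 hb2).
Qed.

Lemma prices_ge0 q1 p1 q2 p2 :
  [/\ forall i, 0 <= price_a cl v q1 p1 q2 p2 i,
      forall i, 0 <= price_b1 dl w q1 p1 q2 p2 i
    & forall i, 0 <= price_b2 dl w q1 p1 q2 p2 i].
Proof.
have [m1 m2 _] := mult_ge0 q1 p1 q2 p2.
have p0 (x : int) : 0 <= pos x by case: (posP x) => -[h ->].
by split=> i; rewrite ?addr_ge0 // mulr_ge0 // addr_ge0.
Qed.

Lemma wp_priced c (Q0 : state -> Prop) st k1 l1 k2 l2 (mu pe : int) :
  (k1 <= n)%N -> (l1 <= n)%N -> (k2 <= n)%N -> (l2 <= n)%N ->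
  env st -> tuple_regs G v w k1 l1 k2 l2 st ->
  reg st rMul = mu -> reg st rPert = pe -> 0 <= mu -> 0 <= pe ->
  (`|mu| <= 2 ^ B)%N -> (`|pe| <= 2 ^ B)%N ->
  (forall st', env st' -> tuple_regs G v w k1 l1 k2 l2 st' ->
    (forall r, r \in [:: rBV; rBD; rMask; rC; rVal] -> reg st' r = reg st r) ->
    is_opt (fun i => mu * price_a cl v (vk k1) (wk l1) (vk k2) (wk l2) i + pe * 2 ^+ i)
      (fun i => mu * price_b1 dl w (vk k1) (wk l1) (vk k2) (wk l2) i)
      (fun i => mu * price_b2 dl w (vk k1) (wk l1) (vk k2) (wk l2) i)
      X (reg st' rOut) -> wp B c Q0 st') ->
  wp B (CSeq cmd_prices (CSeq solver c)) Q0 st.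
Proof.
move=> hk1 hl1 hk2 hl2 he ht hmu hpe mu0 pe0 smu spe hQ.
have [pa pb1 pb2] := prices_ge0 (vk k1) (wk l1) (vk k2) (wk l2).
have P2 (i : 'I_n) : (0 : int) <= 2 ^+ i by apply: exprn_ge0.
apply: wp_seq; apply: wp_frame (wp_prices nB bB v_b w_b he ht hmu hpe smu spe) _ => st1 sm1 [h1 h2 h3].
have he1 : env st1 by apply: env_same sm1 _ _ he.
have ht1 : tuple_regs G v w k1 l1 k2 l2 st1 by apply: tuple_regs_same sm1 _ ht.
apply: wp_seq; apply: wp_frame (wp_solver he1 _ _ _ h1 h2 h3) _.
- by move=> i; rewrite addr_ge0 // mulr_ge0.
- by move=> i; rewrite mulr_ge0.
- by move=> i; rewrite mulr_ge0.
move=> st2 sm2 hopt; apply: hQ => //.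
- by apply: env_same sm2 _ _ he1; rewrite /= ?solver_regF ?solver_arrF.
- by apply: tuple_regs_same sm2 _ ht1; rewrite /= !solver_regF.
- move=> r; rewrite !inE => /or4P[/eqP->|/eqP->|/eqP->|/orP[]/eqP->];
  by rewrite (sameR sm2) ?solver_regF // (sameR sm1).
Qed.

(** If the optimal value for the plain prices is an improvement, its difference
    to the value for the perturbed prices is, by [perturbed_opt], the mask of a
    first-stage solution that attains it. *)
Lemma wp_eval st k1 l1 k2 l2 :
  (k1 <= n)%N -> (l1 <= n)%N -> (k2 <= n)%N -> (l2 <= n)%N ->
  env st -> tuple_regs G v w k1 l1 k2 l2 st -> best st ->
  wp B (cmd_eval solver) (scanned (fun i j i' j' =>
    [/\ i = k1, j = l1, i' = k2 & j' = l2]) st) st.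
Proof.
move=> hk1 hl1 hk2 hl2 he ht hb.
have [m1s m2s dens] := mult_b v_b w_b k1 l1 k2 l2.
have [_ _ den0] := mult_ge0 (vk k1) (wk l1) (vk k2) (wk l2).
have oneB : (`|1%R : int| <= 2 ^ B)%N by rewrite absz1 expn_gt0.
apply: wp_seq; apply: wp_asgn => //=; apply: wp_seq; apply: wp_asgn => //=.
set st1 := set_reg _ rPert 0.
have he1 : env st1 by case: he.
have ht1 : tuple_regs G v w k1 l1 k2 l2 st1 by case: ht.
apply: (@wp_priced _ _ st1 k1 l1 k2 l2 1 0) => // st2 he2 ht2 hr2.
have -> : (fun i => 1 * price_a cl v (vk k1) (wk l1) (vk k2) (wk l2) i + 0 * 2 ^+ i)
    = price_a cl v (vk k1) (wk l1) (vk k2) (wk l2).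
  by apply/funext => i; rewrite mul1r mul0r addr0.
have -> : (fun i => 1 * price_b1 dl w (vk k1) (wk l1) (vk k2) (wk l2) i)
    = price_b1 dl w (vk k1) (wk l1) (vk k2) (wk l2).
  by apply/funext => i; rewrite mul1r.
have -> : (fun i => 1 * price_b2 dl w (vk k1) (wk l1) (vk k2) (wk l2) i)
    = price_b2 dl w (vk k1) (wk l1) (vk k2) (wk l2).
  by apply/funext => i; rewrite mul1r.
move=> hopt.
have [rbv rbd rmask] : [/\ reg st2 rBV = reg st rBV, reg st2 rBD = reg st rBD
    & reg st2 rMask = reg st rMask].
  by rewrite !hr2.
have hb2 : best st2 by apply: best_eq hb.
have [_ [_ _ rk rden]] := ht2.
have Qs := small_abs bB Q_b.
have hQ2 : reg st2 rQ = Q by case: he2.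
have dB2 := small_abs2 bB (best_den hb2); have dB := small_abs2 bB dens.
apply: wp_seq; apply: wp_asgn => //=.
apply: wp_seq; apply: wp_asgn => //=; first by rewrite hQ2 Qs.
set m := reg st2 rOut in hopt *.
have [[x [y1 [y2 [Xy1 Xy2 xm]]]] lo] := is_opt_triple hopt.
set N := konst G (vk k1) (wk l1) (vk k2) (wk l2) + Q * m.
have valE : reg st2 rK + reg st2 rQ * m = N by rewrite rk hQ2.
have Nlo x' u1 u2 : X2 X x' u1 -> X2 X x' u2 -> N <= nval k1 l1 k2 l2 x' u1 u2.
  move=> h1 h2; rewrite /N /num_val lerD2l ler_wpM2l //; last exact: lo.
  by case/andP: Q_b.
apply: wp_if => /=.
- by rewrite rden dB dB2 !orbT.
- rewrite valE rden subr_gt0 => hlt.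
  apply: wp_seq; apply: wp_asgn => //=; apply: wp_seq; apply: wp_asgn => //=.
  apply: wp_seq; apply: wp_asgn => //=; apply: wp_seq; apply: wp_asgn => //=.
  set st3 := set_reg _ rPert 1.
  have hM : reg st2 rM = 2 ^+ n by case: he2.
  have he3 : env st3 by case: he2.
  have ht3 : tuple_regs G v w k1 l1 k2 l2 st3 by case: ht2.
  apply: (@wp_priced _ _ st3 k1 l1 k2 l2 (2 ^+ n) 1) => //.
    exact: small_2n.
  move=> st4 he4 ht4 hr4 hopt4.
  have hC4 : reg st4 rC = m by rewrite hr4.
  have hM4 : reg st4 rM = 2 ^+ n by case: he4.
  apply: wp_asgn => /=; first by rewrite hM4 small_2n.
  rewrite hC4 hM4; set st5 := set_reg _ rMask _.
  have bv5 : reg st5 rBV = N by rewrite /= hr4 //= valE.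
  have bd5 : reg st5 rBD = den k1 l1 k2 l2 by rewrite /= hr4 //= rden.
  have a4E : (fun i : 'I_n => 2 ^+ n * price_a cl v (vk k1) (wk l1) (vk k2) (wk l2) i
        + 1 * 2 ^+ i)
      = (fun i : 'I_n => 2 ^+ n * price_a cl v (vk k1) (wk l1) (vk k2) (wk l2) i
        + 2 ^+ i).
    by apply/funext => i; rewrite mul1r.
  rewrite a4E in hopt4.
  have [x' [u1 [u2 [Xu1 Xu2 x'm maskE]]]] := perturbed_opt hopt hopt4.
  split.
  + right; exists k1, l1, k2, l2, x', u1, u2; split=> //.
    by rewrite bv5 /N /num_val /triple_cost x'm.
  + move=> i j i' j' hbt x2 z1 z2 Xz1 Xz2; rewrite bv5 bd5.
    have := hbt x2 z1 z2 Xz1 Xz2; rewrite -rbv -rbd.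
    have [_ _ den0'] := mult_ge0 (vk i) (wk j) (vk i') (wk j').
    have /andP[bd0 _] := best_den hb2.
    exact: fraction_lt_trans den0 den0' bd0 hlt.
  + move=> _ _ _ _ [-> -> -> ->] x2 z1 z2 Xz1 Xz2; rewrite bv5 bd5.
    by rewrite ler_wpM2r //; [apply: ltW|apply: Nlo].
- rewrite valE rden subr_le0 => hle; apply: wp_skip; split.
  + by apply: best_eq hb2.
  + by move=> i j i' j'; apply: beats_eq.
  + move=> _ _ _ _ [-> -> -> ->] x2 z1 z2 Xz1 Xz2 /=.
    apply: le_trans hle _; apply: ler_wpM2r; last exact: Nlo.
    by have /andP[] := best_den hb2.
Qed.

(** The rule for one of the four nested loops.  [S i] are the quadruples that
    the body visits when the counter has the value [i]. *)
Lemma wp_scan r l c st (S : nat -> nat -> nat -> nat -> nat -> Prop) :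
  r \notin [:: rBV; rBD; rMask] -> l \notin [:: rBV; rBD; rMask] ->
  reg st rN = n%:Z -> best st ->
  (forall i s, (i <= n)%N -> reg s r = i%:Z ->
     same [:: r, l & mregs c] (marrs c) st s -> best s ->
     wp B c (scanned (S i) s) s) ->
  wp B (cmd_upto r l c)
    (scanned (fun k1 l1 k2 l2 => exists2 i, (i <= n)%N & S i k1 l1 k2 l2) st) st.
Proof.
move=> hr hl hN hb hbody.
have set3 x s y : x \notin [:: rBV; rBD; rMask] ->
    [/\ reg (set_reg s x y) rBV = reg s rBV, reg (set_reg s x y) rBD = reg s rBD
      & reg (set_reg s x y) rMask = reg s rMask].
  rewrite !inE !negb_or ![x == _]eq_sym => /and3P[/negbTE e1 /negbTE e2 /negbTE e3].
  by rewrite /set_reg /= e1 e2 e3.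
pose Inv k s := scanned (fun k1 l1 k2 l2 =>
  exists2 i, (i < k)%N & S i k1 l1 k2 l2) st s.
apply: (wp_for (k := n.+1) (Inv := Inv)) => //=.
- by rewrite hN; lia.
- have [e1 e2 e3] := set3 l st n.+1%:Z hl.
  have [e4 e5 e6] := set3 r (set_reg st l n.+1%:Z) 0 hr.
  split; last by move=> k1 l1 k2 l2 [].
    by apply: best_eq hb; rewrite ?e4 ?e5 ?e6.
  by move=> k1 l1 k2 l2; apply: beats_eq; rewrite ?e4 ?e5.
- move=> i s iN ri sm [hb1 hm1 hs1].
  apply: wp_mono (hbody i s iN ri sm hb1) => s' [hb2 hm2 hs2].
  have [e1 e2 e3] := set3 r s' i.+1%:Z hr.
  split; first by apply: best_eq hb2.
    by move=> k1 l1 k2 l2 h; apply: beats_eq (hm2 _ _ _ _ (hm1 _ _ _ _ h)).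
  move=> k1 l1 k2 l2 [j]; rewrite ltnS leq_eqVlt => /orP[/eqP->|ji] h.
    by apply: beats_eq (hs2 _ _ _ _ h).
  by apply: beats_eq (hm2 _ _ _ _ (hs1 _ _ _ _ _)) => //; exists j.
Qed.

Lemma scanned_sub (S S' : nat -> nat -> nat -> nat -> Prop) st st' :
  (forall k1 l1 k2 l2, S' k1 l1 k2 l2 -> S k1 l1 k2 l2) ->
  scanned S st st' -> scanned S' st st'.
Proof. by move=> hS [h1 h2 h3]; split=> // k1 l1 k2 l2 /hS; apply: h3. Qed.

(** What the search modifies at a nesting level whose loop counters are numbered
    from [lo].  The registers from 7 to 12 hold the best value so far and serve
    to communicate with the solver, those from 40 to 87 are the private registers
    of the solver and the counters of the preprocessing loops. *)
Definition search_reg (lo r : nat) : bool := [|| 7 <= r < 13, 40 <= r < 88 | lo <= r]%N.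

Lemma body_regs : all (search_reg 96) (mregs (CSeq cmd_setup (cmd_eval solver))) /\
  all (leq 8) (marrs (CSeq cmd_setup (cmd_eval solver))).
Proof.
have /and3P[_ hr ha] := solver_local.
have {}hr : all (search_reg 96) (mregs solver).
  by apply: sub_all hr => r /orP[/eqP->//|/andP[h1 h2]]; rewrite /search_reg h1 ltnW ?orbT //; lia.
have {}ha : all (leq 8) (marrs solver) by apply: sub_all ha => r; lia.
split.
  have -> : mregs (CSeq cmd_setup (cmd_eval solver)) = mregs cmd_setup ++
    [:: rMul, rPert & mregs cmd_prices ++ mregs solver ++ [:: rC, rVal &
       ([:: rBV; rBD; rMul; rPert] ++ mregs cmd_prices ++ mregs solver ++ [:: rMask]) ++ [::]]].
    by [].
  by rewrite !all_cat /= !all_cat /= !all_cat hr /=.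
have -> : marrs (CSeq cmd_setup (cmd_eval solver)) = marrs cmd_prices ++ marrs solver
    ++ (marrs cmd_prices ++ marrs solver ++ [::]) ++ [::] by [].
by rewrite !all_cat ha.
Qed.

Lemma upto_regs lo r l c : all (search_reg lo.+2) (mregs c) /\ all (leq 8) (marrs c) ->
  r = lo -> l = lo.+1 ->
  all (search_reg lo) (mregs (cmd_upto r l c)) /\ all (leq 8) (marrs (cmd_upto r l c)).
Proof.
move=> [h1 h2] -> ->; split=> //=; rewrite /search_reg leqnn leqnSn !orbT /=.
by apply: sub_all h1 => x; rewrite /search_reg => /or3P[->|->|h]; rewrite ?orbT //;
  apply/or3P; apply: Or33; lia.
Qed.

Lemma search4_regs : all (search_reg 94) (mregs (cmd_search4 solver)) /\
  all (leq 8) (marrs (cmd_search4 solver)).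
Proof. by apply: upto_regs => //; exact: body_regs. Qed.

Lemma search3_regs : all (search_reg 92) (mregs (cmd_search3 solver)) /\
  all (leq 8) (marrs (cmd_search3 solver)).
Proof. by apply: upto_regs => //; exact: search4_regs. Qed.

Lemma search2_regs : all (search_reg 90) (mregs (cmd_search2 solver)) /\
  all (leq 8) (marrs (cmd_search2 solver)).
Proof. by apply: upto_regs => //; exact: search3_regs. Qed.

Lemma search_frame lo r l c st st' : all (search_reg lo.+2) (mregs c) /\ all (leq 8) (marrs c) ->
  (88 <= lo)%N -> r = lo -> l = lo.+1 ->
  same [:: r, l & mregs c] (marrs c) st st' ->
  (env st -> env st') /\ (forall x, (88 <= x < lo)%N -> reg st' x = reg st x).
Proof.
move=> hc hlo er el sm; have [/allP h1 /allP h2] := upto_regs hc er el.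
split=> [|x hx].
  apply: env_same sm _ _; apply/allP => x hx; apply/negP.
    by move/h1; move: hx; rewrite !inE /search_reg; lia.
  by move/h2; move: hx; rewrite !inE; lia.
by apply: (sameR sm); apply/negP => /h1; rewrite /search_reg; lia.
Qed.

Lemma wp_search4 st k1 l1 k2 : (k1 <= n)%N -> (l1 <= n)%N -> (k2 <= n)%N ->
  env st -> best st ->
  reg st rK1 = k1%:Z -> reg st rL1 = l1%:Z -> reg st rK2 = k2%:Z ->
  wp B (cmd_search4 solver) (scanned (fun i j i' j' =>
    [/\ i = k1, j = l1, i' = k2 & (j' <= n)%N]) st) st.
Proof.
move=> hk1 hl1 hk2 he hb r1 r2 r3.
pose S (l2 i j i' j' : nat) := [/\ i = k1, j = l1, i' = k2 & j' = l2].
apply: (wp_mono (Q := scanned (fun i j i' j' => exists2 q, (q <= n)%N & S q i j i' j') st));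
  last (apply: (wp_scan (S := S) _ _ (env_N he) hb _) => //).
  by move=> s; apply: scanned_sub => i j i' j' [-> -> -> hj]; exists j'.
move=> l2 s hl2 r4 sm hbs.
have [/(_ he) hes hr] := search_frame body_regs (erefl : 88 <= 94)%N erefl erefl sm.
rewrite -(hr rK1) // in r1; rewrite -(hr rL1) // in r2; rewrite -(hr rK2) // in r3.
apply: wp_seq.
apply: wp_frame (wp_setup bB v_b w_b G_b hk1 hl1 hk2 hl2 hes r1 r2 r3 r4) _.
move=> s5 sm5 ht5.
have he5 : env s5 by apply: env_same sm5 _ _ hes.
have hb5 : best s5 by apply: best_eq hbs; rewrite (sameR sm5).
apply: wp_mono (wp_eval hk1 hl1 hk2 hl2 he5 ht5 hb5) => s6 [hb6 hm6 hs6].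
split=> // i j i' j' hbt; apply: hm6; apply: beats_eq hbt; by rewrite (sameR sm5).
Qed.

Lemma wp_search3 st k1 l1 : (k1 <= n)%N -> (l1 <= n)%N ->
  env st -> best st -> reg st rK1 = k1%:Z -> reg st rL1 = l1%:Z ->
  wp B (cmd_search3 solver) (scanned (fun i j i' j' =>
    [/\ i = k1, j = l1, (i' <= n)%N & (j' <= n)%N]) st) st.
Proof.
move=> hk1 hl1 he hb r1 r2.
pose S (k2 i j i' j' : nat) := [/\ i = k1, j = l1, i' = k2 & (j' <= n)%N].
apply: (wp_mono (Q := scanned (fun i j i' j' => exists2 q, (q <= n)%N & S q i j i' j') st));
  last (apply: (wp_scan (S := S) _ _ (env_N he) hb _) => //).
  by move=> s; apply: scanned_sub => i j i' j' [-> -> hi hj]; exists i'.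
move=> k2 s hk2 r3 sm hbs.
have [/(_ he) hes hr] := search_frame search4_regs (erefl : 88 <= 92)%N erefl erefl sm.
by apply: wp_search4; rewrite // hr.
Qed.

Lemma wp_search2 st k1 : (k1 <= n)%N -> env st -> best st -> reg st rK1 = k1%:Z ->
  wp B (cmd_search2 solver) (scanned (fun i j i' j' =>
    [/\ i = k1, (j <= n)%N, (i' <= n)%N & (j' <= n)%N]) st) st.
Proof.
move=> hk1 he hb r1.
pose S (l1 i j i' j' : nat) := [/\ i = k1, j = l1, (i' <= n)%N & (j' <= n)%N].
apply: (wp_mono (Q := scanned (fun i j i' j' => exists2 q, (q <= n)%N & S q i j i' j') st));
  last (apply: (wp_scan (S := S) _ _ (env_N he) hb _) => //).
  by move=> s; apply: scanned_sub => i j i' j' [-> hj hi' hj']; exists j.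
move=> l1 s hl1 r2 sm hbs.
have [/(_ he) hes hr] := search_frame search3_regs (erefl : 88 <= 90)%N erefl erefl sm.
by apply: wp_search3; rewrite // hr.
Qed.

Lemma wp_search st : env st -> best st ->
  wp B (cmd_search solver) (fun st' => [/\ env st', best st' &
    forall k1 l1 k2 l2, (k1 <= n)%N -> (l1 <= n)%N -> (k2 <= n)%N -> (l2 <= n)%N ->
      beats st' k1 l1 k2 l2]) st.
Proof.
move=> he hb.
pose S (k1 i j i' j' : nat) := [/\ i = k1, (j <= n)%N, (i' <= n)%N & (j' <= n)%N].
apply: (wp_frame (wp_scan (S := S) _ _ (env_N he) hb _)) => //.
  move=> k1 s hk1 r1 sm hbs.
  have [/(_ he) hes hr] := search_frame search2_regs (erefl : 88 <= 88)%N erefl erefl sm.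
  exact: wp_search2.
move=> s sm [hbs _ hs].
have [/(_ he) hes _] := search_frame search2_regs (erefl : 88 <= 88)%N erefl erefl sm.
by split=> // k1 l1 k2 l2 h1 h2 h3 h4; apply: hs; exists k1.
Qed.

End Search.

(** * Output *)

(** The binary digits of the solution are extracted from the mask beginning with
    the most significant one, by comparison with the stored powers of two.  The
    value carries the factor [Q] twice, as its constant term is a product of a
    budget and a price. *)
Definition cmd_output : cmd :=
  CSeq (CPut 1 (Const 0) (Const 1)) (CSeq (CPut 1 (Const 1) (Reg rBV))
  (CSeq (CPut 1 (Const 2) (Mul (Reg rQ) (Mul (Reg rQ) (Reg rBD))))
  (CSeq (CFor rI 87 (Reg rN)
    (CSeq (CAsgn rT (Sub (Sub (Reg rN) (Const 1)) (Reg rI)))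
      (CIf (Sub (Add (Reg rMask) (Const 1)) (Get aP (Reg rT)))
        (CSeq (CPut 1 (Add (Const 3) (Reg rT)) (Const 1))
          (CAsgn rMask (Sub (Reg rMask) (Get aP (Reg rT)))))
        (CPut 1 (Add (Const 3) (Reg rT)) (Const 0)))))
    (CAsgn 1 (Add (Const 3) (Reg rN)))))).

Section Output.
Variables (n B off : nat) (Q G : int) (enc : seq int) (cl v dl w : 'I_n -> int).
Hypothesis nB : (n < B)%N.
Hypothesis QB : (`|Q| <= 2 ^ B)%N.

Definition low_bits (x : bvec n) (k : nat) : int :=
  \sum_(j < k) 2 ^+ j * (ext false x j : nat)%:Z.

Lemma low_bitsS x k : low_bits x k.+1 = low_bits x k + 2 ^+ k * (ext false x k : nat)%:Z.
Proof. by rewrite /low_bits big_ord_recr. Qed.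

Lemma low_bits_lt x k : 0 <= low_bits x k < 2 ^+ k.
Proof.
elim: k => [|k /andP[h1 h2]]; first by rewrite /low_bits big_ord0 expr0.
rewrite low_bitsS exprS; have : (0 : int) < 2 ^+ k by rewrite exprn_gt0.
by move: (2 ^+ k) h2 => M h2 M0; case: (ext _ _ _) => /=; apply/andP; lia.
Qed.

Lemma wp_output st x N d : @env n off Q enc G cl v dl w st ->
  reg st rBV = N -> reg st rBD = d -> reg st rMask = mask x ->
  wp B cmd_output (fun st' => output st' =
    [:: 1, N, Q * (Q * d) & [seq (x i : nat)%:Z | i <- enum 'I_n]]) st.
Proof.
move=> he hbv hbd hm; have [hN _ hQ _ _ _ _ _ _ hP _] := he.
apply: wp_seq; apply: wp_put => //=.
apply: wp_seq; apply: wp_put => //=.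
apply: wp_seq; apply: wp_put => //=; first by rewrite hQ QB.
set st1 := set_arr _ 1 2 _.
pose Inv k s := [/\ reg s rMask = low_bits x (n - k),
  [/\ arr s 1%N 0 = 1, arr s 1%N 1 = N & arr s 1%N 2 = Q * (Q * d)] &
  forall j, (n - k <= j < n)%N -> arr s 1%N (3 + j)%:Z = (ext false x j : nat)%:Z].
apply: wp_seq; apply: (wp_for (k := n) (Inv := Inv)) => //; first exact: ltnW.
- rewrite /Inv /= subn0 hbv hbd hQ hm; split=> //; last by move=> j; lia.
  by apply: eq_bigr => i _; rewrite extE.
- move=> k s kn rk sm [i1 [i2 i3 i4] i5].
  have hNs : reg s rN = n%:Z by rewrite (sameR sm).
  pose t := (n - k.+1)%N; have tE : (n - k)%N = t.+1 by rewrite /t; lia.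
  have tn : (t < n)%N by rewrite /t; lia.
  have hPs : arr s aP t%:Z = 2 ^+ t by rewrite (sameA _ sm) //; exact: (hP (Ordinal tn)).
  apply: wp_seq; apply: wp_asgn => //=; rewrite rk hNs.
  have -> : n%:Z - 1 - k%:Z = t%:Z by rewrite /t; lia.
  have /andP[l0 l1] := low_bits_lt x t.
  rewrite tE low_bitsS in i1.
  have [e1 e2 e3] : [/\ (0 == 3 + t%:Z) = false, (1 == 3 + t%:Z) = false
      & (2%:Z == 3 + t%:Z) = false] by split; apply/negbTE; lia.
  have bits y j : (t <= j < n)%N -> y = (ext false x t : nat)%:Z ->
      (if (3 + j)%:Z == 3 + t%:Z then y else arr s 1%N (3 + j)%:Z)
        = (ext false x j : nat)%:Z.
    move=> /andP[tj jn] ->; case: eqP => [jt|jt].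
      by have -> : j = t by lia.
    by apply: i5; rewrite tE jn andbT; lia.
  apply: wp_if => //=; rewrite hPs i1 => h.
    have bit : ext false x t by move: h; case: (ext _ _ _) => //=; lia.
    apply: wp_seq; apply: wp_put => //=; apply: wp_asgn => //=.
    rewrite hPs i1 bit; split=> /=; rewrite -/t ?e1 ?e2 ?e3 //.
      by rewrite mulr1 addrK.
    by move=> j hj; apply: bits; rewrite ?bit.
  have /negbTE bit : ~~ ext false x t.
    by apply/negP => b; move: h; rewrite b; lia.
  apply: wp_put => //=; split=> /=; rewrite -/t ?e1 ?e2 ?e3 //.
    by rewrite i1 bit mulr0 addr0.
  by move=> j hj; apply: bits; rewrite ?bit.
- move=> s sm [_ [i2 i3 i4] i5].
  have hNs : reg s rN = n%:Z by rewrite (sameR sm).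
  apply: wp_asgn => //=; rewrite /output /= hNs.
  have -> : absz (3 + n%:Z) = (3 + n)%N by [].
  rewrite iotaD map_cat /= i2 i3 i4; congr [:: _, _, _ & _].
  transitivity [seq (ext false x j : nat)%:Z | j <- map val (enum 'I_n)]; last first.
    by rewrite -map_comp; apply: eq_map => i /=; rewrite extE.
  rewrite val_enum_ord (iotaDl 3 0 n : iota 3 n = _) -map_comp.
  apply/eq_in_map => j; rewrite mem_iota /= add0n => jn.
  by rewrite i5 // subnn.
Qed.

End Output.

(** * Polynomial-time solvability *)

Definition cmd_main (solver : cmd) : cmd :=
  CSeq cmd_scale (CSeq cmd_derive (CSeq (cmd_search solver) cmd_output)).

(** The numbers in the main program have at most about the square of the input
    length many bits: the product of all denominators dominates. *)
Definition size_bound (s : nat) : nat := (s + s * s).+2.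

Lemma bitlen_gt (z : int) : (`|z| <= 2 ^ bitlen z)%N.
Proof.
apply: ltnW; apply: leq_trans (trunc_log_ltn `|z| (isT : (1 < 2)%N)) _.
by rewrite leq_exp2l.
Qed.

Lemma input_size_ge (w : seq int) : (size w <= input_size w)%N.
Proof.
rewrite /input_size; elim: w => [|z w IH] //=.
by rewrite big_cons -add1n; apply: leq_add.
Qed.

Lemma entry_small (w : seq int) k : (`|(w`_k)%R| <= 2 ^ input_size w)%N.
Proof.
rewrite /input_size; elim: w k => [|z w IH] [|k]; rewrite ?nth_nil ?absz0 ?expn_gt0 //.
  by rewrite big_cons /=; apply: leq_pow2 (bitlen_gt z) _; rewrite leq_addr.
by rewrite big_cons /=; apply: leq_pow2 (IH k) _; rewrite leq_addl.
Qed.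

Definition data_list n (D : budget_data rat n) : seq rat :=
  Gam D :: flatten [seq [:: c_lo D 0 i; c_hi D 0 i; d_lo D 0 i; d_hi D 0 i]
                   | i <- enum 'I_n].

Lemma enc_budgetE n (D : budget_data rat n) :
  enc_budget D = flatten [seq enc_rat q | q <- data_list D].
Proof.
rewrite /enc_budget /data_list /=; congr [:: _, _ & _].
by elim: (enum 'I_n) => //= i s ->.
Qed.

Lemma size_flatten_pairs (l : seq rat) :
  size (flatten [seq enc_rat q | q <- l]) = (size l + size l)%N.
Proof. by elim: l => //= q l ->; lia. Qed.

Lemma nth_pairs (l : seq rat) (r : seq int) j : (j < size l)%N ->
  nth 0 (flatten [seq enc_rat q | q <- l] ++ r) (j + j) = numq (nth 0 l j) /\
  nth 0 (flatten [seq enc_rat q | q <- l] ++ r) (j + j).+1 = denq (nth 0 l j).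
Proof. by elim: l j => //= q l IH [|j] //= hj; rewrite addnS /=; apply: IH. Qed.

Lemma size_data_list n (D : budget_data rat n) : size (data_list D) = (4 * n).+1.
Proof.
rewrite /= -[in RHS](size_enum_ord n); congr _.+1.
by elim: (enum 'I_n) => //= i s ->; lia.
Qed.

Lemma nth_data_list n (D : budget_data rat n) (i : 'I_n) :
  [/\ nth 0 (data_list D) (1 + 4 * i) = c_lo D 0 i,
      nth 0 (data_list D) (2 + 4 * i) = c_hi D 0 i,
      nth 0 (data_list D) (3 + 4 * i) = d_lo D 0 i
    & nth 0 (data_list D) (4 + 4 * i) = d_hi D 0 i].
Proof.
have main (s : seq 'I_n) (j : nat) : (j < size s)%N ->
    let l := flatten [seq [:: c_lo D 0 i; c_hi D 0 i; d_lo D 0 i; d_hi D 0 i] | i <- s] in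
    [/\ nth 0 l (4 * j) = c_lo D 0 (nth i s j),
        nth 0 l (4 * j).+1 = c_hi D 0 (nth i s j),
        nth 0 l (4 * j).+2 = d_lo D 0 (nth i s j)
      & nth 0 l (4 * j).+3 = d_hi D 0 (nth i s j)].
  elim: s j => // i' s IH [|j] // hj.
  by have -> : (4 * j.+1 = (4 * j).+4)%N; [rewrite mulnS|exact: IH].
have [|h1 h2 h3 h4] := main (enum 'I_n) i; first by rewrite size_enum_ord.
rewrite nth_ord_enum in h1 h2 h3 h4; split; [exact: h1|exact: h2|exact: h3|exact: h4].
Qed.

Section Main.
Variables (R : realType) (P : nominal) (solver : cmd).
Hypothesis solver_ok : solves P solver.
Hypothesis solver_local : local solver.

(** After scaling, all data have at most [b] bits, as the product of the
    denominators has at most the square of the input length many.  The search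
    then ends with a fraction as required by [optimal_fraction]; it cannot end
    with the initial 1 / 0, which does not beat a feasible solution. *)
Lemma wp_main (I : rob_inst P) st : rob_wf I ->
  (exists z, nom_feas (rob_nom I) z) ->
  (forall k : nat, arr st 0 k%:Z = nth 0 (rob_enc I) k) ->
  wp (size_bound (input_size (rob_enc I))) (cmd_main solver)
    (fun st' => @rob_sol R P I (output st')) st.
Proof.
case: I => n nom D [/= wfn wfD] feas; set w := rob_enc _; set s := input_size w.
set B := size_bound s; move=> hin.
pose m := (4 * n).+1; pose b := (s + s * s)%N.
pose qs := nth 0 (data_list D).
have [F [wE szF nF]] : exists F, [/\ w = n%:Z :: F ++ nom_enc nom, size F = (m + m)%N
    & forall j, (j < m)%N -> nth 0 (F ++ nom_enc nom) (j + j) = numq (qs j) /\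
        nth 0 (F ++ nom_enc nom) (j + j).+1 = denq (qs j)].
  exists (flatten [seq enc_rat q | q <- data_list D]); split.
  - by rewrite /w /rob_enc enc_budgetE.
  - by rewrite size_flatten_pairs size_data_list.
  - by rewrite /m -(size_data_list D) => j; apply: nth_pairs.
have ms : (m <= s)%N.
  by apply: leq_trans (input_size_ge w); rewrite wE /= size_cat szF; lia.
have sB : (s <= B)%N by rewrite /B /size_bound; lia.
have bB : (b < B)%N by rewrite /B /size_bound /b.
have nB : (n < B)%N by move: ms; rewrite /m; lia.
have small k : (`|(w`_k)%R| <= 2 ^ s)%N by exact: entry_small.
have smallB k : (`|(w`_k)%R| <= 2 ^ B)%N by apply: leq_pow2 sB.
have wnum j : (j < m)%N -> nth 0 w (1 + (j + j)) = numq (qs j).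
  by rewrite wE => /nF[].
have wden j : (j < m)%N -> nth 0 w (2 + (j + j)) = denq (qs j).
  by rewrite wE => /nF[].
have w0 : nth 0 w 0 = n%:Z by rewrite wE.
have mB : (m <= B)%N by apply: leq_trans sB.
pose off := (1 + (m + m))%N.
have wenc k : nth 0 w (off + k) = nth 0 (nom_enc nom) k.
  by rewrite wE /off -addnA add1n /= nth_cat szF ltnNge leq_addr addKn.
apply: wp_seq; apply: wp_frame (wp_scale mB smallB w0 wnum wden hin) _.
move=> st1 sm1 [hN1 hO1 hQ1 hZ1].
pose Q := den_prod qs m; pose Z (l : nat) := arr st1 aZ l%:Z.
have ZE l : (l < m)%N -> (Z l)%:~R = qs l * Q%:~R by apply: hZ1.
have Q0 : 0 < Q by exact: den_prod_gt0.
have Qle : (`|Q| <= 2 ^ (s * s))%N.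
  apply: leq_pow2 (den_prod_le wden (leqnn _) small) _.
  by rewrite leq_mul2l ms orbT.
have Zle l : (l < m)%N -> (`|Z l| <= 2 ^ b)%N.
  move=> lm; have e : Z l * denq (qs l) = numq (qs l) * Q.
    by apply: (@intr_inj rat); rewrite !intrM ZE // numqE mulrAC.
  rewrite /b expnD; apply: leq_trans (_ : `|Z l| * `|denq (qs l)| <= _)%N.
    by rewrite leq_pmulr // absz_gt0 denq_neq0.
  by rewrite -abszM e abszM; apply: leq_mul => //; rewrite -wnum.
have le_b (z : int) : (`|z| <= 2 ^ b)%N -> z <= 2 ^+ b.
  move=> h; apply: le_trans (ler_norm z) _.
  by rewrite -abszE -[2 ^+ b]natrX natz lez_nat.
have im (i : 'I_n) c : (c <= 4)%N -> (c + 4 * i < m)%N.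
  by move=> hc; have := ltn_ord i; rewrite /m; lia.
have clE i : (zcl Z i)%:~R = c_lo D 0 i * Q%:~R.
  by rewrite ZE ?im // /qs; have [-> _ _ _] := nth_data_list D i.
have vE i : (zv Z i)%:~R = (c_hi D 0 i - c_lo D 0 i) * Q%:~R.
  rewrite intrB !ZE ?im // mulrBl /qs.
  by have [-> -> _ _] := nth_data_list D i.
have dlE i : (zdl Z i)%:~R = d_lo D 0 i * Q%:~R.
  by rewrite ZE ?im // /qs; have [_ _ -> _] := nth_data_list D i.
have wiE i : (zw Z i)%:~R = (d_hi D 0 i - d_lo D 0 i) * Q%:~R.
  rewrite intrB !ZE ?im // mulrBl /qs.
  by have [_ _ -> ->] := nth_data_list D i.
have GE : (Z 0%N)%:~R = Gam D * Q%:~R by rewrite ZE.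
have cl0 := cl_ge0 Q0 clE wfD; have dl0 := dl_ge0 Q0 dlE wfD.
have v0 := v_ge0 Q0 vE wfD; have wi0 := w_ge0 Q0 wiE wfD.
have v_b (i : 'I_n) : 0 <= zv Z i <= 2 ^+ b.
  rewrite v0 /= /zv; apply: le_trans (le_b _ (Zle _ (im i 2%N isT))).
  by rewrite gerBl; exact: cl0.
have w_b (i : 'I_n) : 0 <= zw Z i <= 2 ^+ b.
  rewrite wi0 /= /zw; apply: le_trans (le_b _ (Zle _ (im i 4%N isT))).
  by rewrite gerBl; exact: dl0.
have Q_b : 0 <= Q <= 2 ^+ b.
  by rewrite ltW //= le_b // (leq_pow2 Qle) // /b leq_addl.
have G_b : 0 <= Z 0%N <= 2 ^+ b.
  rewrite le_b ?Zle // andbT -(ler0z rat) GE mulr_ge0 ?ler0z ?(ltW Q0) //.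
  by case: wfD.
apply: wp_seq.
have hE1 k : arr st1 0 (off + k)%:Z = nth 0 (nom_enc nom) k.
  by rewrite (sameA _ sm1) // hin.
apply: wp_mono (wp_derive (Z := Z) nB hN1 hO1 hQ1 (fun l _ => erefl) hE1).
move=> st2 [he2 hbv2 hbd2]; apply: wp_seq.
have hb2 : best nom Q (Z 0%N) (zcl Z) (zv Z) (zdl Z) (zw Z) st2 by left.
apply: wp_mono (wp_search solver_ok solver_local wfn feas nB bB v_b w_b G_b Q_b
   cl0 dl0 he2 hb2) => st3 [he3 hb3 hall].
have [x0 [y0 Xy0]] : exists x y, X2 (nom_feas nom) x y.
  have [z Xz] := feas; exists z, [ffun=> false]; split=> [i|].
    by rewrite ffunE; case: (z i).
  by exists z => // i; rewrite ffunE addn0.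
case: hb3 => [[bv3 bd3]|[k1 [l1 [k2 [l2 [x [y1 [y2 [Xy1 Xy2 bv3 bd3 hm]]]]]]]]].
  have := hall 0%N 0%N 0%N 0%N isT isT isT isT x0 y0 y0 Xy0 Xy0.
  rewrite bv3 bd3 mulr0 mul1r.
  move=> h; have den0 q1 p1 q2 p2 : 0 < denom q1 p1 q2 p2 by case: (mult_ge0 q1 p1 q2 p2).
  by have := lt_le_trans (den0 _ _ _ _) h; rewrite ltxx.
have QB : (`|Q| <= 2 ^ B)%N by apply: leq_pow2 Qle _; rewrite /B /size_bound; lia.
apply: wp_mono (wp_output nB QB he3 erefl erefl hm) => st4 ->.
right; exists (reg st3 rBV), (Q * (Q * reg st3 rBD)), x.
have hall' i j i' j' x' z1 z2 : (i <= n)%N -> (j <= n)%N -> (i' <= n)%N -> (j' <= n)%N ->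
    X2 (nom_feas nom) x' z1 -> X2 (nom_feas nom) x' z2 -> _ :=
  fun hi hj hi' hj' => hall i j i' j' hi hj hi' hj' x' z1 z2.
have [] // := optimal_fraction (X := nom_feas nom) R Q0 clE vE dlE wiE GE wfD
  (N := reg st3 rBV) (d := reg st3 rBD) (x := x) _ hall'.
by exists k1, l1, k2, l2, y1, y2.
Qed.

End Main.

Lemma init_bounded (w : seq int) B : (input_size w <= B)%N -> bounded B (init w).
Proof.
move=> hB; split=> [r|a i] /=.
  case: ifP => // _; rewrite absz_nat; apply: leq_trans (input_size_ge w) _.
  by apply: leq_trans hB _; apply: ltnW; exact: ltn_expl.
by case: ifP => // _; apply: leq_pow2 (entry_small w _) hB.
Qed.

Lemma poly_time_of_wp (R : realType) (P : nominal) (c : cmd) : wfc c ->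
  (forall I : rob_inst P, rob_wf I ->
     wp (size_bound (input_size (rob_enc I))) c
       (fun st' => @rob_sol R P I (output st')) (init (rob_enc I))) ->
  rob_poly_time R P.
Proof.
move=> hwf hwp; have [C [k hk]] := wp_poly_time hwf.
exists (compile c), (C * 4 ^ k)%N, (2 * k)%N => I wfI.
set s := input_size _.
have hb : bounded (size_bound s) (init (rob_enc I)).
  by apply: init_bounded; rewrite /size_bound -/s; lia.
have [t [st' [hex hs ht]]] := hk _ _ _ (hwp I wfI) hb.
exists t, st'; split=> //; apply: leq_trans ht _.
rewrite -mulnA leq_mul2l; apply/orP; right.
rewrite expnM -expnMn; apply: (@leq_trans ((4 * s.+1 ^ 2) ^ k)) => //.
by case: (k) => // k'; rewrite leq_exp2r // /size_bound expnS expn1; nia.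
Qed.

(** * The three problems *)

Lemma init_input (w : seq int) (k : nat) : arr (init w) 0 k%:Z = nth 0 w k.
Proof. by []. Qed.

(** Where a least cost is attained, there are solutions. *)
Lemma rep_feasible n (J : rep_inst n) : @nom_wf rep_selection n J ->
  exists z, @nom_feas rep_selection n J z.
Proof.
move=> wf; have [e|l0] := posnP (ell J).
  by have [[z [_ [Xz _ _]]] _] := rep_empty (fun=> 0) (fun=> 0) (fun=> 0) e; exists z.
by have [X _ [[z [_ [Xz _ _]]] _]] := rep_label (fun=> 0) (fun=> 0) (fun=> 0) l0 wf;
  exists z.
Qed.

Lemma path_feasible n (G : graph_inst n) : series_parallel G ->
  exists z, st_paths G z.
Proof.
move=> wf.
by have [X _ [[z [_ [Xz _ _]]] _]] :=
  series_parallel_label (fun=> 0) (fun=> 0) (fun=> 0) wf; exists z.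
Qed.

Lemma rep_poly (R : realType) : rob_poly_time R rep_selection.
Proof.
apply: (@poly_time_of_wp _ _ (cmd_main rep_solver)) => // I [wf wfD].
by apply: wp_main => //; [exact: rep_solver_ok|exact: rep_feasible].
Qed.

Lemma path_poly (R : realType) : rob_poly_time R sp_shortest_path.
Proof.
apply: (@poly_time_of_wp _ _ (cmd_main graph_solver)) => // I [wf wfD].
by apply: wp_main => //; [exact: graph_solver_ok|exact: path_feasible].
Qed.

Lemma Rob_infeasible (R : realType) n (D : budget_data R n) (X : set (bvec n)) :
  budget_wf D -> (forall z, ~ X z) -> Rob D X = +oo%E.
Proof.
move=> wf hX; apply: eq_infty => M; apply: le_ereal_inf_tmp => _ [x _ <-].
by apply: rob_value_ge => // q1 p1 q2 p2 y1 y2 _ _ _ _ [_ [z /hX]].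
Qed.

(** The selection problem is the only one of the three that can be
    infeasible. *)
Definition cmd_selection : cmd :=
  CSeq (CAsgn rN (Get 0 (Const 0)))
  (CSeq (CAsgn rT (Get 0 (Add (Const 3) (twice (twice (twice (Reg rN)))))))
    (CIf (Sub (Reg rT) (Reg rN))
      (CSeq (CPut 1 (Const 0) (Const 0)) (CAsgn 1 (Const 1)))
      (cmd_main sel_solver))).

Lemma card_below n p : (p <= n)%N -> (\sum_(i < n) (i < p)%N = p)%N.
Proof.
move=> pn; rewrite -(big_mkord xpredT (fun i => (i < p)%N : nat)).
rewrite (big_cat_nat (n := p)) //= (eq_big_nat _ _ (F2 := fun=> 1%N)); last first.
  by move=> i /andP[_ ->].
rewrite sum_nat_const_nat subn0 muln1 big_nat_cond big1 ?addn0 // => i.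
by rewrite andbT => /andP[h _]; rewrite ltnNge h.
Qed.

Lemma selection_input n (p : nat) (D : budget_data rat n) :
  nth 0 (rob_enc (@RobInst selection n p D)) (8 * n + 3) = p%:Z.
Proof.
rewrite /rob_enc enc_budgetE; set F := flatten _.
have szF : size F = (8 * n + 2)%N by rewrite size_flatten_pairs size_data_list /=; lia.
clearbody F.
have -> : (8 * n + 3 = (size F).+1)%N by lia.
by rewrite /= nth_cat ltnn subnn.
Qed.

Lemma sel_poly (R : realType) : rob_poly_time R selection.
Proof.
apply: (@poly_time_of_wp _ _ cmd_selection) => // -[n p D] [wf wfD].
set w := rob_enc _; set B := size_bound _.
have w0 : nth 0 w 0 = n%:Z by [].
have wp' := selection_input p D; rewrite -/w in wp'.
apply: wp_seq; apply: wp_asgn => //; set st1 := set_reg _ _ _.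
have e1 : eval st1 (Add (Const 3) (twice (twice (twice (Reg rN))))) = (8 * n + 3)%:Z.
  by rewrite /=; lia.
apply: wp_seq; apply: wp_asgn => //; set st2 := set_reg _ _ _.
have p2 : reg st2 rT = p%:Z.
  by rewrite -wp' -init_input -e1.
have n2 : reg st2 rN = n%:Z by [].
have e2 : eval st2 (Sub (Reg rT) (Reg rN)) = p%:Z - n%:Z by rewrite -p2 -n2.
apply: wp_if => //; rewrite e2.
- rewrite subr_gt0 ltz_nat => pn.
  apply: wp_seq; apply: wp_put => //; apply: wp_asgn => //.
  left; split=> //; apply: Rob_infeasible; first exact: budget_wf_real.
  move=> z /= zp; have : (\sum_(i < n) z i <= \sum_(i < n) 1)%N.
    by apply: leq_sum => i _; case: (z i).
  by rewrite zp sum1_card card_ord; lia.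
- rewrite subr_le0 lez_nat => pn.
  apply: wp_main => //; first exact: sel_solver_ok.
  exists [ffun i : 'I_n => (i < p)%N] => /=.
  by rewrite -[RHS](card_below pn); apply: eq_bigr => i _; rewrite ffunE.
Qed.

Theorem corollary5 (R : realType) :
  [/\ rob_poly_time R rep_selection,
      rob_poly_time R selection
    & rob_poly_time R sp_shortest_path].
Proof. by split; [exact: rep_poly|exact: sel_poly|exact: path_poly]. Qed.
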